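(* Let $Z_1, Z_2, \ldots$ be independent, identically distributed random vectors in $\mathbb{R}^2$ with $\mathbb{E}[\|Z_1\|^2] < \infty$ and $\|\mathbb{E}[Z_1]\| \neq 0$. Let $S_0 := 0$ and $S_n := \sum_{i=1}^n Z_i$ for $n \geq 1$, and let $L_n$ denote the length of the perimeter of the convex hull of $\{S_0, S_1, \ldots, S_n\}$. Define \[ \sigma^2 := \frac{4\, \mathbb{E}\big[ \big( (Z_1 - \mathbb{E}[Z_1]) \cdot \mathbb{E}[Z_1] \big)^2 \big]}{\|\mathbb{E}[Z_1]\|^2}, \] and suppose $\sigma^2 > 0$. Then for every $x \in \mathbb{R}$, \[ \lim_{n \to \infty} \Pr\left[ \frac{L_n - \mathbb{E}[L_n]}{\sqrt{\operatorname{Var}[L_n]}} \leq x \right] = \lim_{n \to \infty} \Pr\left[ \frac{L_n - \mathbb{E}[L_n]}{\sqrt{\sigma^2 n}} \leq x \right] = \Phi(x), \] where $\Phi$ is the standard normal distribution function.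
   Context: $\cdot$ denotes the Euclidean inner product and $\|\cdot\|$ the Euclidean norm on $\mathbb{R}^2$. *)

(* Defs.v *)
From HB Require Import structures.
From mathcomp Require Import all_boot all_order all_algebra.
From mathcomp Require Import all_classical all_reals all_analysis.
Set Implicit Arguments. Unset Strict Implicit. Unset Printing Implicit Defensive.
Import Order.TTheory GRing.Theory Num.Theory.
Local Open Scope classical_set_scope.
Local Open Scope ring_scope.

Section Defs.
Context {R : realType}.
Implicit Types p q r : R * R.

Definition cross3 p q r : R := (q.1 - p.1) * (r.2 - p.2) - (q.2 - p.2) * (r.1 - p.1).
Definition dot3 p q r : R := (q.1 - p.1) * (r.1 - p.1) + (q.2 - p.2) * (r.2 - p.2).
Definition dist2 p q : R := Num.sqrt ((q.1 - p.1) ^+ 2 + (q.2 - p.2) ^+ 2).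

Definition on_open_seg p q r : bool :=
  (cross3 p q r == 0) && (0 < dot3 p r q) && (dot3 p r q < dot3 p q q).

(* directed edge p -> q of the boundary of the convex hull of the points of s
   (counterclockwise orientation: every point of s weakly to the left of p->q,
   and no point of s strictly between p and q) *)
Definition hull_edge (s : seq (R * R)) p q : bool :=
  [&& p != q, all (fun r => 0 <= cross3 p q r) s & ~~ has (on_open_seg p q) s].

(* length of the perimeter of the convex hull of the (finite) point set s:
   sum of the lengths of the boundary edges.  When all points are collinear
   the hull is a segment and this gives twice its length (usual convention);
   a single point gives 0. *)
Definition hull_perimeter (s : seq (R * R)) : R :=
  \sum_(p <- undup s) \sum_(q <- undup s | hull_edge s p q) dist2 p q.

(* partial sums S_k = Z_1 + ... + Z_k ; here Z i stands for Z_{i+1} *)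
Definition walk {T : Type} (Z : nat -> T -> R * R) (k : nat) (w : T) : R * R :=
  (\sum_(i < k) (Z i w).1, \sum_(i < k) (Z i w).2).

Definition hull_len {T : Type} (Z : nat -> T -> R * R) (n : nat) (w : T) : R :=
  hull_perimeter [seq walk Z k w | k <- iota 0 n.+1].

End Defs.

Definition iid_seq {d d'} {T : measurableType d} {T' : measurableType d'}
  {R : realType} (P : probability T R) (Z : nat -> T -> T') : Prop :=
  [/\ (forall i, measurable_fun setT (Z i)),
      (forall (s : seq nat) (A : nat -> set T'), uniq s ->
         (forall i, measurable (A i)) ->
         P (\bigcap_(i in [set` s]) (Z i @^-1` A i)) =
         (\prod_(i <- s) P (Z i @^-1` A i))%E)
    & (forall i (A : set T'), measurable A ->
         P (Z i @^-1` A) = P (Z 0 @^-1` A))].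

Definition Phi {R : realType} (x : R) : \bar R :=
  normal_prob (0 : R) 1 `]-oo, x].

(* Main.v *)
(* Let u be the unit vector along E[Z_1] and X_k = S_k . u, Y_k = S_k . u^perp.

   Deterministic part.  For a linear form l, the edges of the hull satisfy
   sum |l(q) - l(p)| = 2 (max l - min l), because each generic level of l is
   crossed by exactly one ascending and one descending edge.  Combined with
   |(x, y)| <= |x| + e|y| + |y - ex| + |y + ex| - 2e|x| this gives
   0 <= L_n - 2 X_n <= (maxima of random walks with negative drift)
                       + 2e (max Y - min Y).
   The maximum M_n of a walk with negative drift satisfies E[M_n^2] = o(n) and
   max Y, -min Y have second moment O(n), so (L_n - 2 X_n) / sqrt n -> 0 in L^2.

   Probabilistic part.  The theorem is thus the central limit theorem for X_n
   followed by Slutsky's argument.  It is proved by Lindeberg's replacement,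
   written as a telescoping sum along the iterates of convolution by N(0, 1/n),
   tested on logistic functions, which are smooth and approximate indicators of
   half-lines. *)
Require Import Defs.
From HB Require Import structures.
From mathcomp Require Import all_boot all_order all_algebra.
From mathcomp Require Import all_classical all_reals all_analysis.
From mathcomp Require Import measurable_realfun ring lra.
Set Implicit Arguments.
Unset Strict Implicit.
Unset Printing Implicit Defensive.
Import Order.TTheory GRing.Theory Num.Theory.
Import numFieldNormedType.Exports.
Local Open Scope classical_set_scope.
Local Open Scope ring_scope.

(** * Edges of the convex hull *)

(** Only second moments are available. The error must vanish in L^2, not just in probability,
    because the centring and the variance are those of L_n itself: L^2 closeness controls both. Two
    moments do not keep the second moment of a negative-drift maximum bounded in n; hence o(n),
    obtained by splitting each step into a part bounded above and a part of small variance.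

    The terms |y - ex| and |y + ex| exploit that Y has no drift: the forms y - ex and -y - ex have
    strictly negative drift for every e > 0, so their widths are known up to negative-drift maxima,
    while their terminal values compensate the term -2e|x|. The driftless fluctuation of Y survives
    only with the factor e, which is fixed small before n grows.

    In the replacement argument no Gaussian variable is ever constructed on the probability space:
    Gaussian steps act on the test function, so only independence of the given steps is needed. The
    logistic function suits this because its derivatives are polynomials in itself. *)

Definition lform {R : realType} (a b : R) (r : R * R) : R := a * r.1 + b * r.2.

Section HullEdges.
Context {R : realType} (a b : R) (ab0 : 0 < a ^+ 2 + b ^+ 2).
Implicit Types (p q r : R * R) (s : seq (R * R)) (t : R).

Notation l := (lform a b).
Notation m := (lform (- b) a).

(** The coordinates [(l, m)] are a rotation followed by a dilation whose squared ratio is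
    [a ^+ 2 + b ^+ 2], so signed areas scale by that factor. *)
Lemma cross3_lform p q r : (a ^+ 2 + b ^+ 2) * cross3 p q r =
  (l q - l p) * (m r - m p) - (m q - m p) * (l r - l p).
Proof. by rewrite /cross3 /lform; ring. Qed.

Lemma lform_inj p q : l p = l q -> m p = m q -> p = q.
Proof.
move=> lpq mpq.
have e1 : (a ^+ 2 + b ^+ 2) * (p.1 - q.1) = 0.
  transitivity (a * (l p - l q) - b * (m p - m q)); first by rewrite /lform; ring.
  by rewrite lpq mpq !subrr !mulr0 subrr.
have e2 : (a ^+ 2 + b ^+ 2) * (p.2 - q.2) = 0.
  transitivity (b * (l p - l q) + a * (m p - m q)); first by rewrite /lform; ring.
  by rewrite lpq mpq !subrr !mulr0 addr0.
move/eqP: e1; rewrite mulf_eq0 (gt_eqF ab0)/= subr_eq0 => /eqP e1.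
move/eqP: e2; rewrite mulf_eq0 (gt_eqF ab0)/= subr_eq0 => /eqP e2.
by case: p q e1 e2 {lpq mpq} => [? ?] [? ?] /= -> ->.
Qed.

Lemma on_open_seg_between p q r :
  l p < l q -> on_open_seg p q r -> l p < l r < l q.
Proof.
move=> lpq /andP[/andP[/eqP c0 d0] d1].
(* [dot3 p r q / dot3 p q q] is the barycentric parameter of [r] on the line through [p] and [q];
   for collinear points the affine form [l] yields the same parameter. *)
have e : dot3 p q q * (l r - l p) = dot3 p r q * (l q - l p).
  apply/eqP; rewrite -subr_eq0; apply/eqP.
  transitivity (cross3 p q r * (b * (q.1 - p.1) - a * (q.2 - p.2))).
    by rewrite /cross3 /dot3 /lform; ring.
  by rewrite c0 mul0r.
have dq : 0 < dot3 p q q by apply: lt_trans d1.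
rewrite -subr_gt0 -(subr_gt0 (l r)) -(pmulr_rgt0 _ dq) e.
rewrite mulr_gt0 ?subr_gt0//=.
suff : 0 < dot3 p q q * (l q - l r) by rewrite (pmulr_rgt0 _ dq) subr_gt0.
have -> : dot3 p q q * (l q - l r) = (dot3 p q q - dot3 p r q) * (l q - l p).
  by rewrite mulrBl -e; ring.
by rewrite mulr_gt0// subr_gt0.
Qed.

Lemma between_on_open_seg p q r : cross3 p q r = 0 -> l p < l r -> l r < l q ->
  on_open_seg p q r.
Proof.
move=> c0 pr rq; have pq := lt_trans pr rq.
have e : (l q - l p) * dot3 p r q = (l r - l p) * dot3 p q q.
  apply/eqP; rewrite -subr_eq0; apply/eqP.
  transitivity (cross3 p q r * (a * (q.2 - p.2) - b * (q.1 - p.1))).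
    by rewrite /cross3 /dot3 /lform; ring.
  by rewrite c0 mul0r.
have d : 0 < dot3 p q q.
  rewrite /dot3 -!expr2 lt0r addr_ge0 ?sqr_ge0// andbT.
  rewrite paddr_eq0 ?sqr_ge0// !sqrf_eq0 !subr_eq0.
  apply/negP => /andP[/eqP q1 /eqP q2]; move: pq.
  by rewrite /lform q1 q2 ltxx.
rewrite /on_open_seg c0 eqxx/=; apply/andP; split.
  by rewrite -(pmulr_rgt0 (dot3 p r q) (_ : 0 < l q - l p)) ?e ?mulr_gt0 ?subr_gt0.
rewrite -subr_gt0 -(pmulr_rgt0 _ (_ : 0 < l q - l p)) ?subr_gt0//.
have -> : (l q - l p) * (dot3 p q q - dot3 p r q) = (l q - l r) * dot3 p q q.
  by rewrite mulrBr e; ring.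
by rewrite mulr_gt0 ?subr_gt0.
Qed.

Lemma argmin_seq (I : eqType) (f : I -> R) (x0 : I) (s : seq I) : x0 \in s ->
  exists2 x, x \in s & forall y, y \in s -> f x <= f y.
Proof.
elim: s x0 => // z s IH x0 _.
have [->|[y ys]] : s = [::] \/ exists y, y \in s.
- by case: s {IH} => [|y s]; [left|right; exists y; rewrite mem_head].
- by exists z; rewrite ?mem_head// => y; rewrite mem_seq1 => /eqP ->.
have [x xs xmin] := IH _ ys.
have [zx|xz] := leP (f z) (f x).
- exists z; rewrite ?mem_head// => w; rewrite inE => /predU1P[->//|ws].
  exact: le_trans (xmin _ ws).
- exists x; first by rewrite inE xs orbT.
  by move=> w; rewrite inE => /predU1P[->|/xmin//]; exact: ltW.
Qed.

(* second coordinate of the point where the line (pq) meets {l = t}, in the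
   orthogonal coordinates (l, m) *)
Let height t p q : R := ((l q - t) * m p + (t - l p) * m q) / (l q - l p).

(** For [t < l q] the sign of the change is that of [cross3 p q r]: moving the left end to a point
    on the right of [p -> q] lowers the chord. *)
Let heightBl t p q r : l p < l q -> l r < l q ->
  height t r q - height t p q =
  (l q - t) * ((a ^+ 2 + b ^+ 2) * cross3 p q r) / ((l q - l p) * (l q - l r)).
Proof.
move=> pq rq; rewrite cross3_lform /height.
have ? : l q - l p != 0 by rewrite gt_eqF// subr_gt0.
have ? : l q - l r != 0 by rewrite gt_eqF// subr_gt0.
by field; apply/andP.
Qed.

Let heightBr t p q r : l p < l q -> l p < l r ->
  height t p r - height t p q =
  (t - l p) * ((a ^+ 2 + b ^+ 2) * cross3 p q r) / ((l q - l p) * (l r - l p)).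
Proof.
move=> pq pr; rewrite cross3_lform /height.
have ? : l q - l p != 0 by rewrite gt_eqF// subr_gt0.
have ? : l r - l p != 0 by rewrite gt_eqF// subr_gt0.
by field; apply/andP.
Qed.

(** The chord [p' q'] meets the level at an affine combination of its ends, so its elevation over
    the line [p q] combines the two signed areas with the same weights. *)
Let heightB t p q p' q' : l p < l q -> l p' < l q' ->
  height t p' q' - height t p q =
  (a ^+ 2 + b ^+ 2) *
  ((l q' - t) * cross3 p q p' + (t - l p') * cross3 p q q') /
    ((l q - l p) * (l q' - l p')).
Proof.
move=> pq pq'.
rewrite mulrDr (mulrCA _ (l q' - t)) (mulrCA _ (t - l p')) !cross3_lform /height.
have ? : l q - l p != 0 by rewrite gt_eqF// subr_gt0.
have ? : l q' - l p' != 0 by rewrite gt_eqF// subr_gt0.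
by field; apply/andP.
Qed.

(* the edge is the lower tangent of the two halves: it minimizes [height] and,
   among the minimizers, the length *)
Lemma crossing_edge_exists s t p0 q0 : (forall r, r \in s -> l r != t) ->
  p0 \in s -> q0 \in s -> l p0 < t -> t < l q0 ->
  exists p q, [/\ p \in s, q \in s, hull_edge s p q, l p < t & t < l q].
Proof.
move=> st p0s q0s p0t q0t.
pose S := [seq (p, q) | p <- [seq p <- s | l p < t], q <- [seq q <- s | t < l q]].
have SP x : (x \in S) = [&& x.1 \in s, l x.1 < t, x.2 \in s & t < l x.2].
  apply/allpairsP/idP => /= [[y [+ + ->]]|].
    by rewrite !mem_filter/= => /andP[-> ->] /andP[-> ->].
  case: x => p q /= /and4P[ps pt qs qt]; exists (p, q).
  by rewrite !mem_filter/= ps pt qs qt.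
have S0 : (p0, q0) \in S by rewrite SP /= p0s p0t q0s q0t.
have [x xS xmin] := argmin_seq (fun x => height t x.1 x.2) S0.
pose S' := [seq y <- S | height t y.1 y.2 == height t x.1 x.2].
have xS' : x \in S' by rewrite mem_filter eqxx.
have [[p q]] := argmin_seq (fun x => l x.2 - l x.1) xS'.
rewrite mem_filter/= => /andP[/eqP hpq pqS] dmin.
have {}xmin y : y \in S -> height t p q <= height t y.1 y.2.
  by rewrite hpq => /xmin.
move: (pqS); rewrite SP /= => /and4P[ps pt qs qt].
have pq := lt_trans pt qt.
exists p, q; split => //; apply/and3P; split.
- by apply/eqP => e; rewrite e ltxx in pq.
(* A point strictly to the right of [p -> q] could replace the endpoint on its own side of the level
   and would strictly lower the height. *)
- apply/allP => r rs; rewrite leNgt; apply/negP => c0.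
  have := st _ rs; rewrite neq_lt => /orP[rt|tr].
  + have rq := lt_trans rt qt.
    have /xmin /= : (r, q) \in S by rewrite SP /= rs rt qs qt.
    rewrite -subr_ge0 heightBl// leNgt => /negP; apply.
    rewrite pmulr_llt0 ?invr_gt0 ?mulr_gt0 ?subr_gt0//.
    by rewrite pmulr_rlt0 ?subr_gt0// pmulr_rlt0.
  + have pr := lt_trans pt tr.
    have /xmin /= : (p, r) \in S by rewrite SP /= ps pt rs tr.
    rewrite -subr_ge0 heightBr// leNgt => /negP; apply.
    rewrite pmulr_llt0 ?invr_gt0 ?mulr_gt0 ?subr_gt0//.
    by rewrite pmulr_rlt0 ?subr_gt0// pmulr_rlt0.
(* A point of the open segment, put in place of one endpoint, keeps the height but shortens the
   extent along [l], against [dmin]. *)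
- apply/hasPn => r rs; apply/negP => seg.
  have /andP[pr rq] := on_open_seg_between pq seg.
  have c0 : cross3 p q r = 0 by move: seg => /andP[/andP[/eqP]].
  have := st _ rs; rewrite neq_lt => /orP[rt|tr].
  + have /dmin /= : (r, q) \in S'.
      rewrite mem_filter SP /= rs rt qs qt !andbT -hpq -subr_eq0 heightBl//.
      by rewrite c0 mulr0 mulr0 mul0r.
    by rewrite lerD2l lerN2 leNgt pr.
  + have /dmin /= : (p, r) \in S'.
      rewrite mem_filter SP /= rs tr ps pt !andbT -hpq -subr_eq0 heightBr//.
      by rewrite c0 mulr0 mulr0 mul0r.
    by rewrite lerD2r leNgt rq.
Qed.

(** Each edge has the ends of the other weakly on its left, so both height differences are
    nonnegative; being opposite, they vanish. A zero sum of nonnegative terms with positive weights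
    then kills both signed areas. *)
Let crossing_edge_cross0 s t p q p' q' :
  p \in s -> q \in s -> p' \in s -> q' \in s ->
  hull_edge s p q -> hull_edge s p' q' ->
  l p < t -> t < l q -> l p' < t -> t < l q' ->
  cross3 p q p' = 0 /\ cross3 p q q' = 0.
Proof.
move=> ps qs ps' qs' /and3P[_ /allP c _] /and3P[_ /allP c' _] pt qt pt' qt'.
have pq := lt_trans pt qt; have pq' := lt_trans pt' qt'.
have h1 : 0 <= height t p q - height t p' q'.
  rewrite heightB// divr_ge0//.
    by rewrite mulr_ge0 ?(ltW ab0)// addr_ge0// mulr_ge0 ?c'// subr_ge0 ltW.
  by rewrite mulr_ge0// subr_ge0 ltW.
have h2 : height t p' q' - height t p q <= 0 by rewrite subr_le0 -subr_ge0.
move: h2; rewrite heightB// ler_pdivrMr ?mul0r ?mulr_gt0 ?subr_gt0//.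
rewrite pmulr_rle0// => h.
have k1 : 0 <= (l q' - t) * cross3 p q p' by rewrite mulr_ge0 ?c// subr_ge0 ltW.
have k2 : 0 <= (t - l p') * cross3 p q q' by rewrite mulr_ge0 ?c// subr_ge0 ltW.
have : (l q' - t) * cross3 p q p' + (t - l p') * cross3 p q q' == 0.
  by rewrite eq_le h addr_ge0.
rewrite paddr_eq0// 2!mulf_eq0 (subr_eq0 (l q')) (subr_eq0 t).
by rewrite (gt_eqF qt') (gt_eqF pt')/= => /andP[/eqP -> /eqP ->].
Qed.

Lemma crossing_edge_unique s t p q p' q' :
  p \in s -> q \in s -> p' \in s -> q' \in s ->
  hull_edge s p q -> hull_edge s p' q' ->
  l p < t -> t < l q -> l p' < t -> t < l q' -> p = p' /\ q = q'.
Proof.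
move=> ps qs ps' qs' e e' pt qt pt' qt'.
have pq := lt_trans pt qt; have pq' := lt_trans pt' qt'.
have [c1 c2] :=
  crossing_edge_cross0 ps qs ps' qs' e e' pt qt pt' qt'.
have [c1' c2'] :=
  crossing_edge_cross0 ps' qs' ps qs e' e pt' qt' pt qt.
move: e e' => /and3P[_ _ /hasPn n] /and3P[_ _ /hasPn n'].
(* The edges are collinear. If their left ends differed, one of these would lie strictly inside the
   other edge, which [hull_edge] forbids. *)
have lpp : l p = l p'.
  apply/le_anti; rewrite !leNgt; apply/andP; split; apply/negP => h.
  - move/negP: (n' _ ps); apply.
    by apply: between_on_open_seg => //; exact: lt_trans qt'.
  - move/negP: (n _ ps'); apply.
    by apply: between_on_open_seg => //; exact: lt_trans qt.
have lqq : l q = l q'.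
  apply/le_anti; rewrite !leNgt; apply/andP; split; apply/negP => h.
  - move/negP: (n _ qs'); apply.
    by apply: between_on_open_seg => //; exact: lt_trans qt'.
  - move/negP: (n' _ qs); apply.
    by apply: between_on_open_seg => //; exact: lt_trans qt.
split; apply: lform_inj => //.
- have := cross3_lform p q p'; rewrite c1 mulr0 lpp subrr mulr0 subr0.
  move/esym/eqP; rewrite mulf_eq0 subr_eq0 (gt_eqF (_ : l p' < l q)) ?lqq//=.
  by rewrite subr_eq0 => /eqP.
- have := cross3_lform p q q'; rewrite c2 mulr0 lqq.
  rewrite (mulrC (_ - _) (l q' - l p)) -mulrBr.
  move/esym/eqP; rewrite mulf_eq0 subr_eq0 (gt_eqF (_ : l p < l q')) ?lpp//=.
  by rewrite subr_eq0 (inj_eq (addIr _)) => /eqP.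
Qed.

End HullEdges.

(** * Width of the hull from the projections of its edges *)

Section HullWidth.
Context {R : realType}.
Implicit Types (p q r : R * R) (s : seq (R * R)) (t : R).

Lemma lformN a b r : @lform R (- a) (- b) r = - lform a b r.
Proof. by rewrite /lform; ring. Qed.

(** [crossing_edge_exists] gives at least one ascending edge through the level and
    [crossing_edge_unique] at most one. *)
Lemma count_up_edges a b s t : 0 < a ^+ 2 + b ^+ 2 ->
  (forall r, r \in s -> lform a b r != t) ->
  \sum_(p <- undup s) \sum_(q <- undup s | hull_edge s p q)
    ((lform a b p < t) && (t < lform a b q))%:R =
  (has (fun p => lform a b p < t) s && has (fun q => t < lform a b q) s)%:R :> R.
Proof.
move=> ab0 st.
have [/andP[/hasP[p0 p0s p0t] /hasP[q0 q0s q0t]]|] := boolP (_ && _).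
  have [p [q [ps qs epq pt qt]]] :=
    crossing_edge_exists ab0 st p0s q0s p0t q0t.
  rewrite (bigD1_seq p) ?undup_uniq ?mem_undup//= [X in _ + X]big1_seq ?addr0.
    rewrite (big_rem q) ?mem_undup//= epq pt qt/= big1_seq ?addr0// => q'.
    rewrite (rem_filter _ (undup_uniq _)) mem_filter mem_undup/=.
    move=> /and3P[epq' qq qs'].
    case: ltP => // qt'.
    have [_ e] := crossing_edge_unique ab0
       ps qs ps qs' epq epq' pt qt pt qt'.
    by rewrite e eqxx in qq.
  move=> p' /andP[pp]; rewrite mem_undup => ps'.
  rewrite big1_seq// => q' /andP[epq']; rewrite mem_undup => qs'.
  case: ltP => // pt'; case: ltP => // qt'.
  have [e _] := crossing_edge_unique ab0
     ps qs ps' qs' epq epq' pt qt pt' qt'.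
  by rewrite e eqxx in pp.
rewrite negb_and => h; rewrite big1_seq// => p; rewrite mem_undup => /andP[_ ps].
rewrite big1_seq// => q; rewrite mem_undup => /andP[_ qs].
by case/orP: h => /hasPn; [move/(_ _ ps)|move/(_ _ qs)] => /negbTE ->; rewrite ?andbF.
Qed.

(** A finite substitute for integration over levels. Each [j] is a pair (gap, midpoint) of
    consecutive values of [U]; midpoints avoid [U], so every level used is generic. The clause on
    [head 0 U] serves only the induction. *)
Lemma step_repr (U : seq R) : sorted <%R U ->
  exists J : seq (R * R),
  [/\ forall j, j \in J -> head 0 U < j.2,
      forall j, j \in J -> 0 <= j.1 /\ j.2 \notin U &
      {in U &, forall x y : R, y - x = \sum_(j <- J) j.1 * ((j.2 < y)%R%:R - (j.2 < x)%R%:R)}].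
Proof.
elim: U => [_|v [_ _|v' U IH /=]]; first by exists [::]; split.
  exists [::]; split=> // x y; rewrite !mem_seq1 => /eqP -> /eqP ->.
  by rewrite big_nil subrr.
move=> /andP[vv' sU].
have [J [hJ nJ EJ]] := IH sU.
have vU u : u \in v' :: U -> v' <= u.
  rewrite inE => /predU1P[->//|uU].
  move: sU; rewrite (path_sortedE lt_trans) => /andP[/allP/(_ _ uU) /ltW //].
pose mid := (v + v') / 2.
have vm : v < mid by rewrite /mid; lra.
have mv : mid < v' by rewrite /mid; lra.
exists ((v' - v, mid) :: J); split => [j|j|x y].
- rewrite inE => /predU1P[->//|/hJ /=]; exact: lt_trans.
- rewrite inE => /predU1P[->/=|jJ].
    split; first by rewrite subr_ge0 ltW.
    rewrite inE gt_eqF//=; apply/negP => /vU; rewrite leNgt mv//.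
  have [? ?] := nJ _ jJ; split=> //; rewrite inE negb_or; apply/andP; split=> //.
  by rewrite gt_eqF// (lt_trans vv')// (hJ _ jJ).
have E0 x' : x' \in v' :: U ->
    x' - v' = \sum_(j <- J) j.1 * (j.2 < x')%R%:R.
  move=> x'U; rewrite (EJ v' x') ?mem_head//; apply: eq_big_seq => j jJ.
  by rewrite (lt_gtF (hJ _ jJ)) subr0.
have E1 z : z \in v :: v' :: U ->
    z - v = \sum_(j <- (v' - v, mid) :: J) j.1 * (j.2 < z)%R%:R.
  rewrite big_cons/= inE => /predU1P[->|zU].
    rewrite subrr (lt_gtF vm) mulr0 add0r big1_seq// => j /andP[_ jJ].
    by rewrite lt_gtF ?mulr0// (lt_trans vv')// (hJ _ jJ).
  rewrite -(E0 _ zU) (lt_le_trans mv (vU _ zU)) mulr1; ring.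
move=> xU yU.
have -> : y - x = (y - v) - (x - v) by ring.
rewrite (E1 y)// (E1 x)// -sumrB; apply: eq_bigr => j _.
by rewrite mulrBr.
Qed.

(* integrating the number of crossings over the levels *)
Lemma sum_hull_edge_lform a b s (p0 q0 : R * R) : 0 < a ^+ 2 + b ^+ 2 ->
  p0 \in s -> q0 \in s ->
  (forall r, r \in s -> lform a b p0 <= lform a b r <= lform a b q0) ->
  \sum_(p <- undup s) \sum_(q <- undup s | hull_edge s p q)
     `|lform a b q - lform a b p| = 2 * (lform a b q0 - lform a b p0).
Proof.
move=> ab0 p0s q0s pq0; set f := lform a b.
pose U := sort <=%R (undup (map f s)).
have sU : sorted <%R U by rewrite sort_lt_sorted undup_uniq.
have mU r : r \in s -> f r \in U.
  by move=> rs; rewrite mem_sort mem_undup map_f.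
have [J [_ nJ EJ]] := step_repr sU.
have absE p q : p \in s -> q \in s -> `|f q - f p| =
    \sum_(j <- J) j.1 * (((f p < j.2) && (j.2 < f q))%:R +
                          ((f q < j.2) && (j.2 < f p))%:R).
  move=> ps qs.
  wlog pq : p q ps qs / f p <= f q.
    move=> H; have [pq|/ltW pq] := leP (f p) (f q); first exact: H.
    rewrite distrC (H q p)//; apply: eq_bigr => j _; by rewrite addrC.
  rewrite ger0_norm ?subr_ge0// (EJ (f p) (f q)) ?mU//.
  apply: eq_big_seq => j jJ; congr (_ * _).
  have [_ jU] := nJ _ jJ.
  have jp : j.2 != f p by apply: contraNneq jU => ->; exact: mU.
  have jq : j.2 != f q by apply: contraNneq jU => ->; exact: mU.
  have np : (f p < j.2) = ~~ (j.2 < f p).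
    by rewrite -leNgt le_eqVlt eq_sym (negbTE jp).
  have nq : (f q < j.2) = ~~ (j.2 < f q).
    by rewrite -leNgt le_eqVlt eq_sym (negbTE jq).
  have : (j.2 < f p) ==> (j.2 < f q) by apply/implyP => h; exact: lt_le_trans h pq.
  rewrite np nq; case: (j.2 < f p); case: (j.2 < f q) => //= _;
    by rewrite ?subr0 ?addr0 ?subrr.
transitivity (\sum_(j <- J) j.1 * 2 * ((j.2 < f q0)%R%:R - (j.2 < f p0)%R%:R)); last first.
  by rewrite (EJ (f p0) (f q0)) ?mU// mulr_sumr; apply: eq_bigr => j _; ring.
transitivity (\sum_(p <- undup s) \sum_(q <- undup s | hull_edge s p q)
   \sum_(j <- J) j.1 * (((f p < j.2) && (j.2 < f q))%:R +
                          ((f q < j.2) && (j.2 < f p))%:R)).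
  apply: eq_big_seq => p; rewrite mem_undup => ps.
  rewrite big_seq_cond [RHS]big_seq_cond; apply: eq_bigr => q.
  by rewrite mem_undup => /andP[qs _]; exact: absE.
under eq_bigr do rewrite exchange_big/=.
rewrite exchange_big/=; apply: eq_big_seq => j jJ.
under eq_bigr do rewrite -mulr_sumr.
rewrite -mulr_sumr -mulrA; congr (_ * _).
under eq_bigr do rewrite big_split/=.
rewrite big_split/=.
have [_ jU] := nJ _ jJ.
have jN r : r \in s -> f r != j.2 by move=> rs; apply: contraNneq jU => <-; exact: mU.
rewrite count_up_edges//.
(* Descending edges for [l] at a level are ascending edges for [- l] at the opposite level, so the
   same count applies. *)
have -> : \sum_(p <- undup s) \sum_(q <- undup s | hull_edge s p q)
    ((f q < j.2) && (j.2 < f p))%:R =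
   (has (fun p => lform (- a) (- b) p < - j.2) s &&
    has (fun q => - j.2 < lform (- a) (- b) q) s)%:R :> R.
  rewrite -count_up_edges.
  - apply: eq_bigr => p _; apply: eq_bigr => q _.
    by rewrite !lformN !ltrN2 andbC.
  - by rewrite !sqrrN.
  - by move=> r rs; rewrite lformN eqr_opp jN.
have -> : has (fun p => lform (- a) (- b) p < - j.2) s = has (fun p => j.2 < f p) s.
  by apply: eq_has => r; rewrite lformN ltrN2.
have -> : has (fun p => - j.2 < lform (- a) (- b) p) s = has (fun p => f p < j.2) s.
  by apply: eq_has => r; rewrite lformN ltrN2.
have -> : has (fun p => j.2 < f p) s = (j.2 < f q0).
  apply/hasP/idP => [[r rs jr]|h]; last by exists q0.
  by apply: lt_le_trans jr _; have /andP[] := pq0 _ rs.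
have -> : has (fun p => f p < j.2) s = ~~ (j.2 < f p0).
  rewrite -leNgt le_eqVlt (negbTE (jN _ p0s))/=.
  apply/hasP/idP => [[r rs jr]|h]; last by exists p0.
  by apply: le_lt_trans jr; have /andP[] := pq0 _ rs.
have : (j.2 < f p0) ==> (j.2 < f q0).
  apply/implyP => h; apply: lt_le_trans h _.
  by have /andP[] := pq0 _ p0s.
by case: (j.2 < f p0); case: (j.2 < f q0) => //= _; ring.
Qed.

Lemma sum_hull_edge_lform_ge a b s p q : 0 < a ^+ 2 + b ^+ 2 ->
  p \in s -> q \in s ->
  2 * (lform a b q - lform a b p) <=
  \sum_(p <- undup s) \sum_(q <- undup s | hull_edge s p q)
     `|lform a b q - lform a b p|.
Proof.
move=> ab0 ps qs.
have [p0 p0s hp] := argmin_seq (lform a b) ps.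
have [q0 q0s hq] := argmin_seq (lform (- a) (- b)) ps.
have {}hq r : r \in s -> lform a b r <= lform a b q0.
  by move=> /hq; rewrite !lformN lerN2.
rewrite (sum_hull_edge_lform ab0 p0s q0s)//.
  by rewrite ler_pM2l// lerB ?hp ?hq.
by move=> r rs; rewrite hp ?hq.
Qed.

Lemma sum_hull_edge_lform_le a b s (u v : R) : 0 < a ^+ 2 + b ^+ 2 ->
  s != [::] ->
  (forall r, r \in s -> u <= lform a b r <= v) ->
  \sum_(p <- undup s) \sum_(q <- undup s | hull_edge s p q)
     `|lform a b q - lform a b p| <= 2 * (v - u).
Proof.
move=> ab0 s0 uv.
have [x xs] : exists x, x \in s.
  by case: s s0 {uv} => // x s _; exists x; rewrite mem_head.
have [p0 p0s hp] := argmin_seq (lform a b) xs.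
have [q0 q0s hq] := argmin_seq (lform (- a) (- b)) xs.
have {}hq r : r \in s -> lform a b r <= lform a b q0.
  by move=> /hq; rewrite !lformN lerN2.
rewrite (sum_hull_edge_lform ab0 p0s q0s)//.
  rewrite ler_pM2l// lerB//; first by have /andP[] := uv _ q0s.
  by have /andP[] := uv _ p0s.
by move=> r rs; rewrite hp ?hq.
Qed.

End HullWidth.

(** * Expectation and independence *)

Section Expectation.
Context {d : measure_display} {T : measurableType d} {R : realType}.
Variable P : probability T R.
Implicit Types (X Y : T -> R) (c : R).

Definition itg X := P.-integrable setT (EFin \o X).
(** Real-valued so that [ring] and [lra] apply; an infinite integral is sent to 0, hence the [itg]
    hypotheses that accompany it. *)
Definition Ex X : R := (\int[P]_w X w)%R.

Lemma itg_measurable X : itg X -> measurable_fun setT X.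
Proof. by move=> /measurable_int /measurable_EFinP. Qed.

Lemma itgD X Y : itg X -> itg Y -> itg (fun w => X w + Y w).
Proof. by move=> iX iY; exact: (integrableD measurableT iX iY). Qed.

Lemma itgZ c X : itg X -> itg (fun w => c * X w).
Proof. by move=> iX; exact: (integrableZl measurableT c iX). Qed.

Lemma itgN X : itg X -> itg (fun w => - X w).
Proof. by move=> iX; exact: (integrableN iX). Qed.

Lemma itgB X Y : itg X -> itg Y -> itg (fun w => X w - Y w).
Proof. by move=> iX iY; apply: itgD => //; exact: itgN. Qed.

Lemma itg_cst c : itg (fun=> c).
Proof. exact: finite_measure_integrable_cst. Qed.

Lemma itg_le X Y : measurable_fun setT X -> itg Y ->
  (forall w, `|X w| <= Y w) -> itg X.
Proof.
move=> mX iY XY; apply: (le_integrable measurableT _ _ iY).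
  exact/measurable_EFinP.
by move=> w _ /=; rewrite lee_fin (le_trans (XY w))// ler_norm.
Qed.

Lemma itg_norm X : itg X -> itg (fun w => `|X w|).
Proof. by move=> iX; exact: (integrable_abse iX). Qed.

Lemma itg_bounded c X : measurable_fun setT X -> (forall w, `|X w| <= c) -> itg X.
Proof. by move=> mX Xc; exact: (itg_le mX (itg_cst c)). Qed.

Lemma ExE X : itg X -> (\int[P]_w (X w)%:E = (Ex X)%:E)%E.
Proof. by move=> iX; rewrite /Ex /Rintegral fineK//; exact: integrable_fin_num. Qed.

Lemma ExD X Y : itg X -> itg Y -> Ex (fun w => X w + Y w) = Ex X + Ex Y.
Proof. by move=> iX iY; rewrite /Ex RintegralD. Qed.

Lemma ExB X Y : itg X -> itg Y -> Ex (fun w => X w - Y w) = Ex X - Ex Y.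
Proof. by move=> iX iY; rewrite /Ex RintegralB. Qed.

Lemma ExZ c X : itg X -> Ex (fun w => c * X w) = c * Ex X.
Proof. by move=> iX; rewrite /Ex RintegralZl. Qed.

Lemma Ex_cst c : Ex (fun=> c) = c.
Proof.
transitivity (c * fine (P setT)); first exact: Rintegral_cst.
by rewrite probability_setT mulr1.
Qed.

Lemma Ex_le X Y : itg X -> itg Y -> (forall w, X w <= Y w) -> Ex X <= Ex Y.
Proof. by move=> iX iY XY; apply: le_Rintegral. Qed.

Lemma Ex_ge0 X : (forall w, 0 <= X w) -> 0 <= Ex X.
Proof. by move=> X0; apply: Rintegral_ge0. Qed.

Lemma Ex_norm X : itg X -> `|Ex X| <= Ex (fun w => `|X w|).
Proof. by move=> iX; exact: le_normr_Rintegral. Qed.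

Lemma Ex_norm_le X c : itg X -> (forall w, `|X w| <= c) -> `|Ex X| <= c.
Proof.
move=> iX Xc; apply: le_trans (Ex_norm iX) _; rewrite -[leRHS]Ex_cst.
by apply: Ex_le => //; [exact/itg_norm|exact: itg_cst].
Qed.

Lemma Ex_normB_le X Y c : itg X -> itg Y -> (forall w, `|X w - Y w| <= c) ->
  `|Ex X - Ex Y| <= c.
Proof.
by move=> iX iY XY; rewrite -ExB//; apply: Ex_norm_le => //; exact: itgB.
Qed.

Definition sq X := measurable_fun setT X /\ itg (fun w => X w ^+ 2).

Lemma sq_itgM X Y : sq X -> sq Y -> itg (fun w => X w * Y w).
Proof.
move=> [mX iX] [mY iY]; apply: (itg_le _ (itgD iX iY)).
  exact: measurable_funM.
move=> w; rewrite normrM -(real_normK (num_real (X w))) -(real_normK (num_real (Y w))).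
by have := sqr_ge0 (`|X w| - `|Y w|); have := mulr_ge0 (normr_ge0 (X w)) (normr_ge0 (Y w)); nra.
Qed.

Lemma sq_cst c : sq (fun=> c).
Proof. by split => //; exact: itg_cst. Qed.

Lemma sq_itg X : sq X -> itg X.
Proof.
move=> sX; have := sq_itgM sX (sq_cst 1).
by under eq_fun do rewrite mulr1.
Qed.

Lemma sqZ c X : sq X -> sq (fun w => c * X w).
Proof.
move=> [mX iX]; split; first exact: measurable_funM.
by under eq_fun do rewrite exprMn; exact: itgZ.
Qed.

Lemma sqN X : sq X -> sq (fun w => - X w).
Proof. by move/(sqZ (-1)); under eq_fun do rewrite mulN1r. Qed.

Lemma sqD X Y : sq X -> sq Y -> sq (fun w => X w + Y w).
Proof.
move=> sX sY; have iXY := sq_itgM sX sY; case: sX sY => [mX iX] [mY iY].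
split; first exact: measurable_funD.
under eq_fun do rewrite sqrrD -mulr_natl.
by apply: itgD => //; apply: itgD => //; exact: itgZ.
Qed.

Lemma sqB X Y : sq X -> sq Y -> sq (fun w => X w - Y w).
Proof. by move=> sX sY; apply: sqD => //; exact: sqN. Qed.

Lemma sq_le X Y : measurable_fun setT X -> sq Y ->
  (forall w, `|X w| <= `|Y w|) -> sq X.
Proof.
move=> mX [mY iY] XY; split=> //; apply: (itg_le _ iY).
  exact: measurable_funX.
by move=> w; rewrite normrX -[leRHS]real_normK ?num_real// lerXn2r ?nnegrE.
Qed.

Lemma Ex_sqrD X Y : sq X -> sq Y -> Ex (fun w => (X w + Y w) ^+ 2) =
  Ex (fun w => X w ^+ 2) + 2 * Ex (fun w => X w * Y w) + Ex (fun w => Y w ^+ 2).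
Proof.
move=> sX sY; have iXY := sq_itgM sX sY; case: sX sY => [mX iX] [mY iY].
under [in LHS]eq_fun do rewrite sqrrD -mulr_natl.
rewrite ExD//; last by apply: itgD => //; exact: itgZ.
by rewrite ExD//; [rewrite ExZ|exact: itgZ].
Qed.

Lemma Ex_sqr X : sq X -> Ex X ^+ 2 <= Ex (fun w => X w ^+ 2).
Proof.
move=> sX; rewrite -subr_ge0.
have <- : Ex (fun w => (X w + - Ex X) ^+ 2) = Ex (fun w => X w ^+ 2) - Ex X ^+ 2.
  rewrite Ex_sqrD//; last exact: sq_cst.
  rewrite Ex_cst; under [X in 2 * Ex X]eq_fun do rewrite mulrC.
  by rewrite ExZ; [ring|exact: sq_itg].
by apply: Ex_ge0 => w; exact: sqr_ge0.
Qed.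

End Expectation.

Section SameLaw.
Context {d d' d'' : measure_display} {T : measurableType d}
  {T' : measurableType d'} {U : measurableType d''} {R : realType}.
Variables (P : probability T R) (P' : probability T' R) (X : T -> U) (Y : T' -> U).
Hypotheses (mX : measurable_fun setT X) (mY : measurable_fun setT Y).
Hypothesis XY : forall A, measurable A -> P (X @^-1` A) = P' (Y @^-1` A).

(** Both sides integrate [h] against the common image measure. Two probability spaces are allowed so
    that the result also covers translated Gaussian measures. *)
Lemma ge0_same_law (h : U -> \bar R) : measurable_fun setT h ->
  (forall u, 0 <= h u)%E -> (\int[P]_w h (X w) = \int[P']_w h (Y w))%E.
Proof.
move=> mh h0.
pose X' : {mfun T >-> U} := HB.pack X (isMeasurableFun.Build _ _ _ _ _ mX).
pose Y' : {mfun T' >-> U} := HB.pack Y (isMeasurableFun.Build _ _ _ _ _ mY).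
have := @ge0_integral_distribution _ _ _ _ _ P X' _ mh h0.
have := @ge0_integral_distribution _ _ _ _ _ P' Y' _ mh h0.
rewrite /= => <- <-; apply: eq_measure_integral => A mA _.
exact: XY.
Qed.

Lemma itg_same_law (h : U -> R) : measurable_fun setT h ->
  itg P (h \o X) -> itg P' (h \o Y).
Proof.
move=> mh /integrableP[_ iX]; apply/integrableP; split.
  exact/measurable_EFinP/measurableT_comp.
rewrite -(ge0_same_law (h := fun u => `|(h u)%:E|%E))//.
by apply: measurableT_comp => //; exact/measurable_EFinP.
Qed.

Lemma Ex_same_law (h : U -> R) : measurable_fun setT h ->
  Ex P (h \o X) = Ex P' (h \o Y).
Proof.
move=> mh; rewrite /Ex /Rintegral; congr fine.
rewrite integralE [RHS]integralE.
have mh' : measurable_fun setT (EFin \o h) by exact/measurable_EFinP.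
congr (_ - _)%E.
- transitivity (\int[P]_w (EFin \o h)^\+ (X w))%E.
    by apply: eq_integral => w _; rewrite !funeposE.
  rewrite (ge0_same_law (measurable_funepos mh'))//.
  by apply: eq_integral => w _; rewrite !funeposE.
- transitivity (\int[P]_w (EFin \o h)^\- (X w))%E.
    by apply: eq_integral => w _; rewrite !funenegE.
  rewrite (ge0_same_law (measurable_funeneg mh'))//.
  by apply: eq_integral => w _; rewrite !funenegE.
Qed.

End SameLaw.

Section Independence.
Context {d : measure_display} {T : measurableType d} {R : realType}.
Variable P : probability T R.

Definition indep (X Y : T -> R) := forall A B, measurable A -> measurable B ->
  P (X @^-1` A `&` Y @^-1` B) = (P (X @^-1` A) * P (Y @^-1` B))%E.

Lemma indep_comp X Y (f g : R -> R) : measurable_fun setT f ->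
  measurable_fun setT g -> indep X Y -> indep (f \o X) (g \o Y).
Proof.
move=> mf mg XY A B mA mB; apply: (XY (f @^-1` A) (g @^-1` B)).
- by rewrite -[X in measurable X]setTI; exact: mf.
- by rewrite -[X in measurable X]setTI; exact: mg.
Qed.

(** Independence says that the joint law agrees with the product measure on rectangles, hence
    everywhere; Tonelli then factors the integral. *)
Lemma ge0_indep_mul X Y : measurable_fun setT X -> measurable_fun setT Y ->
  indep X Y -> (forall w, 0 <= X w) -> (forall w, 0 <= Y w) ->
  (\int[P]_w (X w * Y w)%:E = (\int[P]_w (X w)%:E) * (\int[P]_w (Y w)%:E))%E.
Proof.
move=> mX mY XY X0 Y0.
pose X' : {mfun T >-> R} := HB.pack X (isMeasurableFun.Build _ _ _ _ _ mX).
pose Y' : {mfun T >-> R} := HB.pack Y (isMeasurableFun.Build _ _ _ _ _ mY).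
have mXY : measurable_fun setT (fun w => (X w, Y w)) by exact: measurable_fun_pair.
pose XY' : {mfun T >-> (R * R)%type} :=
  HB.pack (fun w => (X w, Y w)) (isMeasurableFun.Build _ _ _ _ _ mXY).
(* Tonelli needs a nonnegative integrand on the whole plane, not only on the range of [(X, Y)];
   hence the truncations at 0. *)
pose h (u : R * R) : \bar R := (Num.max u.1 0 * Num.max u.2 0)%:E.
have mmax : measurable_fun setT (fun x : R => Num.max x 0).
  exact: measurable_maxr.
have mh : measurable_fun setT h.
  apply/measurable_EFinP; apply: measurable_funM.
    by apply: (measurableT_comp mmax); exact: measurable_fst.
  by apply: (measurableT_comp mmax); exact: measurable_snd.
have h0 u : (0 <= h u)%E by rewrite lee_fin mulr_ge0// le_max lexx orbT.
transitivity (\int[P]_w h (XY' w))%E.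
  by apply: eq_integral => w _; rewrite /h /= !max_l.
have := @ge0_integral_distribution _ _ _ _ _ P XY' _ mh h0; rewrite /= => <-.
transitivity (\int[(distribution P X' \x distribution P Y')%E]_u h u)%E.
  apply: eq_measure_integral => A mA _; apply/esym.
  apply: (@product_measure_unique _ _ _ _ _ (distribution P X') (distribution P Y')
    (distribution P XY')) => // B C mB mC; exact: XY.
rewrite fubini_tonelli1//= /fubini_F.
under eq_integral => x _.
  under eq_integral do rewrite /h /= EFinM.
  rewrite ge0_integralZl//; first last.
  - by rewrite lee_fin le_max lexx orbT.
  - by move=> y _; rewrite lee_fin le_max lexx orbT.
  - exact/measurable_EFinP.
  rewrite muleC; over.
rewrite ge0_integralZl//; first last.
  - by apply: integral_ge0 => y _; rewrite lee_fin le_max lexx orbT.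
  - by move=> y _; rewrite lee_fin le_max lexx orbT.
  - exact/measurable_EFinP.
have mE : measurable_fun setT (fun x : R => (Num.max x 0)%:E) by exact/measurable_EFinP.
have E0 (x : R) : (0 <= (Num.max x 0)%:E)%E by rewrite lee_fin le_max lexx orbT.
rewrite (@ge0_integral_distribution _ _ _ _ _ P X' _ mE E0) (@ge0_integral_distribution _ _ _ _ _ P Y' _ mE E0).
by rewrite muleC; congr (_ * _)%E; apply: eq_integral => w _ /=; rewrite max_l.
Qed.

Lemma indep_itgM X Y : indep X Y -> itg P X -> itg P Y ->
  itg P (fun w => X w * Y w).
Proof.
move=> XY iX iY; have mX := itg_measurable iX; have mY := itg_measurable iY.
apply/integrableP; split; first exact/measurable_EFinP/measurable_funM.
under eq_integral do rewrite /= normrM.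
have mN : measurable_fun setT (fun x : R => `|x|) by exact: normr_measurable.
rewrite (ge0_indep_mul (X := fun w => `|X w|) (Y := fun w => `|Y w|))//;
  [|exact: measurableT_comp|exact: measurableT_comp|
    exact: (@indep_comp X Y (fun x => `|x|) (fun x => `|x|))].
by rewrite (ExE (itg_norm iX)) (ExE (itg_norm iY)) -EFinM ltry.
Qed.

(** Splitting both factors into positive and negative parts reduces to four nonnegative products;
    first moments suffice, without square integrability. *)
Lemma indep_ExM X Y : indep X Y -> itg P X -> itg P Y ->
  Ex P (fun w => X w * Y w) = Ex P X * Ex P Y.
Proof.
move=> XY iX iY; have mX := itg_measurable iX; have mY := itg_measurable iY.
pose p (x : R) := Num.max x 0; pose n (x : R) := Num.max (- x) 0.
have mp : measurable_fun setT p by exact: measurable_maxr.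
have mn : measurable_fun setT n.
  by apply: measurable_maxr => //; exact: measurable_oppr.
have pn x : x = p x - n x.
  rewrite /p /n; case: (leP x 0) => x0.
    by rewrite max_l ?oppr_ge0// sub0r opprK.
  by rewrite max_r ?subr0// oppr_le0 ltW.
have ip Z : itg P Z -> itg P (p \o Z).
  move=> iZ; apply: (itg_le _ (itg_norm iZ)).
    exact: (measurableT_comp mp (itg_measurable iZ)).
  move=> w; rewrite /p /= ger0_norm ?le_max ?lexx ?orbT//.
  by rewrite ge_max ler_norm normr_ge0.
have iN Z : itg P Z -> itg P (n \o Z).
  move=> iZ; apply: (itg_le _ (itg_norm iZ)).
    exact: (measurableT_comp mn (itg_measurable iZ)).
  move=> w; rewrite /n /= ger0_norm ?le_max ?lexx ?orbT//.
  by rewrite ge_max -normrN ler_norm normr_ge0.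
have H (f g : R -> R) : (f = p \/ f = n) -> (g = p \/ g = n) ->
    itg P (fun w => f (X w) * g (Y w)) /\
    Ex P (fun w => f (X w) * g (Y w)) = Ex P (f \o X) * Ex P (g \o Y).
  move=> hf hg.
  have mf : measurable_fun setT f by case: hf => ->.
  have mg : measurable_fun setT g by case: hg => ->.
  have f0 x : 0 <= f x by case: hf => ->; rewrite le_max lexx orbT.
  have g0 x : 0 <= g x by case: hg => ->; rewrite le_max lexx orbT.
  have iX' : itg P (f \o X) by case: hf => ->; [exact: ip|exact: iN].
  have iY' : itg P (g \o Y) by case: hg => ->; [exact: ip|exact: iN].
  have ind := indep_comp mf mg XY.
  have iM := indep_itgM ind iX' iY'; split => //.
  apply/EFin_inj; rewrite -ExE// EFinM -ExE// -ExE//.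
  exact: (ge0_indep_mul (itg_measurable iX') (itg_measurable iY') ind
    (fun w => f0 (X w)) (fun w => g0 (Y w))).
have [i1 e1] := H p p (or_introl erefl) (or_introl erefl).
have [i2 e2] := H p n (or_introl erefl) (or_intror erefl).
have [i3 e3] := H n p (or_intror erefl) (or_introl erefl).
have [i4 e4] := H n n (or_intror erefl) (or_intror erefl).
have -> : (fun w => X w * Y w) = (fun w =>
   ((p (X w) * p (Y w) - p (X w) * n (Y w)) - n (X w) * p (Y w)) + n (X w) * n (Y w)).
  by apply/funext => w; rewrite {1}(pn (X w)) {1}(pn (Y w)); ring.
have EX : Ex P X = Ex P (p \o X) - Ex P (n \o X).
  rewrite -ExB//; [|exact: ip|exact: iN].
  by congr (Ex P _); apply/funext => w; exact: pn.
have EY : Ex P Y = Ex P (p \o Y) - Ex P (n \o Y).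
  rewrite -ExB//; [|exact: ip|exact: iN].
  by congr (Ex P _); apply/funext => w; exact: pn.
rewrite ExD//; last by apply: itgB => //; exact: itgB.
rewrite ExB//; last exact: itgB.
by rewrite ExB// e1 e2 e3 e4 EX EY; ring.
Qed.

End Independence.

Section Past.
Context {d : measure_display} {T : measurableType d} {R : realType}.
Variables (P : probability T R) (xi : nat -> T -> R).
Hypothesis iid : iid_seq P xi.

(** The pi-system generating the sigma-algebra of the steps indexed by [s]. Letting [A] range over
    all of [nat] makes intersections pointwise and matches [iid_seq]. *)
Definition cylinder (s : seq nat) : set (set T) := [set B |
  exists A : nat -> set R, (forall i, measurable (A i)) /\
    B = \bigcap_(i in [set` s]) (xi i @^-1` A i)].

Definition past (s : seq nat) := g_sigma_algebraType (cylinder s).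

Lemma past_measurable s i : i \in s ->
  measurable_fun setT (xi i : past s -> R).
Proof.
move=> si _ A mA; rewrite setTI; apply: sub_sigma_algebra.
exists (fun j => if j == i then A else setT); split.
  by move=> j; case: ifP.
apply/seteqP; split=> [w Aw j /= sj|w /(_ i si)/=]; last by rewrite eqxx.
by case: eqP => // ->.
Qed.

Lemma cylinder_setI s : setI_closed (cylinder s).
Proof.
move=> _ _ [A [mA ->]] [B [mB ->]]; exists (fun i => A i `&` B i); split.
  by move=> i; exact: measurableI.
apply/seteqP; split=> [w [wA wB] i si|w wAB]; first by split; [exact: wA|exact: wB].
by split=> i si; have [] := wAB _ si.
Qed.

(** Dynkin's pi-lambda argument. It yields independence of a step from any functional of other
    steps, in any order of the indices, which both the forward and the reversed walk require. *)
Lemma past_indep s j (G : T -> R) : uniq (j :: s) ->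
  measurable_fun setT (G : past s -> R) -> indep P (xi j) G.
Proof.
move=> /= /andP[js us] mG A B mA mB; have [mxi prodxi _] := iid.
set E := xi j @^-1` A.
have mE : measurable E by rewrite -[E]setTI; exact: mxi.
(* Measurability in [T] is carried along, since [C] is a priori only a set of the generated
   sigma-algebra. *)
pose Q (C : set (past s)) := measurable (C : set T) /\ P (E `&` C) = (P E * P C)%E.
suff : forall C : set (past s), <<s cylinder s >> C -> Q C.
  move=> /(_ (G @^-1` B)) []//.
  by have := mG measurableT B mB; rewrite setTI.
have PEfin C : measurable C -> P C \is a fin_num by move=> mC; exact: fin_num_measure.
apply: (dynkin_induction (T := past s)) => //.
- exact: cylinder_setI.
- by split=> //; rewrite setIT probability_setT mule1.
- move=> _ [D [mD ->]]; split.
    apply: fin_bigcap_measurable => [|i _]; first exact: finite_seq.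
    by rewrite -[X in measurable X]setTI; exact: mxi.
  pose D' i := if i == j then A else D i.
  have mD' i : measurable (D' i) by rewrite /D'; case: ifP.
  have -> : P (\bigcap_(i in [set` s]) (xi i @^-1` D i)) =
            (\prod_(i <- s) P (xi i @^-1` D i))%E by exact: prodxi.
  have -> : E `&` (\bigcap_(i in [set` s]) (xi i @^-1` D i)) =
      \bigcap_(i in [set` j :: s]) (xi i @^-1` D' i).
    apply/seteqP; split=> [w [Ew Dw] i /=|w Dw].
      rewrite inE /D' => /predU1P[->|si]; first by rewrite eqxx.
      by case: eqP => [->//|_]; exact: Dw.
    split; first by have := Dw j; rewrite /D' /= eqxx mem_head; exact.
    move=> i /= si; have := Dw i; rewrite /D' /= inE si orbT => /(_ isT).
    by case: eqP => // ij; rewrite -ij si in js.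
  rewrite prodxi//=; last by rewrite js us.
  rewrite big_cons {1}/D' eqxx; congr (_ * _)%E.
  apply: eq_big_seq => i si; rewrite /D'; case: eqP => // ij.
  by rewrite -ij si in js.
- move=> C mC [mC' PC]; split; first exact: measurableC.
  have PD : (P (E `\` C) = P E - P (E `&` C))%E.
    by apply: measureD => //; rewrite ltey_eq PEfin.
  rewrite -setDE PD PC probability_setC//.
  rewrite -(fineK (PEfin _ mE)) -(fineK (PEfin _ mC')) -EFinM -!EFinB -EFinM.
  by rewrite mulrBr mulr1.
- move=> F mF tF QF; split; first by apply: bigcup_measurable => i _; have [] := QF i.
  have mF' i : measurable (F i : set T) by have [] := QF i.
  have PF : P (\bigcup_k F k) = (\sum_(i <oo | i \in setT) P (F i))%E.
    exact: measure_bigcup.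
  have PEF : P (\bigcup_k (E `&` F k)) = (\sum_(i <oo | i \in setT) P (E `&` F i))%E.
    apply: measure_bigcup => [i _|]; first exact: measurableI.
    exact: trivIset_setIl.
  rewrite setI_bigcupr PEF PF -(fineK (PEfin _ mE)) -nneseriesZl//.
  by apply: eq_eseriesr => i _; have [_ ->] := QF i; rewrite fineK// PEfin.
Qed.

End Past.

(** * Maxima of random walks *)

Section IidBasics.
Context {d : measure_display} {T : measurableType d} {R : realType}.
Variable P : probability T R.

Lemma iid_comp {d'} {U : measurableType d'} {d''} {V : measurableType d''}
    (Z : nat -> T -> U) (f : U -> V) :
  iid_seq P Z -> measurable_fun setT f -> iid_seq P (fun i => f \o Z i).
Proof.
move=> [mZ prodZ idZ] mf.
have mfA A : measurable A -> measurable (f @^-1` A).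
  by move=> mA; rewrite -[X in measurable X]setTI; exact: mf.
split.
- by move=> i; exact: (measurableT_comp mf (mZ i)).
- by move=> s A us mA; apply: (prodZ s (fun i => f @^-1` A i)) => // i; exact: mfA.
- by move=> i A mA; apply: (idZ i (f @^-1` A)); exact: mfA.
Qed.

Lemma iid_same_law {d'} {U : measurableType d'} (Z : nat -> T -> U) (f : U -> R) i :
  iid_seq P Z -> measurable_fun setT f -> itg P (f \o Z 0) ->
  itg P (f \o Z i) /\ Ex P (f \o Z i) = Ex P (f \o Z 0).
Proof.
move=> [mZ _ idZ] mf iZ.
have law A : measurable A -> P (Z 0 @^-1` A) = P (Z i @^-1` A).
  by move=> mA; rewrite idZ.
split; first exact: (itg_same_law (mZ 0%N) (mZ i) law mf iZ).
exact/esym/(Ex_same_law (mZ 0%N) (mZ i) law mf).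
Qed.

Variable xi : nat -> T -> R.
Hypothesis iid : iid_seq P xi.

Lemma iid_measurable i : measurable_fun setT (xi i).
Proof. by case: iid. Qed.

Lemma iid_Ex i : itg P (xi 0) -> itg P (xi i) /\ Ex P (xi i) = Ex P (xi 0).
Proof. by move=> i0; exact: (iid_same_law (f := idfun) i iid (@measurable_id _ _ _) i0). Qed.

Lemma iid_sq i : sq P (xi 0) -> sq P (xi i) /\
  Ex P (fun w => xi i w ^+ 2) = Ex P (fun w => xi 0 w ^+ 2).
Proof.
move=> [_ i0].
have m2 : measurable_fun setT (fun x : R => x ^+ 2) by exact: measurable_funX.
have [i1 e1] := iid_same_law (f := fun x : R => x ^+ 2) i iid m2 i0.
by split=> //; split=> //; exact: iid_measurable.
Qed.

End IidBasics.

(* maximum of the partial sums of [xi] along [s], in Lindley's recursive form *)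
Fixpoint maxsum {T : Type} {R : realType} (xi : nat -> T -> R) (s : seq nat) (w : T) : R :=
  if s is i :: s' then Num.max 0 (xi i w + maxsum xi s' w) else 0.

Section Maxsum.
Context {T : Type} {R : realType}.
Implicit Types (xi : nat -> T -> R) (s : seq nat).

Lemma maxsum_ge0 xi s w : 0 <= maxsum xi s w.
Proof. by case: s => [|i s] //=; rewrite le_max lexx. Qed.

Lemma maxsum_ge xi s k w : \sum_(i <- take k s) xi i w <= maxsum xi s w.
Proof.
elim: s k => [|i s IH] [|k]; rewrite ?big_nil ?maxsum_ge0//=.
by rewrite big_cons le_max lerD2l IH orbT.
Qed.

Lemma maxsum_subadd xi xi1 xi2 s w : (forall i, xi i w <= xi1 i w + xi2 i w) ->
  maxsum xi s w <= maxsum xi1 s w + maxsum xi2 s w.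
Proof.
move=> h; elim: s => [|i s IH] /=; first by rewrite addr0.
rewrite ge_max addr_ge0 ?le_max ?lexx//=.
apply: (@le_trans _ _ ((xi1 i w + maxsum xi1 s w) + (xi2 i w + maxsum xi2 s w))).
  by rewrite addrACA lerD.
by rewrite lerD// le_max lexx orbT.
Qed.

End Maxsum.

Lemma measurable_maxsum {d} {T : measurableType d} {R : realType}
    (xi : nat -> T -> R) s : (forall i, i \in s -> measurable_fun setT (xi i)) ->
  measurable_fun setT (maxsum xi s).
Proof.
elim: s => [|i s IH] mxi; first exact: measurable_cst.
apply: measurable_maxr; first exact: measurable_cst.
apply: measurable_funD; first by apply: mxi; rewrite mem_head.
by apply: IH => j js; apply: mxi; rewrite inE js orbT.
Qed.

Lemma expR_ge_half_sqr {R : realType} (x : R) : 0 <= x -> x ^+ 2 <= 2 * expR x.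
Proof.
move=> x0; have := @expR_ge1Dxn R x 1 x0; rewrite !factS fact0 !muln1.
rewrite -(ler_pM2l (_ : 0 < 2)) //; apply: le_trans.
by rewrite mulrDr mulrCA divff ?mulr1 ?lerDr.
Qed.

(** Squaring [expR (x / 2) <= (1 - x / 2)^-1] leaves a polynomial inequality. There is no lower
    bound on [x]: the truncated steps to which it applies are bounded above only. *)
Lemma expR_le_1DDsqr {R : realType} (x : R) : x <= 1 -> expR x <= 1 + x + 2 * x ^+ 2.
Proof.
move=> x1.
have h2 : 0 < 1 - x / 2 by lra.
have e1 : expR (x / 2) <= (1 - x / 2)^-1.
  rewrite -[expR _]invrK -expRN lef_pV2 ?posrE ?expR_gt0//.
  by have := expR_ge1Dx (- (x / 2)).
have -> : expR x = expR (x / 2) ^+ 2 by rewrite expr2 -expRD -splitr.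
apply: (@le_trans _ _ ((1 - x / 2)^-1 ^+ 2)).
  by rewrite lerXn2r ?nnegrE ?expR_ge0// invr_ge0 ltW.
rewrite exprVn -[leLHS]mul1r ler_pdivrMr ?exprn_gt0//.
have -> : (1 + x + 2 * x ^+ 2) * (1 - x / 2) ^+ 2 =
    1 + x ^+ 2 * ((1 - x) * (5 / 4 - x / 2)) by field.
by rewrite lerDl mulr_ge0 ?sqr_ge0// mulr_ge0; lra.
Qed.

Section MaxsumMoments.
Context {d : measure_display} {T : measurableType d} {R : realType}.
Variables (P : probability T R) (xi : nat -> T -> R).
Hypothesis iid : iid_seq P xi.

Lemma maxsum_past_indep j s : uniq (j :: s) -> indep P (xi j) (maxsum xi s).
Proof.
move=> us; apply: (past_indep iid us).
by apply: measurable_maxsum => i si; exact: past_measurable.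
Qed.

Let mmax s : measurable_fun setT (maxsum xi s).
Proof. by apply: measurable_maxsum => i _; exact: iid_measurable iid i. Qed.

(* Lindley recursion: (xi + M)^+ has second moment at most E xi^2 + E M^2 *)
Lemma maxsum_sq s : uniq s -> sq P (xi 0) -> Ex P (xi 0) <= 0 ->
  sq P (maxsum xi s) /\
  Ex P (fun w => maxsum xi s w ^+ 2) <= (size s)%:R * Ex P (fun w => xi 0 w ^+ 2).
Proof.
move=> + sq0 mean0; elim: s => [_|j s IH ujs] /=.
  split; first exact: sq_cst.
  by rewrite (_ : (fun _ => _) = fun=> 0) ?Ex_cst ?mul0r//; apply/funext => w; rewrite expr0n.
have /andP[_ us] := ujs.
have [sqM leM] := IH us.
have [sqj Ej] := iid_sq iid j sq0.
have [_ mj] := iid_Ex iid j (sq_itg sq0).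
have sqD := sqD sqj sqM.
have le w : `|maxsum xi (j :: s) w| <= `|xi j w + maxsum xi s w|.
  rewrite ger0_norm ?maxsum_ge0//= ge_max normr_ge0 ler_norm//.
have sqJ : sq P (maxsum xi (j :: s)) by exact: sq_le (mmax _) sqD le.
split=> //.
apply: (@le_trans _ _ (Ex P (fun w => (xi j w + maxsum xi s w) ^+ 2))).
  apply: Ex_le; [by case: sqJ|by case: sqD|move=> w].
  rewrite -[leLHS]real_normK ?num_real// -[leRHS]real_normK ?num_real//.
  by rewrite lerXn2r ?nnegrE//; exact: le.
rewrite Ex_sqrD// indep_ExM//; [|exact: maxsum_past_indep|exact: sq_itg|exact: sq_itg].
rewrite Ej mj.
have -> (c : R) : (size s).+1%:R * c = c + (size s)%:R * c.
  by rewrite -addn1 natrD; ring.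
rewrite lerD// gerDl.
rewrite mulr_ge0_le0// mulr_le0_ge0//; apply: Ex_ge0 => w; exact: maxsum_ge0.
Qed.

(** From exp(max(0, y)) <= 1 + exp(y) and independence, the exponential moments satisfy a' <= 1 +
    [rho] a, whose fixed point [(1 - rho)^-1] bounds them uniformly in [s]. *)
Lemma maxsum_exp s (lam rho : R) : uniq s -> 0 < lam ->
  itg P (fun w => expR (lam * xi 0 w)) ->
  Ex P (fun w => expR (lam * xi 0 w)) <= rho -> 0 <= rho < 1 ->
  itg P (fun w => expR (lam * maxsum xi s w)) /\
  Ex P (fun w => expR (lam * maxsum xi s w)) <= (1 - rho)^-1.
Proof.
move=> + lam0 ie Ee /andP[rho0 rho1].
have r1 : 0 < 1 - rho by rewrite subr_gt0.
have mexp : measurable_fun setT (fun x : R => expR (lam * x)).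
  by apply: (measurableT_comp (@measurable_expR R)); exact: measurable_funM.
elim: s => [_|j s IH ujs] /=.
  split; first by exact: itg_cst.
  by rewrite Ex_cst mulr0 expR0 invf_ge1// lerBlDr lerDl.
have /andP[_ us] := ujs.
have [iM leM] := IH us.
have [ij Ej] := iid_same_law (f := fun x : R => expR (lam * x)) j iid mexp ie.
have ind := indep_comp mexp mexp (maxsum_past_indep ujs).
have iP := indep_itgM ind ij iM.
have le w : expR (lam * maxsum xi (j :: s) w) <=
    1 + expR (lam * xi j w) * expR (lam * maxsum xi s w).
  rewrite -expRD -mulrDr /=.
  case: (leP 0 (xi j w + maxsum xi s w)) => _; first by rewrite lerDr.
  by rewrite mulr0 expR0 lerDl expR_ge0.
have i1P := itgD (itg_cst P 1) iP.
have iJ : itg P (fun w => expR (lam * maxsum xi (j :: s) w)).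
  apply: (itg_le (measurableT_comp mexp (mmax (j :: s))) i1P) => w.
  by rewrite ger0_norm ?expR_ge0//; exact: le.
split=> //.
apply: le_trans (Ex_le iJ i1P le) _.
rewrite ExD//; last exact: itg_cst.
rewrite Ex_cst (indep_ExM ind ij iM) Ej.
apply: (@le_trans _ _ (1 + rho * (1 - rho)^-1)).
  rewrite lerD2l ler_pM//; apply: Ex_ge0 => w; exact: expR_ge0.
rewrite -{2}(mul1r (1 - rho)^-1) -[1 + _](_ : (1 - rho) / (1 - rho) + rho / (1 - rho) = _).
  by rewrite -mulrDl subrK.
by rewrite divff ?gt_eqF.
Qed.

Lemma maxsum_exp_sq s (lam rho : R) : uniq s -> 0 < lam ->
  itg P (fun w => expR (lam * xi 0 w)) ->
  Ex P (fun w => expR (lam * xi 0 w)) <= rho -> 0 <= rho < 1 ->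
  sq P (maxsum xi s) /\
  Ex P (fun w => maxsum xi s w ^+ 2) <= 2 / lam ^+ 2 * (1 - rho)^-1.
Proof.
move=> us lam0 ie Ee rho01.
have [iM leM] := maxsum_exp us lam0 ie Ee rho01.
have le w : maxsum xi s w ^+ 2 <= 2 / lam ^+ 2 * expR (lam * maxsum xi s w).
  have := expR_ge_half_sqr (mulr_ge0 (ltW lam0) (maxsum_ge0 xi s w)).
  rewrite exprMn -ler_pdivlMl ?exprn_gt0//.
  by rewrite mulrA (mulrC _^-1).
have sM : sq P (maxsum xi s).
  split; first exact: mmax.
  apply: (itg_le _ (itgZ (2 / lam ^+ 2) iM)).
    by apply: measurable_funX; exact: mmax.
  by move=> w; rewrite ger0_norm ?sqr_ge0.
split=> //.
apply: le_trans (Ex_le (proj2 sM) (itgZ (2 / lam ^+ 2) iM) le) _.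
by rewrite ExZ// ler_wpM2l// divr_ge0// sqr_ge0.
Qed.

End MaxsumMoments.

Section DominatedToZero.
Context {d : measure_display} {T : measurableType d} {R : realType}.
Variable P : probability T R.

Lemma Ex_cvg0 (f : nat -> T -> R) (g : T -> R) :
  (forall n, measurable_fun setT (f n)) -> itg P g ->
  (forall n w, `|f n w| <= g w) -> (forall w, (f n w) @[n --> \oo] --> 0) ->
  Ex P (f n) @[n --> \oo] --> 0.
Proof.
move=> mf ig fg f0.
have mF n : measurable_fun setT (EFin \o f n) by exact/measurable_EFinP.
have F0 : {ae P, forall w, setT w -> (EFin \o f n) w @[n --> \oo] --> cst 0%E w}.
  by apply: aeW => w _; apply: cvg_EFin; [exact: nearW|exact: f0].
have Fg : {ae P, forall w n, setT w -> (`|(EFin \o f n) w| <= (EFin \o g) w)%E}.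
  by apply: aeW => w n _; rewrite /= lee_fin.
have [_ _] := dominated_convergence measurableT mF (measurable_cst _) F0 ig Fg.
by rewrite integral0 => /fine_cvgP[_].
Qed.

End DominatedToZero.

Section MaxsumDrift.
Context {d : measure_display} {T : measurableType d} {R : realType}.
Variables (P : probability T R).

Let over (K x : R) : R := Num.max (x - K) 0.

Let mover K : measurable_fun setT (over K).
Proof.
by apply: measurable_maxr; [exact: measurable_funB|exact: measurable_cst].
Qed.

Lemma Ex_over_small (X : T -> R) (eta : R) : sq P X -> 0 < eta ->
  exists K : R, 0 <= K /\ Ex P (fun w => over K (X w) ^+ 2) <= eta.
Proof.
move=> [mX iX] eta0.
have /cvgrPdist_le/(_ _ eta0) : Ex P (fun w => over n%:R (X w) ^+ 2) @[n --> \oo] --> 0.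
  apply: (Ex_cvg0 (g := fun w => X w ^+ 2)) => //.
  - move=> n; apply: measurable_funX.
    exact: (measurableT_comp (mover _) mX).
  - move=> n w; rewrite ger0_norm ?sqr_ge0//.
    rewrite -[leRHS]real_normK ?num_real// lerXn2r ?nnegrE ?le_max ?lexx ?orbT//.
    rewrite ge_max normr_ge0 andbT (le_trans _ (ler_norm _))//.
    by rewrite gerBl.
  - move=> w; apply: cvg_near_cst; near=> n.
    have Xn : X w <= n%:R by near: n; exact: nbhs_infty_ger.
    by rewrite /over max_r ?subr_le0// expr0n.
move=> [N _ /(_ N (leqnn N))] /=.
rewrite sub0r normrN ger0_norm => [h|]; last by apply: Ex_ge0 => w; exact: sqr_ge0.
by exists N%:R.
Unshelve. all: end_near. Qed.

Variable xi : nat -> T -> R.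
Hypothesis iid : iid_seq P xi.

(* Split xi as (min xi K + a) + ((xi - K)^+ - a): the first walk has negative
   drift and steps bounded above, hence exponential moments; the second one has
   nonpositive drift and steps of small second moment. *)
Lemma maxsum_drift (eps : R) : sq P (xi 0) -> Ex P (xi 0) < 0 -> 0 < eps ->
  exists C : R, forall s, uniq s -> sq P (maxsum xi s) /\
    Ex P (fun w => maxsum xi s w ^+ 2) <= eps * (size s)%:R + C.
Proof.
move=> sX drift eps0; set c := - Ex P (xi 0).
have c0 : 0 < c by rewrite oppr_gt0.
(* The shift [a] costs [f1] at most half of the drift, so its mean stays below [- (c / 2)]; the
   bound [a ^+ 2 <= eps / 4] limits the second moment of [f2]. *)
pose a := Num.min (c / 2) (Num.sqrt (eps / 4)).
have a0 : 0 < a by rewrite lt_min divr_gt0//= sqrtr_gt0 divr_gt0.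
have ac : a <= c / 2 by rewrite ge_min lexx.
have ae : a ^+ 2 <= eps / 4.
  rewrite -[leRHS]sqr_sqrtr ?divr_ge0 ?(ltW eps0)//.
  by rewrite lerXn2r ?nnegrE ?sqrtr_ge0 ?(ltW a0)// ge_min lexx orbT.
(* With second moment at most [a ^+ 2], the excess over [K] has mean at most [a]; so [f2] has
   nonpositive drift and second moment at most [2 * a ^+ 2]. *)
have [K [K0 hK]] := Ex_over_small sX (exprn_gt0 2 a0).
have mX := sX.1.
pose f1 (x : R) := x - over K x + a.
pose f2 (x : R) := over K x - a.
have mf1 : measurable_fun setT f1.
  by apply: measurable_funD => //; apply: measurable_funB.
have mf2 : measurable_fun setT f2 by exact: measurable_funB.
have sO : sq P (over K \o xi 0).
  apply: (sq_le _ sX) => [|w]; first exact: (measurableT_comp (mover K) mX).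
  rewrite ger0_norm ?le_max ?lexx ?orbT//= ge_max normr_ge0 andbT.
  by rewrite (le_trans _ (ler_norm _))// gerBl.
have O0 : 0 <= Ex P (over K \o xi 0).
  by apply: Ex_ge0 => w; rewrite /= le_max lexx orbT.
have Oa : Ex P (over K \o xi 0) <= a.
  rewrite -(@ler_pXn2r _ 2) ?nnegrE ?(ltW a0)//.
  exact: le_trans (Ex_sqr sO) hK.
have s1 : sq P (f1 \o xi 0) by apply: sqD (sq_cst P a); exact: sqB.
have s2 : sq P (f2 \o xi 0) by apply: sqB (sq_cst P a).
have m1 : Ex P (f1 \o xi 0) <= - (c / 2).
  rewrite [X in Ex P X](_ : _ = fun w => (xi 0 w - (over K \o xi 0) w) + a)//.
  rewrite ExD ?ExB ?Ex_cst; [|exact: sq_itg|exact: sq_itg|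
    by apply: itgB; exact: sq_itg|exact: itg_cst].
  move: O0 ac; rewrite /c; lra.
have m2 : Ex P (f2 \o xi 0) <= 0.
  rewrite [X in Ex P X](_ : _ = fun w => (over K \o xi 0) w - a)//.
  by rewrite ExB ?Ex_cst ?subr_le0//; [exact: sq_itg|exact: itg_cst].
have v2 : Ex P (fun w => (f2 \o xi 0) w ^+ 2) <= eps / 2.
  rewrite [X in Ex P X](_ : _ = fun w => ((over K \o xi 0) w + (- a)) ^+ 2)//.
  rewrite Ex_sqrD//; last exact: sq_cst.
  rewrite Ex_cst (_ : (fun w => (over K \o xi 0) w * - a) = fun w => (- a) * (over K \o xi 0) w); last first.
    by apply/funext => w; rewrite mulrC.
  rewrite ExZ; last exact: sq_itg.
  have := mulr_ge0 (ltW a0) O0; move: hK ae; rewrite /=; lra.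
set V := Ex P (fun w => (f1 \o xi 0) w ^+ 2).
have V0 : 0 <= V by apply: Ex_ge0 => w; exact: sqr_ge0.
(* Small enough that [lam * (K + a) <= 1], so the quadratic bound on [expR] applies, and that
   [2 * lam * V <= c / 4], so the quadratic term consumes only half of the drift [c / 2]. What is
   left is [rho = 1 - lam * (c / 4)]. *)
pose lam := (1 + K + a + 8 * V / c)^-1.
have den0 : 0 < 1 + K + a + 8 * V / c.
  have : 0 <= 8 * V / c by rewrite divr_ge0 ?mulr_ge0// ltW.
  by move: K0 a0; lra.
have lam0 : 0 < lam by rewrite invr_gt0.
have lamK : lam * (K + a) <= 1.
  rewrite mulrC ler_pdivrMr// mul1r.
  have : 0 <= 8 * V / c by rewrite divr_ge0 ?mulr_ge0// ltW.
  lra.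
have lamV : 2 * lam * V <= c / 4.
  have -> : 2 * lam * V = (2 * V) * lam by ring.
  rewrite ler_pdivrMr//.
  have -> : c / 4 * (1 + K + a + 8 * V / c) = c / 4 * (1 + K + a) + 2 * V.
    by field; rewrite gt_eqF.
  by rewrite lerDr mulr_ge0 ?divr_ge0 ?(ltW c0)//; move: K0 a0; lra.
have f1K x : f1 x <= K + a.
  rewrite /f1 lerD2r /over; case: (leP (x - K) 0); lra.
have ub w : expR (lam * (f1 \o xi 0) w) <=
    1 + lam * (f1 \o xi 0) w + 2 * lam ^+ 2 * (f1 \o xi 0) w ^+ 2.
  have := @expR_le_1DDsqr R (lam * (f1 \o xi 0) w); rewrite exprMn mulrA; apply.
  by apply: le_trans lamK; rewrite ler_pM2l//; exact: f1K.
have iub : itg P (fun w => 1 + lam * (f1 \o xi 0) w + 2 * lam ^+ 2 * (f1 \o xi 0) w ^+ 2).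
  apply: itgD; last by apply: itgZ; exact: s1.2.
  by apply: itgD; [exact: itg_cst|apply: itgZ; exact: sq_itg].
have ie : itg P (fun w => expR (lam * (f1 \o xi 0) w)).
  apply: (itg_le _ iub) => [|w]; last by rewrite ger0_norm ?expR_ge0.
  apply: (measurableT_comp (@measurable_expR R)).
  by apply: measurable_funM => //; exact: s1.1.
pose rho := 1 - lam * (c / 4).
have Ee : Ex P (fun w => expR (lam * (f1 \o xi 0) w)) <= rho.
  apply: le_trans (Ex_le ie iub ub) _.
  rewrite ExD; [|by apply: itgD; [exact: itg_cst|apply: itgZ; exact: sq_itg]|
                by apply: itgZ; exact: s1.2].
  rewrite ExD; [|exact: itg_cst|by apply: itgZ; exact: sq_itg].
  rewrite Ex_cst !ExZ; [|exact: s1.2|exact: sq_itg].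
  rewrite -/V /rho.
  have h1 := ler_wpM2l (ltW lam0) m1.
  have h2 := ler_wpM2l (ltW lam0) lamV.
  by move: h1 h2; nra.
have rho01 : 0 <= rho < 1.
  apply/andP; split; first by apply: le_trans Ee; apply: Ex_ge0 => w; exact: expR_ge0.
  by rewrite /rho ltrBlDr ltrDl mulr_gt0// divr_gt0.
have iid1 := iid_comp iid mf1; have iid2 := iid_comp iid mf2.
(* The outer 2 comes from [(M1 + M2) ^+ 2 <= 2 * M1 ^+ 2 + 2 * M2 ^+ 2]; it also turns the rate
   [eps / 2] of [M2] into [eps]. *)
exists (2 * (2 / lam ^+ 2 * (1 - rho)^-1)) => s us.
have [sM1 le1] := maxsum_exp_sq iid1 us lam0 ie Ee rho01.
have [sM2 le2] := maxsum_sq iid2 us s2 m2.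
have sub w : maxsum xi s w <= maxsum (fun i => f1 \o xi i) s w + maxsum (fun i => f2 \o xi i) s w.
  apply: maxsum_subadd => i; rewrite /f1 /f2 /=; lra.
have sM : sq P (maxsum xi s).
  apply: (sq_le _ (sqD sM1 sM2)) => [|w].
    by apply: measurable_maxsum => i _; exact: iid_measurable iid i.
  by rewrite ger0_norm ?maxsum_ge0// (le_trans (sub w))// ler_norm.
split=> //.
set M1 := maxsum _ s in sM1 le1 sub *; set M2 := maxsum _ s in sM2 le2 sub *.
apply: (@le_trans _ _ (Ex P (fun w => 2 * M1 w ^+ 2 + 2 * M2 w ^+ 2))).
  apply: Ex_le; [exact: sM.2|by apply: itgD; apply: itgZ; [exact: sM1.2|exact: sM2.2]|].
  move=> w; have h := sub w; have h0 := maxsum_ge0 xi s w.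
  apply: (@le_trans _ _ ((M1 w + M2 w) ^+ 2)).
    by rewrite lerXn2r ?nnegrE// (le_trans h0).
  by have := sqr_ge0 (M1 w - M2 w); nra.
rewrite ExD; [|by apply: itgZ; exact: sM1.2|by apply: itgZ; exact: sM2.2].
rewrite !ExZ; [|exact: sM2.2|exact: sM1.2].
rewrite addrC lerD ?ler_pM2l//.
apply: (@le_trans _ _ (2 * ((size s)%:R * (eps / 2)))).
  by rewrite ler_pM2l// (le_trans le2)// ler_wpM2l.
by rewrite le_eqVlt; apply/orP; left; apply/eqP; field.
Qed.

End MaxsumDrift.

(** * Taylor bounds *)

Section Taylor.
Context {R : realType}.
Implicit Types (f g : R -> R) (x h B : R).

(** One application of the mean value theorem raises the order by one. The factorial gain of an
    exact Taylor formula is given up, as constants do not matter. *)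
Lemma mvt_bound f f' B (k : nat) h : 0 <= B ->
  (forall u : R, is_derive u 1 f (f' u)) -> f 0 = 0 ->
  (forall u, `|u| <= `|h| -> `|f' u| <= B * `|u| ^+ k) ->
  forall u, `|u| <= `|h| -> `|f u| <= B * `|u| ^+ k.+1.
Proof.
move=> B0 df f0 fB u uh.
have cf a b : {within `[a, b], continuous f}.
  by apply: derivable_within_continuous => y _; case: (df y).
suff [c cu ->] : exists2 c, `|c| <= `|u| & f u = f' c * u.
  rewrite normrM exprSr mulrA ler_wpM2r//.
  apply: le_trans (fB _ (le_trans cu uh)) _.
  by rewrite ler_wpM2l// lerXn2r ?nnegrE.
have [u0|u0] := leP 0 u.
- have [c] := @MVT_segment R f f' 0 u u0 (fun y _ => df y) (cf 0 u).
  rewrite in_itv/= f0 !subr0 => /andP[c0 cu ->].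
  by exists c => //; rewrite !ger0_norm.
- have [c] := @MVT_segment R f f' u 0 (ltW u0) (fun y _ => df y) (cf u 0).
  rewrite in_itv/= f0 !sub0r mulrN => /andP[uc c0 /oppr_inj ->].
  by exists c => //; rewrite !ler0_norm ?(ltW u0)// lerN2.
Qed.

Lemma is_derive_addl g g' x (u : R) : (forall u : R, is_derive u 1 g (g' u)) ->
  is_derive u 1 (fun h => g (x + h)) (g' (x + u)).
Proof.
move=> dg; rewrite -[g' _]mulr1.
apply: (@is_derive1_comp _ g (fun h => x + h) u _ 1).
by rewrite -[X in is_derive _ _ _ X]add0r; apply: is_deriveD.
Qed.

Variables f f1 f2 f3 : R -> R.
Hypothesis (df : forall u : R, is_derive u 1 f (f1 u)).
Hypothesis (df1 : forall u : R, is_derive u 1 f1 (f2 u)).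
Hypothesis (df2 : forall u : R, is_derive u 1 f2 (f3 u)).

Definition taylor2 f f1 f2 x h : R := f (x + h) - f x - f1 x * h - f2 x * h ^+ 2 / 2.

(** [r1] and [r2] are the successive derivatives of [taylor2] in [h]; all vanish at 0, so
    [mvt_bound] can be iterated. *)
Let r1 x h : R := f1 (x + h) - f1 x - f2 x * h.
Let r2 x h : R := f2 (x + h) - f2 x.

Let d2 x (u : R) : is_derive u 1 (r2 x) (f3 (x + u)).
Proof.
rewrite -[f3 _]subr0.
exact: (is_deriveB (is_derive_addl x u df2) (is_derive_cst (f2 x) u 1)).
Qed.

Let d1 x (u : R) : is_derive u 1 (r1 x) (r2 x u).
Proof.
rewrite /r2 -[f2 (x + u)]subr0 -[X in _ - X]mulr1.
have h1 := is_deriveB (is_derive_addl x u df1) (is_derive_cst (f1 x) u 1).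
exact: (is_deriveB h1 (is_deriveZ (f2 x) (is_derive_id u 1))).
Qed.

Let d0 x (u : R) : is_derive u 1 (taylor2 f f1 f2 x) (r1 x u).
Proof.
rewrite /r1 -[f1 (x + u)]subr0.
have -> : f2 x * u = (f2 x / 2) * (2 * u) by field.
have -> : taylor2 f f1 f2 x = fun h => f (x + h) - f x - f1 x * h - (f2 x / 2) * h ^+ 2.
  by apply/funext => h; rewrite /taylor2; field.
have h0 := is_deriveB (is_derive_addl x u df) (is_derive_cst (f x) u 1).
have h1 := is_deriveB h0 (is_deriveZ (f1 x) (is_derive_id u 1)).
have h2 := is_deriveB h1 (is_deriveZ (f2 x / 2) (is_deriveX 2 (is_derive_id u 1))).
move: h2; congr (is_derive _ _ _ _).
by rewrite /GRing.scale/= expr1 !mulr1.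
Qed.

Lemma taylor2_cube B x h : 0 <= B ->
  (forall u, `|u| <= `|h| -> `|f3 (x + u)| <= B) ->
  `|taylor2 f f1 f2 x h| <= B * `|h| ^+ 3.
Proof.
move=> B0 hB.
have h2 := @mvt_bound (r2 x) (fun u => f3 (x + u)) B 0 h B0 (d2 x).
have h1 := @mvt_bound (r1 x) (r2 x) B 1 h B0 (d1 x).
have h0 := @mvt_bound (taylor2 f f1 f2 x) (r1 x) B 2 h B0 (d0 x).
apply: h0 => //; first by rewrite /taylor2 addr0 expr0n/=; ring.
apply: h1; first by rewrite /r1 addr0; ring.
apply: h2; first by rewrite /r2 addr0 subrr.
by move=> u /hB; rewrite expr0 mulr1.
Qed.

(** Stops one derivative earlier than [taylor2_cube]. Large steps need this quadratic bound, since
    third moments may be infinite. *)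
Lemma taylor2_sqr B x h : (forall u, `|f2 u| <= B) ->
  `|taylor2 f f1 f2 x h| <= (2 * B) * `|h| ^+ 2.
Proof.
move=> hB; have B0 : 0 <= B := le_trans (normr_ge0 _) (hB 0).
have BB : 0 <= 2 * B by rewrite mulr_ge0.
have h1 := @mvt_bound (r1 x) (r2 x) (2 * B) 0 h BB (d1 x).
have h0 := @mvt_bound (taylor2 f f1 f2 x) (r1 x) (2 * B) 1 h BB (d0 x).
apply: h0 => //; first by rewrite /taylor2 addr0 expr0n/=; ring.
apply: h1; first by rewrite /r1 addr0; ring.
move=> u _; rewrite expr0 mulr1 (le_trans (ler_normB _ _))//.
by have := hB (x + u); have := hB x; lra.
Qed.

End Taylor.

Lemma expR_taylor2 {R : realType} (z : R) :
  `|expR z - 1 - z - z ^+ 2 / 2| <= `|z| ^+ 3 * expR `|z|.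
Proof.
have dexp := @is_derive_expR R.
have H u : `|u| <= `|z| -> `|expR (0 + u)| <= expR `|z|.
  move=> uz; rewrite add0r ger0_norm ?expR_ge0// ler_expR.
  exact: le_trans (ler_norm u) uz.
have := taylor2_cube dexp dexp dexp (expR_ge0 _) H.
by rewrite /taylor2 add0r expR0 !mul1r (mulrC (expR _)).
Qed.

Section Logistic.
Context {R : realType}.

(** The decreasing logistic function, a smooth version of the indicator of the negative half-line.
    Its derivative is [s ^+ 2 - s], so all further derivatives are polynomials in a quantity between
    0 and 1. *)
Definition logistic (y : R) : R := (1 + expR y)^-1.
Let s := logistic.
Definition logistic1 (y : R) : R := s y ^+ 2 - s y.
Definition logistic2 (y : R) : R := 2 * s y ^+ 3 - 3 * s y ^+ 2 + s y.
Let s3 (y : R) : R := (6 * s y ^+ 2 - 6 * s y + 1) * (s y ^+ 2 - s y).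

Lemma logistic_gt0 y : 0 < logistic y.
Proof. by rewrite invr_gt0 addr_gt0// expR_gt0. Qed.

Lemma logistic_le1 y : logistic y <= 1.
Proof. by rewrite invf_le1 ?addr_gt0 ?expR_gt0// lerDl expR_ge0. Qed.

Let ds (u : R) : is_derive u 1 s (s u ^+ 2 - s u).
Proof.
have e0 : 1 + expR u != 0 by rewrite gt_eqF// addr_gt0// expR_gt0.
have de : is_derive u 1 (fun y : R => 1 + expR y) (expR u).
  by rewrite -[expR u]add0r; apply: is_deriveD.
have := @is_deriveV R (fun y : R => 1 + expR y) u _ _ e0 de.
congr (is_derive _ _ _ _); rewrite /GRing.scale/= /s /logistic.
by field.
Qed.

Let ds1 (u : R) : is_derive u 1 logistic1 (logistic2 u).
Proof.
have := is_deriveB (is_deriveM (ds u) (ds u)) (ds u).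
have -> : (s * s - s)%R = logistic1 by apply/funext => y; rewrite /logistic1 expr2.
by congr (is_derive _ _ _ _); rewrite /GRing.scale/= /logistic2; ring.
Qed.

Let ds2 (u : R) : is_derive u 1 logistic2 (s3 u).
Proof.
have := is_deriveD (is_deriveB (is_deriveZ 2 (is_deriveM (ds u) (is_deriveM (ds u) (ds u))))
  (is_deriveZ 3 (is_deriveM (ds u) (ds u)))) (ds u).
have -> : (2 \*: (s * (s * s)) - 3 \*: (s * s) + s)%R = logistic2.
  by apply/funext => y; rewrite /logistic2 /GRing.scale/= !exprS expr0 !mulr1.
congr (is_derive _ _ _ _); rewrite /GRing.scale/= !mulrfctE /s3 /=; ring.
Qed.

Let sb y : `|s y| <= 1.
Proof. by rewrite ger0_norm ?logistic_le1// ltW// logistic_gt0. Qed.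

Lemma logistic1_bound y : `|logistic1 y| <= 6.
Proof.
have := logistic_le1 y; have := logistic_gt0 y; rewrite /logistic1 -/s => s0 s1.
by rewrite ler_norml; apply/andP; split; nra.
Qed.

Lemma logistic2_bound y : `|logistic2 y| <= 6.
Proof.
have := logistic_le1 y; have := logistic_gt0 y; rewrite /logistic2 -/s => s0 s1.
have h2 : 0 <= s y ^+ 2 <= 1 by rewrite sqr_ge0 expr_le1// ltW.
have h3 : 0 <= s y ^+ 3 <= 1 by rewrite exprn_ge0 ?expr_le1// ltW.
by rewrite ler_norml; apply/andP; split; lra.
Qed.

Let s3_bound y : `|s3 y| <= 12.
Proof.
have := logistic_le1 y; have := logistic_gt0 y; rewrite /s3 -/s => s0 s1.
have h2 : 0 <= s y ^+ 2 <= 1 by rewrite sqr_ge0 expr_le1// ltW.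
rewrite normrM -[12]mulr1 ler_pM//.
  by rewrite ler_norml; apply/andP; split; lra.
by rewrite ler_norml; apply/andP; split; lra.
Qed.

Lemma logistic_taylor_cube x h :
  `|taylor2 logistic logistic1 logistic2 x h| <= 12 * `|h| ^+ 3.
Proof. by apply: (taylor2_cube ds ds1 ds2) => //. Qed.

Lemma logistic_taylor_sqr x h :
  `|taylor2 logistic logistic1 logistic2 x h| <= 12 * `|h| ^+ 2.
Proof.
have := taylor2_sqr ds ds1 x h logistic2_bound.
by rewrite (_ : 2 * 6 = 12 :> R)//; ring.
Qed.

Lemma measurable_logistic : measurable_fun setT logistic.
Proof.
apply: continuous_measurable_fun => y.
by apply: differentiable_continuous; apply/derivable1_diffP; case: (ds y).
Qed.

Lemma logistic_lipschitz x y : `|logistic x - logistic y| <= 6 * `|x - y|.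
Proof.
have df u : is_derive (u : R) 1 (fun h => logistic (y + h) - logistic y) (logistic1 (y + u)).
  have := is_deriveB (is_derive_addl y u ds) (is_derive_cst (s y) u 1).
  by rewrite subr0.
have h6 u : `|u| <= `|x - y| -> `|logistic1 (y + u)| <= 6 * `|u| ^+ 0.
  by rewrite expr0 mulr1 logistic1_bound.
have := @mvt_bound R (fun h => logistic (y + h) - logistic y)
  (fun u => logistic1 (y + u)) 6 0 (x - y) _ df _ h6 (x - y) (lexx _).
by rewrite addr0 subrr subrKC expr1; apply.
Qed.

End Logistic.

(** * Gaussian convolutions *)

Section NormalIntegral.
Context {R : realType}.
Implicit Types (m s t lam : R).
Local Notation mu := (@lebesgue_measure R).

(** The Radon-Nikodym derivative of [normal_prob] and [normal_pdf] have equal integrals over every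
    measurable set, hence agree almost everywhere. *)
Lemma ge0_integral_normal m s (g : R -> \bar R) : measurable_fun setT g ->
  (forall x, 0 <= g x)%E ->
  (\int[normal_prob m s]_x g x = \int[mu]_x (g x * (normal_pdf m s x)%:E))%E.
Proof.
move=> mg g0; have dom := normal_prob_dominates m s.
have mpdf : measurable_fun setT (fun x : R => (normal_pdf m s x)%:E).
  by apply/measurable_EFinP; exact: measurable_normal_pdf.
rewrite -(Radon_Nikodym_SigmaFinite.change_of_variables dom)//=.
apply: ae_eq_integral => //=.
- apply: emeasurable_funM => //; apply: (measurable_int mu).
  exact: Radon_Nikodym_SigmaFinite.f_integrable.
- exact: emeasurable_funM.
- apply: ae_eqe_mul2l => /=; apply: integral_ae_eq => //=.
  + exact: Radon_Nikodym_SigmaFinite.f_integrable.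
  + by move=> E _ mE; rewrite -Radon_Nikodym_SigmaFinite.f_integral.
Qed.

Let measurable_addl (y : R) : measurable_fun setT (fun u : R => y + u).
Proof. exact: measurable_funD. Qed.

Lemma lebesgue_translation (y : R) (A : set R) : measurable A ->
  mu ((fun u => y + u) @^-1` A) = mu A.
Proof.
move=> mA.
pose phi : measurableTypeR R -> measurableTypeR R := fun u : R => y + u.
rewrite -[LHS]/(pushforward mu phi A).
have mphi : measurable_fun setT phi by exact: measurable_addl.
apply/esym/lebesgue_measure_unique => //= _ [[a b]] _ <-; rewrite /pushforward.
have -> : phi @^-1` `]a, b] = `]a - y, b - y]%classic.
  apply/seteqP; split=> u /=; rewrite !in_itv/= /phi => /andP[h1 h2]; apply/andP; split; lra.
rewrite !lebesgue_measure_itv/= !lte_fin ltrD2r.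
by case: ifP => // _; rewrite -!EFinD; congr EFin; ring.
Qed.

Lemma normal_prob_translation s (y : R) (A : set R) : s != 0 -> measurable A ->
  normal_prob y s A = normal_prob 0 s ((fun u => y + u) @^-1` A).
Proof.
move=> s0 mA; pose phi : measurableTypeR R -> measurableTypeR R := fun u : R => y + u.
have mphi : measurable_fun setT phi by exact: measurable_addl.
rewrite /normal_prob.
transitivity (\int[mu]_(u in phi @^-1` A) (normal_pdf y s (phi u))%:E)%E; last first.
  apply: eq_integral => u _; rewrite !normal_pdfE// /normal_fun /phi.
  by rewrite subr0 addrAC subrr add0r.
have mpdf : measurable_fun setT (fun x : R => (normal_pdf y s x)%:E).
  by apply/measurable_EFinP; exact: measurable_normal_pdf.
rewrite -(@ge0_integral_pushforward _ _ _ _ _ phi mphi mu A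
  (fun x : R => (normal_pdf y s x)%:E))//.
- by apply: eq_measure_integral => B mB _; exact/esym/(lebesgue_translation y mB).
- exact: measurable_funTS.
- by move=> z _; rewrite lee_fin normal_pdf_ge0.
Qed.

Lemma ge0_integral_normal_translation s (y : R) (g : R -> \bar R) : s != 0 ->
  measurable_fun setT g -> (forall x, 0 <= g x)%E ->
  (\int[normal_prob y s]_x g x = \int[normal_prob 0 s]_x g (y + x)%R)%E.
Proof.
move=> s0 mg g0.
pose RR := measurableTypeR R.
have law A : measurable A -> normal_prob y s (idfun @^-1` A) =
    normal_prob 0 s ((fun u : RR => y + u : RR) @^-1` A).
  exact: normal_prob_translation.
exact: (@ge0_same_law _ _ _ RR RR RR R (normal_prob y s) (normal_prob 0 s) idfun
  (fun u : RR => y + u : RR) (@measurable_id _ RR setT) (measurable_addl y) law g mg g0).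
Qed.

(** If y has law N(0, t^2) and z given y has law N(y, s^2), the joint density is also the marginal
    of z, N(0, r^2), times the conditional law of y given z; this fixes the mean and deviation on
    the right. *)
Lemma normal_pdf_conv s t r (y z : R) : 0 < s -> 0 < t -> 0 < r ->
  r ^+ 2 = s ^+ 2 + t ^+ 2 ->
  normal_pdf y s z * normal_pdf 0 t y =
  normal_pdf 0 r z * normal_pdf (t ^+ 2 / r ^+ 2 * z) (s * t / r) y.
Proof.
move=> s0 t0 r0 rst.
have q0 : 0 < s * t / r by rewrite divr_gt0// mulr_gt0.
have peak c : 0 < c -> normal_peak c = (c * Num.sqrt (pi *+ 2))^-1.
  move=> c0; rewrite /normal_peak -mulrnAr sqrtrM ?sqr_ge0// sqrtr_sqr gtr0_norm//.
have p0 : Num.sqrt (pi *+ 2) != 0 :> R by rewrite gt_eqF// sqrtr_gt0 mulrn_wgt0// pi_gt0.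
rewrite !normal_pdfE ?gt_eqF// !peak//.
have n0 : s != 0 by rewrite gt_eqF. have n1 : t != 0 by rewrite gt_eqF.
have n2 : r != 0 by rewrite gt_eqF.
rewrite mulrACA [RHS]mulrACA; congr (_ * _).
  by field; rewrite n0 n1 n2 p0.
rewrite /normal_fun -!expRD; congr expR.
have e : s ^+ 2 = r ^+ 2 - t ^+ 2 by rewrite rst; ring.
have d0 : r ^+ 2 - t ^+ 2 != 0 by rewrite -e expf_neq0.
have -> : (s * t / r) ^+ 2 = (r ^+ 2 - t ^+ 2) * t ^+ 2 / r ^+ 2 by rewrite -e; field.
rewrite e; field.
by rewrite n1 n2 d0.
Qed.

Lemma measurable_normal_pdf2 s : s != 0 ->
  measurable_fun setT (fun u : R * R => normal_pdf u.1 s u.2).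
Proof.
move=> s0; rewrite (_ : (fun u => _) = fun u : R * R => normal_peak s *
    expR (- (u.2 - u.1) ^+ 2 / (s ^+ 2 *+ 2))); last first.
  by apply/funext => u; rewrite normal_pdfE.
apply: measurable_funM => //; apply: (measurableT_comp (@measurable_expR R)).
apply: measurable_funM => //; apply: (measurableT_comp (@oppr_measurable R setT)).
by apply: measurable_funX; apply: measurable_funB; [exact: measurable_snd|exact: measurable_fst].
Qed.

(* completing the square *)
Lemma ge0_normal_conv s t r (g : R -> \bar R) : 0 < s -> 0 < t -> 0 < r ->
  r ^+ 2 = s ^+ 2 + t ^+ 2 -> measurable_fun setT g -> (forall x, 0 <= g x)%E ->
  (\int[normal_prob 0 r]_z g z =
   \int[normal_prob 0 t]_y \int[normal_prob 0 s]_z g (y + z)%R)%E.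
Proof.
move=> s0 t0 r0 rst mg g0.
have n0 : s != 0 by rewrite gt_eqF. have n1 : t != 0 by rewrite gt_eqF.
have pdf0 m c x : (0 <= (@normal_pdf R m c x)%:E)%E by rewrite lee_fin normal_pdf_ge0.
have mp1 m c : measurable_fun setT (fun x : R => (@normal_pdf R m c x)%:E).
  by apply/measurable_EFinP; exact: measurable_normal_pdf.
pose RR := measurableTypeR R.
pose h (u : RR * RR) : \bar R := (g u.2 * (normal_pdf u.1 s u.2)%:E)%E.
have mh : measurable_fun setT h.
  apply: emeasurable_funM; first exact: (measurableT_comp mg (@measurable_snd _ _ RR RR)).
  by apply/measurable_EFinP; exact: measurable_normal_pdf2.
have h0 u : (0 <= h u)%E by rewrite mule_ge0.
transitivity (\int[normal_prob 0 t]_y \int[mu]_z h (y, z))%E; last first.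
  apply: eq_integral => y _.
  by rewrite -ge0_integral_normal_translation// ge0_integral_normal.
rewrite (ge0_integral_normal 0 t (g := fun y => \int[mu]_z h (y, z))%E); first last.
- by move=> y; apply: integral_ge0 => z _; exact: h0.
- exact: (measurable_fun_fubini_tonelli_F h).
have -> : (\int[mu]_y (\int[mu]_z h (y, z) * (normal_pdf 0 t y)%:E) =
           \int[mu]_y \int[mu]_z (h (y, z) * (normal_pdf 0 t y)%:E))%E.
  apply: eq_integral => y _; rewrite ge0_integralZr//.
  exact: (measurable_fun_pair2 y mh).
rewrite (fubini_tonelli (fun u : RR * RR => (h u * (normal_pdf 0 t u.1)%:E)%E)); first last.
- by move=> u; rewrite mule_ge0.
- apply: emeasurable_funM => //.
  exact: (measurableT_comp (mp1 0 t) (@measurable_fst _ _ RR RR)).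
rewrite ge0_integral_normal//; apply: eq_integral => z _.
rewrite [RHS](_ : _ = \int[mu]_y ((g z * (normal_pdf 0 r z)%:E) *
    (normal_pdf (t ^+ 2 / r ^+ 2 * z) (s * t / r) y)%:E))%E; last first.
  apply: eq_integral => y _; rewrite /h /= -muleA -EFinM (normal_pdf_conv y z s0 t0 r0 rst).
  by rewrite EFinM muleA.
rewrite ge0_integralZl//; [|exact: mp1|by rewrite mule_ge0].
by rewrite integral_normal_pdf mule1.
Qed.

(** Exponential tilting: multiplying the centred density by [expR (lam * y)] shifts its mean to
    [lam * t ^+ 2], up to the stated constant. *)
Lemma normal_mgf t lam : 0 < t ->
  (\int[normal_prob 0 t]_y (expR (lam * y))%:E = (expR (lam ^+ 2 * t ^+ 2 / 2))%:E)%E.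
Proof.
move=> t0; have n0 : t != 0 by rewrite gt_eqF.
have me : measurable_fun setT (fun y : R => (expR (lam * y))%:E).
  apply/measurable_EFinP; apply: (measurableT_comp (@measurable_expR R)).
  exact: measurable_funM.
rewrite ge0_integral_normal//.
rewrite (_ : (\int[mu]_x _)%E = \int[mu]_x ((expR (lam ^+ 2 * t ^+ 2 / 2))%:E *
   (normal_pdf (lam * t ^+ 2) t x)%:E))%E; last first.
  apply: eq_integral => x _; rewrite -!EFinM; congr EFin.
  rewrite !normal_pdfE// [LHS]mulrCA [RHS]mulrCA; congr (_ * _).
  rewrite /normal_fun -!expRD; congr expR; field.
  by [].
rewrite ge0_integralZl//.
- by rewrite integral_normal_pdf mule1.
- by apply/measurable_EFinP; exact: measurable_normal_pdf.
- by move=> x _; rewrite lee_fin normal_pdf_ge0.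
Qed.

End NormalIntegral.

Section GaussianMoments.
Context {R : realType}.
Implicit Types (t lam x y B : R) (g : R -> R).
Variable t : R.
Hypothesis t0 : 0 < t.
Local Notation N := (normal_prob (0 : R) t).

(* [normal_prob] lives on [measurableTypeR R], convertible to but not unifiable
   with the canonical measurable structure of [R] *)
Lemma gauss_itg_le (X Y : R -> R) : measurable_fun [set: R] X -> itg N Y ->
  (forall y, `|X y| <= Y y) -> itg N X.
Proof. by move=> mX; exact: (@itg_le _ (measurableTypeR R) R N X Y mX). Qed.

Lemma gauss_exp lam : itg N (fun y : R => expR (lam * y)) /\
  Ex N (fun y : R => expR (lam * y)) = expR (lam ^+ 2 * t ^+ 2 / 2).
Proof.
have me : measurable_fun setT (fun y : R => expR (lam * y)).
  by apply: (measurableT_comp (@measurable_expR R)); exact: measurable_funM.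
have mgf := normal_mgf lam t0.
split; last by rewrite /Ex /Rintegral mgf.
apply/integrableP; split; first exact/measurable_EFinP.
under eq_integral do rewrite /= ger0_norm ?expR_ge0//.
by rewrite mgf ltry.
Qed.

Lemma expR_norm_le lam y : 0 <= lam ->
  expR (lam * `|y|) <= expR (lam * y) + expR (- lam * y).
Proof.
move=> l0; have [y0|y0] := leP 0 y.
  by rewrite ger0_norm// lerDl expR_ge0.
by rewrite ltr0_norm// mulrN -mulNr lerDr expR_ge0.
Qed.

Lemma gauss_itg_norm lam : 0 <= lam -> itg N (fun y : R => expR (lam * `|y|)).
Proof.
move=> l0; have [i1 _] := gauss_exp lam; have [i2 _] := gauss_exp (- lam).
have mE : measurable_fun [set: R] (fun y : R => expR (lam * `|y|)).
  by apply: (measurableT_comp (@measurable_expR R)); apply: measurable_funM.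
apply: (gauss_itg_le mE (itgD i1 i2)) => y.
by rewrite ger0_norm ?expR_ge0// expR_norm_le.
Qed.

Lemma cube_le_expR x : 0 <= x -> x ^+ 3 <= 6 * expR x.
Proof.
move=> x0; have := @expR_ge1Dxn R x 2 x0; rewrite !factS fact0 !muln1.
rewrite -(ler_pM2l (_ : 0 < 6)) //; apply: le_trans.
by rewrite mulrDr mulrCA divff ?mulr1 ?lerDr.
Qed.

Lemma gauss_itg_cube : itg N (fun y : R => `|y| ^+ 3 * expR `|y|).
Proof.
have mn : measurable_fun [set: R] (fun y : R => `|y|) by exact: normr_measurable.
have mE : measurable_fun [set: R] (fun y : R => `|y| ^+ 3 * expR `|y|).
  apply: measurable_funM; first exact: measurable_funX.
  exact: (measurableT_comp (@measurable_expR R) mn).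
apply: (gauss_itg_le mE (itgZ 6 (gauss_itg_norm (ler0n R 2)))) => y.
rewrite ger0_norm ?mulr_ge0 ?expR_ge0 ?exprn_ge0//.
have -> : 2 * `|y| = `|y| + `|y| :> R by ring.
by rewrite expRD mulrA ler_wpM2r ?expR_ge0// cube_le_expR.
Qed.

Lemma gauss_sq : sq N (fun y : R => y).
Proof.
split; first exact: measurable_id.
have mE : measurable_fun [set: R] (fun y : R => y ^+ 2) by exact: measurable_funX.
apply: (gauss_itg_le mE (itgZ 2 (gauss_itg_norm ler01))) => y.
by rewrite mul1r normrX expR_ge_half_sqr.
Qed.

(* compare the expansions of E (expR (lam * y)) = expR (lam^2 t^2 / 2) in lam *)
Lemma gauss_mean_var : Ex N (fun y : R => y) = 0 /\ Ex N (fun y : R => y ^+ 2) = t ^+ 2.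
Proof.
set m1 := Ex N (fun y : R => y); set m2 := Ex N (fun y : R => y ^+ 2).
set C := Ex N (fun y : R => `|y| ^+ 3 * expR `|y|).
have C0 : 0 <= C by apply: Ex_ge0 => y; rewrite mulr_ge0 ?exprn_ge0 ?expR_ge0.
have i1 := sq_itg gauss_sq; have i2 := gauss_sq.2.
(* [C] bounds the expectation side. For |lam| <= 1 and z = lam^2 t^2 / 2, the terms z^2 / 2 and z^3
   exp(z) of the closed form are at most |lam|^3 times the other two summands. *)
pose C' := C + t ^+ 4 + t ^+ 6 * expR (t ^+ 2 / 2).
have C'0 : 0 <= C'.
  by rewrite !addr_ge0 ?mulr_ge0 ?expR_ge0 ?exprn_ge0 ?(ltW t0).
have key lam : `|lam| <= 1 -> `|lam * m1 + lam ^+ 2 * (m2 - t ^+ 2) / 2| <= C' * `|lam| ^+ 3.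
  move=> l1; have [ie Ee] := gauss_exp lam.
  have h1 : `|expR (lam ^+ 2 * t ^+ 2 / 2) - (1 + lam * m1 + lam ^+ 2 / 2 * m2)| <= C * `|lam| ^+ 3.
    have ip : itg N (fun y : R => 1 + lam * y + lam ^+ 2 / 2 * y ^+ 2).
      by apply: itgD; [apply: itgD; [exact: itg_cst|exact: itgZ]|exact: itgZ].
    have -> : 1 + lam * m1 + lam ^+ 2 / 2 * m2 = Ex N (fun y : R => 1 + lam * y + lam ^+ 2 / 2 * y ^+ 2).
      rewrite ExD ?ExD ?ExZ ?Ex_cst//; [exact: itg_cst|exact: itgZ| |exact: itgZ].
      by apply: itgD; [exact: itg_cst|exact: itgZ].
    rewrite -Ee -ExB//.
    apply: le_trans (Ex_norm (itgB ie ip)) _.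
    rewrite [leRHS]mulrC /C -ExZ; last exact: gauss_itg_cube.
    apply: Ex_le; [exact/itg_norm/itgB|apply: itgZ; exact: gauss_itg_cube|move=> y].
    rewrite (_ : _ - _ = expR (lam * y) - 1 - lam * y - (lam * y) ^+ 2 / 2); last by field.
    apply: le_trans (expR_taylor2 _) _.
    rewrite normrM exprMn -mulrA ler_wpM2l ?exprn_ge0// ler_wpM2l ?exprn_ge0//.
    by rewrite ler_expR ler_piMl.
  set z := lam ^+ 2 * t ^+ 2 / 2 in h1.
  have z0 : 0 <= z by apply: divr_ge0 => //; apply: mulr_ge0; exact: sqr_ge0.
  have h2 : `|expR z - 1 - z| <= (t ^+ 4 + t ^+ 6 * expR (t ^+ 2 / 2)) * `|lam| ^+ 3.
    have := expR_taylor2 z; rewrite (ger0_norm z0) => hz.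
    have l2 : lam ^+ 2 <= 1.
      by rewrite -real_normK ?num_real// expr_le1.
    have l3 : lam ^+ 2 * lam ^+ 2 <= `|lam| ^+ 3.
      rewrite -real_normK ?num_real// -exprD.
      by rewrite ler_wiXn2l.
    have zt : z <= t ^+ 2 / 2.
      by rewrite /z -mulrA ler_piMl// divr_ge0// sqr_ge0.
    have e1 : z ^+ 2 / 2 <= t ^+ 4 * `|lam| ^+ 3.
      have -> : z ^+ 2 / 2 = t ^+ 4 * (lam ^+ 2 * lam ^+ 2) / 8 by rewrite /z; field.
      rewrite -mulrA ler_wpM2l ?exprn_ge0 ?(ltW t0)//.
      have : 0 <= lam ^+ 2 * lam ^+ 2 by rewrite mulr_ge0 ?sqr_ge0.
      lra.
    have e2 : z ^+ 3 * expR z <= t ^+ 6 * expR (t ^+ 2 / 2) * `|lam| ^+ 3.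
      rewrite -mulrA [X in _ <= _ * X]mulrC mulrA.
      apply: ler_pM; rewrite ?exprn_ge0 ?expR_ge0 ?ler_expR//.
      have -> : z ^+ 3 = t ^+ 6 * (lam ^+ 2 * (lam ^+ 2 * lam ^+ 2)) / 8 by rewrite /z; field.
      rewrite -mulrA ler_wpM2l ?exprn_ge0 ?(ltW t0)//.
      have q0 : 0 <= lam ^+ 2 * lam ^+ 2 by rewrite mulr_ge0 ?sqr_ge0.
      have : lam ^+ 2 * (lam ^+ 2 * lam ^+ 2) <= lam ^+ 2 * lam ^+ 2 by rewrite ler_piMl.
      have : 0 <= lam ^+ 2 * (lam ^+ 2 * lam ^+ 2) by rewrite mulr_ge0 ?sqr_ge0.
      lra.
    have -> : expR z - 1 - z = (expR z - 1 - z - z ^+ 2 / 2) + z ^+ 2 / 2 by ring.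
    apply: le_trans (ler_normD _ _) _.
    rewrite mulrDl addrC lerD//; last exact: le_trans hz e2.
    by rewrite ger0_norm ?divr_ge0 ?sqr_ge0.
  have -> : lam * m1 + lam ^+ 2 * (m2 - t ^+ 2) / 2 =
      (expR z - 1 - z) - (expR z - (1 + lam * m1 + lam ^+ 2 / 2 * m2)).
    by rewrite /z; field.
  apply: le_trans (ler_normB _ _) _.
  rewrite (_ : C' = (t ^+ 4 + t ^+ 6 * expR (t ^+ 2 / 2)) + C); last by rewrite /C'; ring.
  by rewrite mulrDl lerD.
have small (a K : R) : 0 <= K ->
    (forall lam, 0 < lam -> lam <= 1 -> `|a| <= K * lam) -> a = 0.
  move=> K0 h; apply/eqP; rewrite -normr_le0 -[X in _ <= X]add0r; apply/ler_addgt0Pr => e e0.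
  have d0 : 0 < Num.min 1 (e / (K + 1)) by rewrite lt_min ltr01 divr_gt0//; lra.
  have := h _ d0 _; rewrite ge_min lexx => /(_ isT) /le_trans; apply.
  rewrite add0r; apply: (@le_trans _ _ (K * (e / (K + 1)))).
    by rewrite ler_wpM2l// ge_min lexx orbT.
  by rewrite mulrA ler_pdivrMr; [nra|lra].
(* Adding [key] at [lam] and [- lam] cancels the odd term in [m1], which isolates the variance; the
   mean follows by substituting it back. *)
have v0 : m2 - t ^+ 2 = 0.
  apply: (small _ (2 * C')) => [|lam l0 l1]; first by rewrite mulr_ge0.
  have k1 := key lam _; have k2 := key (- lam) _.
  rewrite normrN sqrrN gtr0_norm// in k1 k2.
  have {}k1 := k1 l1; have {}k2 := k2 l1.
  rewrite -(ler_pM2l (exprn_gt0 2 l0)).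
  have -> : lam ^+ 2 * `|m2 - t ^+ 2| = `|lam ^+ 2 * (m2 - t ^+ 2)|.
    by rewrite normrM ger0_norm ?sqr_ge0.
  have -> : lam ^+ 2 * (2 * C' * lam) = 2 * (C' * lam ^+ 3) by ring.
  have -> : lam ^+ 2 * (m2 - t ^+ 2) = (lam * m1 + lam ^+ 2 * (m2 - t ^+ 2) / 2) +
     (- lam * m1 + lam ^+ 2 * (m2 - t ^+ 2) / 2) by field.
  move: k1 k2; rewrite !ler_norml => /andP[k1 k1'] /andP[k2 k2'].
  by apply/andP; split; lra.
split; last by apply/eqP; rewrite -subr_eq0 v0.
apply: (small _ C') => // lam l0 l1.
have := key lam; rewrite v0 mulr0 mul0r addr0 gtr0_norm// => /(_ l1).
rewrite normrM gtr0_norm// (_ : C' * lam ^+ 3 = lam * (C' * lam ^+ 2)); last by ring.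
rewrite ler_pM2l// => /le_trans; apply.
by rewrite ler_wpM2l// expr2 ler_piMl// ltW.
Qed.

(** At scale [t], x^3 <= 6 exp(x) reduces to exponential moments at [t^-1] and [- t^-1]. Each equals
    exp(1/2) <= 2, whence 6 times 4. *)
Lemma gauss_cube : itg N (fun y : R => `|y| ^+ 3) /\
  Ex N (fun y : R => `|y| ^+ 3) <= 24 * t ^+ 3.
Proof.
have [i1 E1] := gauss_exp t^-1; have [i2 E2] := gauss_exp (- t^-1).
have le y : `|y| ^+ 3 <= 6 * t ^+ 3 * (expR (t^-1 * y) + expR (- t^-1 * y)).
  have yt : `|y| = t * (t^-1 * `|y|) by rewrite mulrA divff ?mul1r ?gt_eqF.
  have -> : 6 * t ^+ 3 * (expR (t^-1 * y) + expR (- t^-1 * y)) =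
    t ^+ 3 * (6 * (expR (t^-1 * y) + expR (- t^-1 * y))) by ring.
  rewrite {1}yt exprMn ler_pM2l ?exprn_gt0//.
  have tv : 0 <= t^-1 by rewrite invr_ge0 ltW.
  apply: le_trans (cube_le_expR (mulr_ge0 tv (normr_ge0 y))) _.
  by rewrite ler_pM2l// expR_norm_le.
have ic : itg N (fun y : R => `|y| ^+ 3).
  have mE : measurable_fun [set: R] (fun y : R => `|y| ^+ 3).
    by apply: measurable_funX; exact: normr_measurable.
  apply: (gauss_itg_le mE (itgZ (6 * t ^+ 3) (itgD i1 i2))) => y.
  by rewrite ger0_norm ?exprn_ge0.
split=> //.
apply: le_trans (Ex_le ic (itgZ (6 * t ^+ 3) (itgD i1 i2)) le) _.
rewrite ExZ ?ExD ?E1 ?E2//; last exact: itgD.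
rewrite sqrrN.
have -> : t^-1 ^+ 2 * t ^+ 2 / 2 = 2^-1 by field; rewrite gt_eqF.
have := @expR_le_1DDsqr R 2^-1 _; rewrite expr2.
have t3 : 0 < t ^+ 3 by rewrite exprn_gt0.
have -> : 24 * t ^+ 3 = 6 * t ^+ 3 * 4 by ring.
move=> h; rewrite ler_pM2l ?mulr_gt0//.
have {}h := h _; have /h : 2^-1 <= 1 :> R by lra.
lra.
Qed.

End GaussianMoments.

Section GaussianConvolution.
Context {R : realType}.
Implicit Types (t x y B : R) (g : R -> R).

(** The heat semigroup, parametrized by the standard deviation [t] and not by the variance. *)
Definition gconv t g x : R := Ex (normal_prob 0 t) (fun y : R => g (x + y)).

Let addl_measurable g x : measurable_fun setT g ->
  measurable_fun setT (fun y : R => g (x + y)).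
Proof. by move=> mg; apply: (measurableT_comp mg); exact: measurable_funD. Qed.

Lemma gconv_itg t g B x : measurable_fun setT g -> (forall y, `|g y| <= B) ->
  itg (normal_prob 0 t) (fun y : R => g (x + y)).
Proof. by move=> mg gB; apply: (@itg_bounded _ _ _ _ B) => //; exact: addl_measurable. Qed.

Lemma gconv_bounded t g B : measurable_fun setT g -> (forall y, `|g y| <= B) ->
  forall x, `|gconv t g x| <= B.
Proof.
by move=> mg gB x; apply: Ex_norm_le => //; exact: gconv_itg mg gB.
Qed.

(** Shifting a bounded function by its bound makes it nonnegative, so results of Tonelli type
    transfer to it. *)
Let gB0 g B : (forall y, `|g y| <= B) -> forall y, 0 <= g y + B.
Proof. by move=> gB y; have := gB y; rewrite ler_norml; lra. Qed.

Let gconvE t g B x : measurable_fun setT g -> (forall y, `|g y| <= B) ->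
  (\int[normal_prob 0 t]_y (g (x + y) + B)%:E = (gconv t g x + B)%:E)%E.
Proof.
move=> mg gB; have i1 := gconv_itg t x mg gB.
by rewrite ExE; [rewrite ExD ?Ex_cst//; exact: itg_cst|apply: itgD => //; exact: itg_cst].
Qed.

Lemma measurable_gconv t g B : measurable_fun setT g -> (forall y, `|g y| <= B) ->
  measurable_fun setT (gconv t g).
Proof.
move=> mg gB; pose RR := measurableTypeR R.
pose h (u : RR * RR) : \bar R := (g (u.1 + u.2) + B)%:E.
have mh : measurable_fun setT h.
  apply/measurable_EFinP; apply: measurable_funD => //.
  apply: (measurableT_comp mg); apply: measurable_funD.
    exact: (@measurable_fst _ _ RR RR).
  exact: (@measurable_snd _ _ RR RR).
have h0 u : (0 <= h u)%E by rewrite lee_fin; exact: gB0.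
have mF := measurable_fun_fubini_tonelli_F (m2 := normal_prob 0 t) h mh h0.
have E : (fun x => \int[normal_prob 0 t]_y h (x, y))%E = EFin \o (fun x => gconv t g x + B).
  by apply/funext => x; rewrite /h /= gconvE.
have mE : measurable_fun [set: R] (fun x => gconv t g x + B).
  by apply/measurable_EFinP; rewrite -E; exact: mF.
rewrite (_ : gconv t g = fun x => (gconv t g x + B) - B); last first.
  by apply/funext => x; rewrite addrK.
exact: (measurable_funB mE (measurable_cst B)).
Qed.

Lemma gconv_semigroup s t r g B x : 0 < s -> 0 < t -> 0 < r ->
  r ^+ 2 = s ^+ 2 + t ^+ 2 -> measurable_fun setT g -> (forall y, `|g y| <= B) ->
  gconv r g x = gconv t (gconv s g) x.
Proof.
move=> s0 t0 r0 rst mg gB.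
have mh : measurable_fun [set: R] (fun z : R => (g (x + z) + B)%:E).
  apply/measurable_EFinP; apply: measurable_funD => //; exact: addl_measurable.
have h0 z : (0 <= (g (x + z) + B)%:E)%E by rewrite lee_fin; exact: gB0.
have mG := measurable_gconv s mg gB; have bG := gconv_bounded s mg gB.
have E := ge0_normal_conv s0 t0 r0 rst mh h0.
have E1 : (\int[normal_prob 0 r]_z (g (x + z) + B)%:E = (gconv r g x + B)%:E)%E.
  exact: gconvE.
have E2 : (\int[normal_prob 0 t]_y \int[normal_prob 0 s]_z (g (x + (y + z)) + B)%:E =
    (gconv t (gconv s g) x + B)%:E)%E.
  rewrite -(gconvE t x mG bG); apply: eq_integral => y _.
  rewrite -(gconvE s (x + y) mg gB); apply: eq_integral => z _.
  by rewrite addrA.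
have E3 : (gconv r g x + B)%:E = (gconv t (gconv s g) x + B)%:E.
  exact: etrans (esym E1) (etrans E E2).
by apply: (addIr B); exact: (EFin_inj E3).
Qed.

End GaussianConvolution.

(** * Central limit theorem *)

Section SmoothClass.
Context {R : realType}.
Implicit Types (A t x h : R) (g : R -> R).

(* [g1] and [g2] stand for the derivatives of [g]; asking only for Taylor
   remainders makes the class stable under averaging translates, without
   differentiating under the integral *)
Definition c3 A g g1 g2 : Prop :=
  [/\ [/\ measurable_fun [set: R] g, measurable_fun [set: R] g1 & measurable_fun [set: R] g2],
      forall y, [/\ `|g y| <= A, `|g1 y| <= A & `|g2 y| <= A],
      forall x h, `|taylor2 g g1 g2 x h| <= A * `|h| ^+ 2 &
      forall x h, `|taylor2 g g1 g2 x h| <= A * `|h| ^+ 3].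

Let taylor2_gconv A t g g1 g2 x h : c3 A g g1 g2 ->
  itg (normal_prob 0 t) (fun y : R => taylor2 g g1 g2 (x + y) h) /\
  taylor2 (gconv t g) (gconv t g1) (gconv t g2) x h =
  Ex (normal_prob 0 t) (fun y : R => taylor2 g g1 g2 (x + y) h).
Proof.
move=> [[mg mg1 mg2] bd _ _].
have i0 := gconv_itg t x mg (fun y => let: And3 b _ _ := bd y in b).
have i0h := gconv_itg t (x + h) mg (fun y => let: And3 b _ _ := bd y in b).
have i1 := gconv_itg t x mg1 (fun y => let: And3 _ b _ := bd y in b).
have i2 := gconv_itg t x mg2 (fun y => let: And3 _ _ b := bd y in b).
rewrite (_ : (fun y : R => taylor2 g g1 g2 (x + y) h) =
  fun y : R => g (x + h + y) - g (x + y) - h * g1 (x + y) - (h ^+ 2 / 2) * g2 (x + y)); last first.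
  by apply/funext => y; rewrite /taylor2 (addrAC x y h); field.
split; first by apply: itgB; [apply: itgB; [exact: itgB|exact: itgZ]|exact: itgZ].
rewrite ExB; [|by apply: itgB; [exact: itgB|exact: itgZ]|exact: itgZ].
rewrite ExB; [|exact: itgB|exact: itgZ].
by rewrite ExB// ExZ// ExZ// /taylor2 /gconv; field.
Qed.

(** Averaging translates preserves every bound with the same [A]; the error of each replacement is
    therefore uniform along the iterates. *)
Lemma c3_gconv A t g g1 g2 : c3 A g g1 g2 ->
  c3 A (gconv t g) (gconv t g1) (gconv t g2).
Proof.
move=> cg; have [[mg mg1 mg2] bd t2 t3] := cg.
have b0 y : `|g y| <= A by case: (bd y).
have b1 y : `|g1 y| <= A by case: (bd y).
have b2 y : `|g2 y| <= A by case: (bd y).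
have H x h B : (forall z, `|taylor2 g g1 g2 z h| <= B) ->
    `|taylor2 (gconv t g) (gconv t g1) (gconv t g2) x h| <= B.
  move=> hB; have [i ->] := taylor2_gconv t x h cg.
  exact: Ex_norm_le.
split.
- split; [exact: measurable_gconv b0|exact: measurable_gconv b1|exact: measurable_gconv b2].
- by move=> y; split; apply: gconv_bounded.
- by move=> x h; apply: H.
- by move=> x h; apply: H.
Qed.

(** A Gaussian step has mean 0 and variance [t ^+ 2], so only the second-order term survives; the
    cubic remainder is integrated with [gauss_cube]. *)
Lemma gconv_expand A t g g1 g2 x : 0 < t -> c3 A g g1 g2 ->
  `|gconv t g x - g x - t ^+ 2 / 2 * g2 x| <= 24 * A * t ^+ 3.
Proof.
move=> t0 cg; have [[mg mg1 mg2] bd t2 t3] := cg.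
have b0 y : `|g y| <= A by case: (bd y).
have A0 : 0 <= A := le_trans (normr_ge0 _) (b0 0).
have [m1 m2] := gauss_mean_var t0; have [ic Ec] := gauss_cube t0.
have sqN := gauss_sq t0; have i1 := sq_itg sqN; have i2 := sqN.2.
have ig := gconv_itg t x mg b0.
have E : (fun y : R => taylor2 g g1 g2 x y) =
  fun y : R => g (x + y) - g x - g1 x * y - (g2 x / 2) * y ^+ 2.
  by apply/funext => y; rewrite /taylor2; field.
have iT : itg (normal_prob 0 t) (fun y : R => taylor2 g g1 g2 x y).
  rewrite E; apply: itgB; last exact: itgZ.
  by apply: itgB; [apply: itgB => //; exact: itg_cst|exact: itgZ].
have ET : gconv t g x - g x - t ^+ 2 / 2 * g2 x =
    Ex (normal_prob 0 t) (fun y : R => taylor2 g g1 g2 x y).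
  rewrite E ExB; [|by apply: itgB; [apply: itgB => //; exact: itg_cst|exact: itgZ]|exact: itgZ].
  rewrite ExB; [|by apply: itgB => //; exact: itg_cst|exact: itgZ].
  rewrite ExB//; last exact: itg_cst.
  by rewrite Ex_cst ExZ// ExZ// m1 m2 /gconv; field.
rewrite ET; apply: le_trans (Ex_norm iT) _.
apply: (@le_trans _ _ (Ex (normal_prob 0 t) (fun y : R => A * `|y| ^+ 3))).
  by apply: Ex_le; [exact: itg_norm|exact: itgZ|move=> y; exact: t3].
by rewrite ExZ// (mulrC 24) -mulrA ler_wpM2l.
Qed.

(** Variances add. When [t] is the inverse root of [n], the [n]-fold iterate is convolution with the
    standard Gaussian, which is how the limit arises. *)
Lemma iter_gconv A t n g g1 g2 : 0 < t -> c3 A g g1 g2 ->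
  (exists k1 k2 : R -> R, c3 A (iter n (gconv t) g) k1 k2) /\
  (forall x, iter n.+1 (gconv t) g x = gconv (Num.sqrt n.+1%:R * t) g x).
Proof.
move=> t0 cg; split.
  elim: n => [|n [k1 [k2 IH]]]; first by exists g1, g2.
  by exists (gconv t k1), (gconv t k2); exact: c3_gconv.
have [[mg _ _] bd _ _] := cg.
have b0 y : `|g y| <= A by case: (bd y).
elim: n => [x|n IH x]; first by rewrite sqrtr1 mul1r.
rewrite iterS (_ : iter n.+1 (gconv t) g = gconv (Num.sqrt n.+1%:R * t) g); last exact/funext.
apply/esym; apply: (gconv_semigroup x _ _ _ _ mg b0) => //.
- by rewrite mulr_gt0// sqrtr_gt0.
- by rewrite mulr_gt0// sqrtr_gt0.
- by rewrite !exprMn !sqr_sqrtr// -[n.+2]addn1 natrD mulrDl mul1r.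
Qed.

End SmoothClass.

Section CentralLimit.
Context {d : measure_display} {T : measurableType d} {R : realType}.
Variable P : probability T R.
Implicit Types (A t : R).

(** The better of the two Taylor bounds: cubic for small steps, quadratic and thus integrable for
    large ones. It plays the part of Lindeberg's truncation. *)
Let rem (x : R) : R := Num.min (`|x| ^+ 2) (`|x| ^+ 3).

Let measurable_rem : measurable_fun [set: R] rem.
Proof.
have mn : measurable_fun [set: R] (fun y : R => `|y|) by exact: normr_measurable.
by apply: measurable_minr; exact: measurable_funX.
Qed.

Let rem_ge0 x : 0 <= rem x.
Proof. by rewrite le_min !exprn_ge0. Qed.

Let rem_itg (X : T -> R) : sq P X -> itg P (rem \o X).
Proof.
move=> [mX iX]; apply: (itg_le (measurableT_comp measurable_rem mX) iX) => w.
by rewrite ger0_norm ?rem_ge0// /rem /= real_normK ?num_real// ge_min lexx.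
Qed.

(** Independence factors each Taylor term and the zero mean removes the linear one. The remaining
    second-order term is the one that a Gaussian step of equal variance produces in
    [gconv_expand]. *)
Lemma Ex_taylor_step A g g1 g2 (S eta : T -> R) : c3 A g g1 g2 ->
  measurable_fun setT S -> sq P eta -> indep P eta S -> Ex P eta = 0 ->
  `|Ex P (fun w => g (S w + eta w)) - Ex P (fun w => g (S w))
    - Ex P (fun w => eta w ^+ 2) / 2 * Ex P (fun w => g2 (S w))| <=
  A * Ex P (rem \o eta).
Proof.
move=> [[mg mg1 mg2] bd t2 t3] mS sE ind E0.
have b0 y : `|g y| <= A by case: (bd y).
have b1 y : `|g1 y| <= A by case: (bd y).
have b2 y : `|g2 y| <= A by case: (bd y).
have iE := sq_itg sE; have [mE iE2] := sE.
have m2 : measurable_fun [set: R] (fun x : R => x ^+ 2) by exact: measurable_funX.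
have i0 : itg P (g \o S) := itg_bounded P (measurableT_comp mg mS) (fun w => b0 (S w)).
have i1 : itg P (g1 \o S) := itg_bounded P (measurableT_comp mg1 mS) (fun w => b1 (S w)).
have i2 : itg P (g2 \o S) := itg_bounded P (measurableT_comp mg2 mS) (fun w => b2 (S w)).
have ind1 := indep_comp (@measurable_id _ R setT) mg1 ind.
have ind2 := indep_comp m2 mg2 ind.
have j1 := indep_itgM ind1 iE i1; have j2 := indep_itgM ind2 iE2 i2.
have ig : itg P (fun w => g (S w + eta w)).
  apply: (@itg_bounded _ _ _ P A) => [|w]; last exact: b0.
  by apply: (measurableT_comp mg); exact: measurable_funD.
have E : (fun w => taylor2 g g1 g2 (S w) (eta w)) = fun w =>
   g (S w + eta w) - g (S w) - eta w * g1 (S w) - 2^-1 * (eta w ^+ 2 * g2 (S w)).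
  by apply/funext => w; rewrite /taylor2; field.
have iT : itg P (fun w => taylor2 g g1 g2 (S w) (eta w)).
  rewrite E; apply: itgB; last exact: itgZ.
  by apply: itgB => //; exact: itgB.
have -> : Ex P (fun w => g (S w + eta w)) - Ex P (fun w => g (S w))
    - Ex P (fun w => eta w ^+ 2) / 2 * Ex P (fun w => g2 (S w)) =
    Ex P (fun w => taylor2 g g1 g2 (S w) (eta w)).
  rewrite E ExB; [|by apply: itgB => //; exact: itgB|exact: itgZ].
  rewrite ExB; [|exact: itgB|exact: j1].
  rewrite ExB// ExZ; last exact: j2.
  have := indep_ExM ind1 iE i1; rewrite /= => ->; rewrite E0 mul0r subr0.
  have := indep_ExM ind2 iE2 i2; rewrite /= => ->.
  by congr (_ - _); rewrite mulrA (mulrC 2^-1).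
apply: le_trans (Ex_norm iT) _; rewrite -ExZ; last exact: rem_itg.
apply: Ex_le; [exact: itg_norm|by apply: itgZ; exact: rem_itg|move=> w].
by rewrite /rem /= minEle; case: ifP => _; [exact: t2|exact: t3].
Qed.

Variable xi : nat -> T -> R.
Hypothesis iid : iid_seq P xi.
Hypotheses (sq0 : sq P (xi 0)) (mean0 : Ex P (xi 0) = 0)
  (var1 : Ex P (fun w => xi 0 w ^+ 2) = 1).

Let psum t k w : R := \sum_(i < k) t * xi i w.

Let measurable_psum t k : measurable_fun setT (psum t k).
Proof.
apply: measurable_sum => i; apply: measurable_funM => //.
exact: iid_measurable iid i.
Qed.

Let psum_indep t k : indep P (xi k) (psum t k).
Proof.
apply: (@past_indep _ _ _ _ _ iid (iota 0 k)).
  by rewrite /= iota_uniq mem_iota ltnn.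
apply: measurable_sum => i; apply: measurable_funM => //.
by apply: past_measurable; rewrite mem_iota /= add0n ltn_ord.
Qed.

Lemma clt_bound A f f1 f2 n t : c3 A f f1 f2 -> (0 < n)%N ->
  t = (Num.sqrt n%:R)^-1 ->
  `|Ex P (fun w => f (psum t n w)) - gconv 1 f 0| <=
  A * Ex P (fun w => Num.min (xi 0 w ^+ 2) (t * `|xi 0 w| ^+ 3)) + 24 * A * t.
Proof.
move=> cf n0 tE.
have s0 : 0 < Num.sqrt n%:R :> R by rewrite sqrtr_gt0 ltr0n.
have t0 : 0 < t by rewrite tE invr_gt0.
have nt2 : n%:R * t ^+ 2 = 1.
  by rewrite tE exprVn sqr_sqrtr// divff// pnatr_eq0 -lt0n.
(* Interpolation: [k] genuine steps followed by [n - k] Gaussian ones, from the Gaussian value at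
   [k = 0] to the random sum at [k = n]. *)
pose a k := Ex P (fun w => iter (n - k) (gconv t) f (psum t k w)).
pose e := Ex P (fun w => Num.min (xi 0 w ^+ 2) (t * `|xi 0 w| ^+ 3)).
have b0 y : `|f y| <= A by have [_ bd _ _] := cf; case: (bd y).
have A0 : 0 <= A := le_trans (normr_ge0 _) (b0 0).
pose c := A * (t ^+ 2 * e) + 24 * A * t ^+ 3.
have remt x : rem (t * x) = t ^+ 2 * Num.min (x ^+ 2) (t * `|x| ^+ 3).
  rewrite /rem normrM (gtr0_norm t0) !exprMn real_normK ?num_real//.
  rewrite minr_pMr ?sqr_ge0//; congr Num.min; ring.
have step k : (k < n)%N -> `|a k.+1 - a k| <= c.
  (* The test function [g] is common to both: [a k.+1] adds [t * xi k] to its argument, [a k] adds a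
     Gaussian step. Their second-order terms cancel. *)
  move=> kn; pose g := iter (n - k.+1) (gconv t) f.
  have [[g1 [g2 cg]] _] := iter_gconv (n - k.+1) t0 cf.
  have [sk Ek] := iid_sq iid k sq0.
  have [ik mk] := iid_Ex iid k (sq_itg sq0).
  have sE : sq P (fun w => t * xi k w) by exact: sqZ.
  have ind : indep P (fun w => t * xi k w) (psum t k).
    have mt : measurable_fun [set: R] (fun x : R => t * x) by exact: measurable_funM.
    exact: indep_comp mt (@measurable_id _ R setT) (@psum_indep t k).
  have mE0 : Ex P (fun w => t * xi k w) = 0 by rewrite ExZ// mk mean0 mulr0.
  have := Ex_taylor_step cg (@measurable_psum t k) sE ind mE0.
  have -> : Ex P (fun w => (t * xi k w) ^+ 2) = t ^+ 2.
    by under eq_fun do rewrite exprMn; rewrite ExZ ?Ek ?var1 ?mulr1//; case: sk.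
  have -> : Ex P (rem \o (fun w => t * xi k w)) = t ^+ 2 * e.
    have mq : measurable_fun [set: R] (fun x : R => rem (t * x)).
      by apply: (measurableT_comp measurable_rem); exact: measurable_funM.
    have iq : itg P ((fun x : R => rem (t * x)) \o xi 0).
      by apply: (rem_itg (X := fun w => t * xi 0 w)); exact: sqZ.
    have [_] := iid_same_law (f := fun x : R => rem (t * x)) k iid mq iq.
    rewrite /comp => ->; under eq_fun do rewrite remt.
    rewrite ExZ//.
    have -> : (fun w => Num.min (xi 0 w ^+ 2) (t * `|xi 0 w| ^+ 3)) =
       fun w => n%:R * rem (t * xi 0 w).
      by apply/funext => w; rewrite remt mulrA nt2 mul1r.
    exact: itgZ.
  have -> : Ex P (fun w => g (psum t k w + t * xi k w)) = a k.+1.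
    by rewrite /a; congr (Ex P _); apply/funext => w; rewrite /psum big_ord_recr.
  have [[mg _ mg2] bd _ _] := cg.
  have bg y : `|g y| <= A by case: (bd y).
  have bg2 y : `|g2 y| <= A by case: (bd y).
  have ig : itg P (fun w => g (psum t k w)).
    by apply: (@itg_bounded _ _ _ P A) => // ; exact: (measurableT_comp mg (@measurable_psum t k)).
  have ig2 : itg P (fun w => g2 (psum t k w)).
    by apply: (@itg_bounded _ _ _ P A) => // ; exact: (measurableT_comp mg2 (@measurable_psum t k)).
  have iG : itg P (fun w => gconv t g (psum t k w)).
    apply: (@itg_bounded _ _ _ P A) => [|w]; last exact: gconv_bounded.
    exact: (measurableT_comp (measurable_gconv t mg bg) (@measurable_psum t k)).
  have ak : a k = Ex P (fun w => gconv t g (psum t k w)).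
    by rewrite /a -(subnSK kn).
  have : `|a k - (Ex P (fun w => g (psum t k w)) + t ^+ 2 / 2 * Ex P (fun w => g2 (psum t k w)))|
      <= 24 * A * t ^+ 3.
    rewrite ak -ExZ// -ExD//; last exact: itgZ.
    apply: Ex_normB_le => //; first by apply: itgD => //; exact: itgZ.
    by move=> w; rewrite opprD addrA; exact: (gconv_expand _ t0 cg).
  move=> h2 h1.
  rewrite (_ : a k.+1 - a k = (a k.+1 - Ex P (fun w => g (psum t k w)) -
      t ^+ 2 / 2 * Ex P (fun w => g2 (psum t k w))) -
    (a k - (Ex P (fun w => g (psum t k w)) + t ^+ 2 / 2 * Ex P (fun w => g2 (psum t k w))))); last by ring.
  by apply: le_trans (ler_normB _ _) _; exact: lerD.
have tele k : (k <= n)%N -> `|a k - a 0%N| <= k%:R * c.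
  elim: k => [_|k IH kn]; first by rewrite subrr normr0 mul0r.
  rewrite (_ : a k.+1 - a 0%N = (a k.+1 - a k) + (a k - a 0%N)); last by ring.
  apply: le_trans (ler_normD _ _) _.
  by rewrite -[k.+1]add1n natrD mulrDl mul1r lerD ?step ?IH// ltnW.
have := tele n (leqnn n).
have -> : a n = Ex P (fun w => f (psum t n w)) by rewrite /a subnn.
have -> : a 0%N = gconv 1 f 0.
  rewrite /a subn0; under eq_fun do rewrite /psum big_ord0.
  rewrite Ex_cst; have [_ /(_ 0)] := iter_gconv n.-1 t0 cf.
  have -> : Num.sqrt n.-1.+1%:R * t = 1 by rewrite prednK// tE divff// gt_eqF.
  by rewrite prednK.
(* Since [n%:R * t ^+ 2 = 1], the [n] errors add up to a quantity that still tends to 0. *)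
have -> // : n%:R * c = A * e + 24 * A * t.
rewrite /c mulrDr.
have -> : n%:R * (A * (t ^+ 2 * e)) = (n%:R * t ^+ 2) * (A * e) by ring.
have -> : n%:R * (24 * A * t ^+ 3) = (n%:R * t ^+ 2) * (24 * A * t) by ring.
by rewrite nt2 !mul1r.
Qed.

Lemma cvg_invsqrt : (Num.sqrt n%:R)^-1 @[n --> \oo] --> (0 : R).
Proof.
apply/cvgrPdist_le => e e0; near=> n.
rewrite sub0r normrN.
have n0 : 0 < n%:R :> R.
  by rewrite ltr0n; near: n; exact: nbhs_infty_gt.
rewrite ger0_norm ?invr_ge0 ?sqrtr_ge0// -[leRHS]invrK lef_pV2 ?posrE ?invr_gt0 ?sqrtr_gt0//.
rewrite -(@ler_pXn2r _ 2) ?nnegrE ?invr_ge0 ?sqrtr_ge0 ?(ltW e0)// sqr_sqrtr ?(ltW n0)//.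
by near: n; exact: nbhs_infty_ger.
Unshelve. all: end_near. Qed.

(** In [clt_bound] the minimum tends to 0 pointwise, thanks to the factor [t], and is dominated by
    [xi 0 w ^+ 2]; no moment beyond the second is used. *)
Lemma clt_smooth A f f1 f2 : c3 A f f1 f2 ->
  Ex P (fun w => f (psum (Num.sqrt n%:R)^-1 n w)) @[n --> \oo] --> gconv 1 f 0.
Proof.
move=> cf.
have e0 : Ex P (fun w => Num.min (xi 0 w ^+ 2) ((Num.sqrt n%:R)^-1 * `|xi 0 w| ^+ 3))
    @[n --> \oo] --> 0.
  have mx := sq0.1.
  have mn : measurable_fun setT (fun w => `|xi 0 w|).
    by apply: measurableT_comp mx; exact: normr_measurable.
  apply: (Ex_cvg0 (g := fun w => xi 0 w ^+ 2)); last 3 first.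
  - by case: sq0.
  - move=> n w; rewrite ger0_norm ?ge_min ?lexx//.
    by rewrite le_min sqr_ge0 mulr_ge0 ?exprn_ge0// invr_ge0 sqrtr_ge0.
  - move=> w.
    have h : (Num.sqrt n%:R)^-1 * `|xi 0 w| ^+ 3 @[n --> \oo] --> 0.
      rewrite -[X in _ --> X](mul0r (`|xi 0 w| ^+ 3)).
      by apply: cvgM; [exact: cvg_invsqrt|exact: cvg_cst].
    apply: (squeeze_cvgr _ (cvg_cst 0) h); apply: nearW => n.
    rewrite ge_min lexx orbT andbT.
    by rewrite le_min sqr_ge0 mulr_ge0 ?exprn_ge0// invr_ge0 sqrtr_ge0.
  - move=> n; apply: measurable_minr; first exact: measurable_funX.
    by apply: measurable_funM => //; exact: measurable_funX.
apply/cvgrPdist_le => e ep.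
have b : A * Ex P (fun w => Num.min (xi 0 w ^+ 2) ((Num.sqrt n%:R)^-1 * `|xi 0 w| ^+ 3)) +
    24 * A * (Num.sqrt n%:R)^-1 @[n --> \oo] --> 0.
  rewrite [X in _ --> X](_ : 0 = A * 0 + 24 * A * 0); last by rewrite !mulr0 addr0.
  apply: cvgD; first by apply: cvgM; [exact: cvg_cst|exact: e0].
  by apply: cvgM; [exact: cvg_cst|exact: cvg_invsqrt].
move/cvgrPdist_le : b => /(_ e ep) b.
near=> n.
have n0 : (0 < n)%N by near: n; exact: nbhs_infty_gt.
rewrite distrC; apply: le_trans (clt_bound cf n0 erefl) _.
apply: le_trans (ler_norm _) _.
by rewrite -normrN -sub0r; near: n; exact: b.
Unshelve. all: end_near. Qed.

End CentralLimit.

(** * From smooth test functions to distribution functions *)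

Section ScaledLogistic.
Context {R : realType}.
Implicit Types (a del K x y : R).

Definition slog a del y : R := logistic ((y - a) / del).

Lemma c3_slog a del : 0 < del -> exists A f1 f2, c3 A (slog a del) f1 f2.
Proof.
move=> d0; pose i := del^-1.
have i0 : 0 < i by rewrite invr_gt0.
exists (12 * (1 + i + i ^+ 2 + i ^+ 3)).
exists (fun y => i * logistic1 ((y - a) / del)).
exists (fun y => i ^+ 2 * logistic2 ((y - a) / del)).
have ms : measurable_fun [set: R] (fun y => (y - a) / del).
  by apply: measurable_funM => //; exact: measurable_funB.
have ml := measurable_logistic (R := R).
have ml1 : measurable_fun [set: R] (logistic1 (R := R)).
  by apply: measurable_funB => //; exact: measurable_funX.
have ml2 : measurable_fun [set: R] (logistic2 (R := R)).
  apply: measurable_funD => //; apply: measurable_funB.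
    by apply: measurable_funM => //; exact: measurable_funX.
  by apply: measurable_funM => //; exact: measurable_funX.
have i2 : 0 < i ^+ 2 by rewrite exprn_gt0.
have i3 : 0 < i ^+ 3 by rewrite exprn_gt0.
have tE x h : taylor2 (slog a del) (fun y => i * logistic1 ((y - a) / del))
    (fun y => i ^+ 2 * logistic2 ((y - a) / del)) x h =
    taylor2 logistic logistic1 logistic2 ((x - a) / del) (h * i).
  rewrite /taylor2 /slog -/i.
  have -> : (x + h - a) * i = (x - a) * i + h * i by ring.
  by field.
split.
- split; first exact: (measurableT_comp ml ms).
  + by apply: measurable_funM => //; exact: (measurableT_comp ml1 ms).
  + by apply: measurable_funM => //; exact: (measurableT_comp ml2 ms).
- move=> y; split.
  + rewrite ger0_norm ?(ltW (logistic_gt0 _))//.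
    by apply: le_trans (logistic_le1 _) _; lra.
  + rewrite normrM gtr0_norm//.
    apply: (@le_trans _ _ (i * 6)); first by rewrite ler_wpM2l ?(ltW i0)// logistic1_bound.
    lra.
  + rewrite normrM gtr0_norm//.
    apply: (@le_trans _ _ (i ^+ 2 * 6)); first by rewrite ler_wpM2l ?(ltW i2)// logistic2_bound.
    lra.
- move=> x h; rewrite tE; apply: le_trans (logistic_taylor_sqr _ _) _.
  rewrite normrM (gtr0_norm i0) exprMn (mulrC (`|h| ^+ 2)) mulrA.
  by rewrite ler_wpM2r ?exprn_ge0//; lra.
- move=> x h; rewrite tE; apply: le_trans (logistic_taylor_cube _ _) _.
  rewrite normrM (gtr0_norm i0) exprMn (mulrC (`|h| ^+ 3)) mulrA.
  by rewrite ler_wpM2r ?exprn_ge0//; lra.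
Qed.

Lemma slog_lipschitz a del x y : 0 < del ->
  `|slog a del x - slog a del y| <= 6 / del * `|x - y|.
Proof.
move=> d0; apply: le_trans (logistic_lipschitz _ _) _.
rewrite -mulrBl opprB addrA subrK normrM (gtr0_norm (_ : 0 < del^-1)) ?invr_gt0//.
by rewrite mulrA mulrAC.
Qed.

Lemma slog_norm_le1 a del y : `|slog a del y| <= 1.
Proof. by rewrite ger0_norm ?logistic_le1// ltW// logistic_gt0. Qed.

Lemma measurable_slog a del : measurable_fun [set: R] (slog a del).
Proof.
apply: (measurableT_comp measurable_logistic).
by apply: measurable_funM => //; exact: measurable_funB.
Qed.

(** Outside a window of half-width [K * del] around [a], the scaled logistic differs from the
    indicator by at most [expR (- K)]. *)
Lemma slog_sandwich a del K y : 0 < del ->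
  (y <= a - K * del)%R%:R - expR (- K) <= slog a del y <= (y <= a + K * del)%R%:R + expR (- K).
Proof.
move=> d0; have s0 := logistic_gt0 ((y - a) / del); have s1 := logistic_le1 ((y - a) / del).
have e0 := expR_gt0 (- K); rewrite /slog; apply/andP; split.
- case: (leP y (a - K * del)) => h /=; last by rewrite sub0r; lra.
  have h' : expR ((y - a) / del) <= expR (- K).
    by rewrite ler_expR ler_pdivrMr//; lra.
  rewrite /logistic; set e := expR (_ / _) in h' *.
  have p : 0 < 1 + e by rewrite addr_gt0// expR_gt0.
  rewrite -[leRHS]mul1r ler_pdivlMr//.
  have : 0 <= e by rewrite expR_ge0.
  nra.
- case: (leP y (a + K * del)) => h /=; first by lra.
  rewrite add0r /logistic expRN lef_pV2 ?posrE ?addr_gt0 ?expR_gt0//.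
  apply: (@le_trans _ _ (expR ((y - a) / del))); last by rewrite lerDr.
  by rewrite ler_expR ler_pdivlMr//; lra.
Qed.

End ScaledLogistic.

Section Cdf.
Context {d : measure_display} {T : measurableType d} {R : realType}.
Variable P : probability T R.

Definition cdfR (W : T -> R) (x : R) : R := fine (P [set w | W w <= x]).

Lemma measurable_le (W : T -> R) x : measurable_fun setT W -> measurable [set w | W w <= x].
Proof.
move=> mW; rewrite (_ : [set w | _] = setT `&` W @^-1` `]-oo, x]%classic).
  by apply: mW.
by rewrite setTI; apply/seteqP; split => w /=; rewrite in_itv.
Qed.

Lemma Ex_le_indic (W : T -> R) x : measurable_fun setT W ->
  itg P (fun w => (W w <= x)%R%:R) /\ Ex P (fun w => (W w <= x)%R%:R) = cdfR W x.
Proof.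
move=> mW; have mA := measurable_le x mW.
have E : (fun w => (W w <= x)%R%:R) = (\1_[set w | W w <= x] : T -> R).
  apply/funext => w; rewrite indicE; congr (_ %:R); congr (nat_of_bool _).
  by apply/idP/idP; rewrite inE.
rewrite E; split; first exact: integrable_indic.
by rewrite /Ex /Rintegral integral_indic// setIT.
Qed.

Lemma cdf_slog (W : T -> R) (a del K : R) : measurable_fun setT W -> 0 < del ->
  cdfR W (a - K * del) - expR (- K) <= Ex P (slog a del \o W) <=
  cdfR W (a + K * del) + expR (- K).
Proof.
move=> mW d0.
have is_ : itg P (slog a del \o W).
  apply: (@itg_bounded _ _ _ P 1); last by move=> w; exact: slog_norm_le1.
  exact: (measurableT_comp (measurable_slog a del) mW).
have [i1 <-] := Ex_le_indic (a - K * del) mW.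
have [i2 <-] := Ex_le_indic (a + K * del) mW.
apply/andP; split.
- rewrite -{1}(Ex_cst P (expR (- K))) -ExB//; last exact: itg_cst.
  apply: Ex_le => //; first by apply: itgB => //; exact: itg_cst.
  by move=> w; have /andP[] := slog_sandwich a K (W w) d0.
- rewrite -{1}(Ex_cst P (expR (- K))) -ExD//; last exact: itg_cst.
  apply: Ex_le => //; first by apply: itgD => //; exact: itg_cst.
  by move=> w; have /andP[] := slog_sandwich a K (W w) d0.
Qed.

End Cdf.

Section Slutsky.
Context {d : measure_display} {T : measurableType d} {R : realType}.
Variable P : probability T R.

Local Notation F := (cdfR (normal_prob (0 : R) 1) idfun).

Lemma PhiE (x : R) : Phi x = (F x)%:E.
Proof.
rewrite /cdfR /Phi fineK ?fin_num_measure//.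
by apply: (@measurable_le _ (measurableTypeR R) R idfun x); exact: measurable_id.
Qed.

Lemma Phi_lipschitz (x y : R) : x <= y -> F y <= F x + normal_peak 1 * (y - x).
Proof.
move=> xy; rewrite -lee_fin EFinD -!PhiE /Phi.
have -> : `]-oo, y]%classic = `]-oo, x] `|` `]x, y] :> set R.
  apply/seteqP; split => z /=; rewrite !in_itv/=.
    by move=> zy; case: (leP z x) => zx; [left|right; rewrite zy].
  by move=> [/le_trans-> //|/andP[_ ->]].
apply: le_trans (measureU2 _ _ _) _ => //.
rewrite leeD2l//.
apply: (@le_trans _ _ (\int[lebesgue_measure]_(z in `]x, y]) (normal_peak 1)%:E)%E).
  apply: ge0_le_integral => //=.
  - by move=> z _; rewrite lee_fin normal_pdf_ge0.
  - by apply/measurable_EFinP; apply: measurable_funTS; exact: measurable_normal_pdf.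
  - by move=> z _; rewrite lee_fin normal_pdf_ub// oner_neq0.
rewrite integral_cst//= lebesgue_measure_itv/= lte_fin.
by case: ltP => h; rewrite ?mule0 ?lee_fin ?mulr_ge0 ?normal_peak_ge0 ?subr_ge0// -EFinD -EFinM.
Qed.

Variables (W V : nat -> T -> R).
Hypothesis mW : forall n, measurable_fun setT (W n).
Hypothesis mV : forall n, measurable_fun setT (V n).
Hypothesis cvgV : forall A f f1 f2, c3 A f f1 f2 ->
  Ex P (fun w => f (V n w)) @[n --> \oo] --> gconv 1 f 0.
Hypothesis sqWV : forall n, itg P (fun w => (W n w - V n w) ^+ 2).
Hypothesis WV : Ex P (fun w => (W n w - V n w) ^+ 2) @[n --> \oo] --> 0.

Let slog_close (a del eta : R) : 0 < del -> 0 < eta ->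
  \forall n \near \oo,
    `|Ex P (slog a del \o W n) - Ex (normal_prob 0 1) (slog a del)| <= eta.
Proof.
move=> d0 e0; have [A [f1 [f2 cf]]] := c3_slog a d0.
have := cvgV cf.
have -> : gconv 1 (slog a del) 0 = Ex (normal_prob 0 1) (slog a del).
  by congr (Ex _ _); apply/funext => y; rewrite add0r.
have e2 : 0 < eta / 2 by rewrite divr_gt0.
move=> /cvgrPdist_le /(_ _ e2) near1.
(* An L^2 distance below this threshold bounds the L^1 distance by its root, and [6 / del] is the
   Lipschitz constant of [slog a del]. *)
have q0 : 0 < (eta / 2 / (6 / del)) ^+ 2 by rewrite exprn_gt0// !divr_gt0.
have /cvgrPdist_le /(_ _ q0) near2 := WV.
near=> n.
have h1 : `|Ex (normal_prob 0 1) (slog a del) - Ex P (fun w => slog a del (V n w))| <= eta / 2.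
  by near: n; exact: near1.
have h2 : `|0 - Ex P (fun w => (W n w - V n w) ^+ 2)| <= (eta / 2 / (6 / del)) ^+ 2.
  by near: n; exact: near2.
rewrite sub0r normrN ger0_norm in h2; last by apply: Ex_ge0 => w; exact: sqr_ge0.
have sD : sq P (fun w => `|W n w - V n w|).
  split.
    apply: measurableT_comp; first exact: normr_measurable.
    exact: measurable_funB.
  by under eq_fun do rewrite real_normK ?num_real//.
have iD := sq_itg sD.
have ED : Ex P (fun w => `|W n w - V n w|) <= eta / 2 / (6 / del).
  rewrite -(@ler_pXn2r _ 2) ?nnegrE ?divr_ge0 ?(ltW e0) ?(ltW d0)//; last first.
    by apply: Ex_ge0.
  apply: le_trans (Ex_sqr sD) _.
  by under eq_fun do rewrite real_normK ?num_real//.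
have is_ (U : T -> R) : measurable_fun setT U -> itg P (slog a del \o U).
  move=> mU; apply: (@itg_bounded _ _ _ P 1); last by move=> w; exact: slog_norm_le1.
  exact: (measurableT_comp (measurable_slog a del) mU).
have h3 : `|Ex P (slog a del \o W n) - Ex P (slog a del \o V n)| <= eta / 2.
  rewrite -ExB; [|exact: is_|exact: is_].
  apply: le_trans (Ex_norm (itgB (is_ _ (mW n)) (is_ _ (mV n)))) _.
  apply: (@le_trans _ _ (Ex P (fun w => 6 / del * `|W n w - V n w|))).
    apply: Ex_le; [by apply/itg_norm/itgB; exact: is_|exact: itgZ|move=> w].
    exact: slog_lipschitz.
  rewrite ExZ//; apply: le_trans (ler_wpM2l _ ED) _; first by rewrite divr_ge0// ltW.
  by rewrite mulrC divfK// gt_eqF// divr_gt0.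
rewrite (_ : _ - _ = (Ex P (slog a del \o W n) - Ex P (slog a del \o V n)) -
  (Ex (normal_prob 0 1) (slog a del) - Ex P (fun w => slog a del (V n w)))); last by rewrite /comp; ring.
apply: le_trans (ler_normB _ _) _.
by rewrite [leRHS]splitr lerD.
Unshelve. all: end_near. Qed.

Let sandwich_arith (Fn F0 Fp Fm Ep Em Np Nm e eta c : R) :
  Fn - e <= Ep -> Em <= Fn + e -> Np <= Fp + e -> Fm - e <= Nm ->
  Fp <= F0 + c -> F0 <= Fm + c -> `|Ep - Np| <= eta / 8 -> `|Em - Nm| <= eta / 8 ->
  e <= eta / 16 -> c <= eta / 2 -> 0 < eta -> `|F0 - Fn| <= eta.
Proof.
clear; rewrite !ler_norml => a1 a2 b1 b2 l1 l2 /andP[h1 h1'] /andP[h2 h2'] eK hd e0.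
by apply/andP; split; lra.
Qed.

Lemma cvg_cdf_Phi (x : R) : P [set w | W n w <= x] @[n --> \oo] --> Phi x.
Proof.
rewrite PhiE.
have E n : P [set w | W n w <= x] = (cdfR P (W n) x)%:E.
  by rewrite /cdfR fineK// fin_num_measure//; exact: measurable_le.
under eq_fun do rewrite E.
apply: cvg_EFin; first exact: nearW.
apply/cvgrPdist_le => eta e0.
(* Since [expR K >= K], the tail [expR (- K)] is at most [eta / 16]. *)
pose K := 16 / eta.
have K0 : 0 < K by rewrite divr_gt0.
have eK : expR (- K) <= eta / 16.
  rewrite expRN -[leRHS]invrK invf_div -/K lef_pV2 ?posrE ?expR_gt0//.
  by apply: le_trans (expR_ge1Dx K); rewrite lerDr.
have C0 : 0 <= normal_peak (1 : R) by exact: normal_peak_ge0.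
have p1 : 0 < normal_peak 1 + 1 :> R by lra.
(* The density peak is a Lipschitz constant of the normal distribution function, so moving its
   argument by [2 * K * del] costs at most [eta / 2]; the [+ 1] keeps the denominator positive. *)
pose del := eta / (4 * K * (normal_peak 1 + 1)).
have den : 0 < 4 * K * (normal_peak 1 + 1).
  by rewrite mulr_gt0// mulr_gt0.
have d0 : 0 < del by rewrite divr_gt0.
have hd : normal_peak 1 * (2 * K * del) <= eta / 2.
  have -> : normal_peak 1 * (2 * K * del) = eta / 2 * (normal_peak 1 / (normal_peak 1 + 1)).
    by rewrite /del; field; rewrite !gt_eqF.
  rewrite ler_piMr ?divr_ge0 ?(ltW e0)// ler_pdivrMr ?mul1r ?lerDl//.
have e8 : 0 < eta / 8 by rewrite divr_gt0.
have idm : measurable_fun [set: measurableTypeR R] (idfun : measurableTypeR R -> R).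
  exact: measurable_id.
(* Centring at [x + K * del] and [x - K * del] makes one bound of [cdf_slog] for [W n] fall exactly
   at [x]; the opposite bounds for the Gaussian fall at distance [2 * K * del] from [x]. *)
have near1 := slog_close (x + K * del) d0 e8.
have near2 := slog_close (x - K * del) d0 e8.
near=> n.
have h1 : `|Ex P (slog (x + K * del) del \o W n) - Ex (normal_prob 0 1) (slog (x + K * del) del)| <= eta / 8.
  by near: n; exact: near1.
have h2 : `|Ex P (slog (x - K * del) del \o W n) - Ex (normal_prob 0 1) (slog (x - K * del) del)| <= eta / 8.
  by near: n; exact: near2.
have /andP[a1 _] := cdf_slog P (x + K * del) K (mW n) d0.
have /andP[_ a2] := cdf_slog P (x - K * del) K (mW n) d0.
have /andP[_ b1] := cdf_slog (normal_prob 0 1) (x + K * del) K idm d0.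
have /andP[b2 _] := cdf_slog (normal_prob 0 1) (x - K * del) K idm d0.
rewrite addrK in a1; rewrite subrK in a2.
rewrite (_ : x + K * del + K * del = x + 2 * K * del) in b1; last by ring.
rewrite (_ : x - K * del - K * del = x - 2 * K * del) in b2; last by ring.
have Kd : 0 <= 2 * K * del by rewrite mulr_ge0 ?(ltW d0)// mulr_ge0 ?(ltW K0).
have l1 := @Phi_lipschitz x (x + 2 * K * del) _.
have l2 := @Phi_lipschitz (x - 2 * K * del) x _.
rewrite (_ : x + 2 * K * del - x = 2 * K * del) in l1; last by ring.
rewrite (_ : x - (x - 2 * K * del) = 2 * K * del) in l2; last by ring.
rewrite lerDl in l1; rewrite gerBl in l2.
exact: (sandwich_arith a1 a2 b1 b2 (l1 Kd) (l2 Kd) h1 h2 eK hd e0).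
Unshelve. all: end_near. Qed.

End Slutsky.

(** * Perimeter of the hull of a random walk *)

Section HullMeasurable.
Context {d : measure_display} {T : measurableType d} {R : realType}.
Variable pts : nat -> T -> R * R.
Hypothesis m1 : forall k, measurable_fun setT (fun w => (pts k w).1).
Hypothesis m2 : forall k, measurable_fun setT (fun w => (pts k w).2).

Let s (ks : seq nat) w := [seq pts k w | k <- ks].

Let meq j k : measurable_fun setT (fun w => pts j w == pts k w).
Proof. by apply: measurable_and; exact: measurable_fun_eqr. Qed.

Let mmem k ks : measurable_fun setT (fun w => pts k w \in s ks w).
Proof.
elim: ks => [|j ks IH]; first exact: measurable_cst.
rewrite (_ : (fun w => _) = fun w => (pts k w == pts j w) || (pts k w \in s ks w)).
  exact: measurable_or.
by apply/funext => w; rewrite /s /= inE.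
Qed.

(** Which points survive [undup] depends on [w]; recursion on the fixed index list turns this into
    measurable case distinctions. *)
Let mundup (G : R * R -> T -> R) ks :
  (forall k, measurable_fun setT (fun w => G (pts k w) w)) ->
  measurable_fun setT (fun w => \sum_(p <- undup (s ks w)) G p w).
Proof.
move=> mG; elim: ks => [|k ks IH].
  by under eq_fun do rewrite big_nil; exact: measurable_cst.
rewrite (_ : (fun w => _) = fun w => if pts k w \in s ks w
    then \sum_(p <- undup (s ks w)) G p w
    else G (pts k w) w + \sum_(p <- undup (s ks w)) G p w).
  by apply: measurable_fun_ifT => //; exact: measurable_funD.
by apply/funext => w; rewrite /s /=; case: ifP => // _; rewrite big_cons.
Qed.

Let mall (C : R * R -> T -> bool) ks :
  (forall k, measurable_fun setT (fun w => C (pts k w) w)) ->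
  measurable_fun setT (fun w => all (fun r => C r w) (s ks w)).
Proof.
move=> mC; elim: ks => [|k ks IH]; first exact: measurable_cst.
exact: measurable_and.
Qed.

Let mB1 j k : measurable_fun setT (fun w => (pts j w).1 - (pts k w).1).
Proof. exact: measurable_funB. Qed.

Let mB2 j k : measurable_fun setT (fun w => (pts j w).2 - (pts k w).2).
Proof. exact: measurable_funB. Qed.

Let mcross i j k : measurable_fun setT (fun w => cross3 (pts i w) (pts j w) (pts k w)).
Proof. by apply: measurable_funB; exact: measurable_funM. Qed.

Let mdot i j k : measurable_fun setT (fun w => dot3 (pts i w) (pts j w) (pts k w)).
Proof. by apply: measurable_funD; exact: measurable_funM. Qed.

Let mdist i j : measurable_fun setT (fun w => dist2 (pts i w) (pts j w)).
Proof.
have ms : measurable_fun [set: R] (@Num.sqrt R).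
  by apply: continuous_measurable_fun; exact: sqrt_continuous.
apply: (measurableT_comp ms).
by apply: measurable_funD; exact: measurable_funX.
Qed.

Let medge ks i j : measurable_fun setT (fun w => hull_edge (s ks w) (pts i w) (pts j w)).
Proof.
apply: measurable_and; first by apply: measurable_neg; exact: meq.
apply: measurable_and.
  apply: (@mall (fun r w => 0 <= cross3 (pts i w) (pts j w) r)) => k.
  by apply: measurable_fun_ler => //; exact: mcross.
rewrite (_ : (fun w => _) =
   fun w => all (fun r => ~~ on_open_seg (pts i w) (pts j w) r) (s ks w)).
  apply: (@mall (fun r w => ~~ on_open_seg (pts i w) (pts j w) r)) => k.
  apply: measurable_neg; apply: measurable_and.
    apply: measurable_and; last by apply: measurable_fun_ltr => //; exact: mdot.
    by apply: measurable_fun_eqr => //; exact: mcross.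
  by apply: measurable_fun_ltr; exact: mdot.
by apply/funext => w; rewrite all_predC.
Qed.

Lemma measurable_hull_perimeter ks :
  measurable_fun setT (fun w => hull_perimeter (s ks w)).
Proof.
apply: (@mundup (fun p w => \sum_(q <- undup (s ks w) | hull_edge (s ks w) p q) dist2 p q)) => i.
under eq_fun do rewrite big_mkcond.
apply: (@mundup (fun q w => if hull_edge (s ks w) (pts i w) q then dist2 (pts i w) q else 0)) => j.
by apply: measurable_fun_ifT.
Qed.

End HullMeasurable.

Section HullBounds.
Context {R : realType} {T : Type}.
Implicit Types (a b e : R).

Lemma prefix_le_maxsum (xi : nat -> T -> R) n k w : (k <= n)%N ->
  \sum_(i < k) xi i w <= maxsum xi (iota 0 n) w.
Proof.
move=> kn; rewrite -(big_mkord predT (fun i => xi i w)) /index_iota subn0.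
have <- : take k (iota 0 n) = iota 0 k by rewrite take_iota (minn_idPl kn).
exact: maxsum_ge.
Qed.

(** The last [n - k] steps form a prefix of the reversed list, up to order. *)
Lemma suffix_le_maxsum (xi : nat -> T -> R) n k w : (k <= n)%N ->
  \sum_(i < n) xi i w - \sum_(i < k) xi i w <= maxsum xi (rev (iota 0 n)) w.
Proof.
move=> kn; rewrite -(big_mkord predT (fun i => xi i w)).
rewrite -(big_mkord predT (fun i => xi i w)) (big_cat_nat (leq0n k) kn)/= addrAC subrr add0r.
have e : take (n - k) (rev (iota 0 n)) = rev (index_iota k n).
  rewrite take_rev size_iota subKn// /index_iota.
  by rewrite -{1}(subnKC kn) iotaD drop_size_cat ?size_iota// add0n.
rewrite (perm_big (take (n - k) (rev (iota 0 n)))) ?maxsum_ge//=.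
by rewrite e perm_sym perm_rev.
Qed.

Variable Z : nat -> T -> R * R.

Definition step_lform a b (i : nat) (w : T) : R := lform a b (Z i w).

Lemma lform_walk a b k w : lform a b (walk Z k w) = \sum_(i < k) step_lform a b i w.
Proof.
by rewrite /lform /walk /= !mulr_sumr -big_split.
Qed.

Lemma step_lformN a b i w : step_lform (- a) (- b) i w = - step_lform a b i w.
Proof. exact: lformN. Qed.

Lemma lform_walk_le a b n k w : (k <= n)%N ->
  lform a b (walk Z k w) <= maxsum (step_lform a b) (iota 0 n) w.
Proof. by move=> kn; rewrite lform_walk; exact: prefix_le_maxsum. Qed.

(** For a form with positive drift the maximum is reached near the end: going back from time [n]
    adds the negated steps, whose drift is negative. *)
Lemma lform_walk_leD a b n k w : (k <= n)%N ->
  lform a b (walk Z k w) <=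
  lform a b (walk Z n w) + maxsum (step_lform (- a) (- b)) (rev (iota 0 n)) w.
Proof.
move=> kn; rewrite !lform_walk -lerBlDl.
have := suffix_le_maxsum (step_lform (- a) (- b)) w kn.
rewrite (eq_bigr (fun i : 'I_n => - step_lform a b i w)); last by move=> i _; exact: step_lformN.
rewrite [X in _ - X <= _](eq_bigr (fun i : 'I_k => - step_lform a b i w)); last by move=> i _; exact: step_lformN.
by rewrite !sumrN opprK addrC.
Qed.

Local Notation pts n w := [seq walk Z k w | k <- iota 0 n.+1].

Lemma pts_le n w a b (u v : R) :
  (forall k, (k <= n)%N -> u <= lform a b (walk Z k w) <= v) ->
  forall r, r \in pts n w -> u <= lform a b r <= v.
Proof.
move=> h r /mapP[k]; rewrite mem_iota add0n => /andP[_ kn] ->.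
by apply: h; rewrite -ltnS.
Qed.

Variables (u1 u2 : R) (u11 : u1 ^+ 2 + u2 ^+ 2 = 1).

(** Every edge is at least as long as its projection on the unit vector, and the projections sum to
    twice a width containing both the start and the end of the walk. *)
Lemma hull_len_ge n w : 2 * lform u1 u2 (walk Z n w) <= hull_len Z n w.
Proof.
have u0 : 0 < u1 ^+ 2 + u2 ^+ 2 by rewrite u11.
have h0 : walk Z 0 w \in pts n w by apply/mapP; exists 0%N.
have hn : walk Z n w \in pts n w.
  by apply/mapP; exists n; rewrite // mem_iota add0n ltnSn.
have := sum_hull_edge_lform_ge u0 h0 hn.
have -> : lform u1 u2 (walk Z 0 w) = 0 by rewrite lform_walk big_ord0.
rewrite subr0 => /le_trans; apply.
rewrite /hull_len /hull_perimeter; apply: ler_sum => p _; apply: ler_sum => q _.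
rewrite -sqrtr_sqr /dist2 ler_wsqrtr//.
have -> : (q.1 - p.1) ^+ 2 + (q.2 - p.2) ^+ 2 =
    (u1 ^+ 2 + u2 ^+ 2) * ((q.1 - p.1) ^+ 2 + (q.2 - p.2) ^+ 2) by rewrite u11 mul1r.
rewrite /lform -subr_ge0.
rewrite (_ : _ - _ = (u1 * (q.2 - p.2) - u2 * (q.1 - p.1)) ^+ 2); last by ring.
exact: sqr_ge0.
Qed.

(* An edge with |y| <= 2e|x| is at most |x| + e|y| long; for a steeper one the
   last three terms, which equal 2(|y| - e|x|)^+, exceed |y|. *)
Let dist2_le e p q : 0 < e ->
  dist2 p q <= `|lform u1 u2 q - lform u1 u2 p|
    + e * `|lform (- u2) u1 q - lform (- u2) u1 p|
    + (`|lform (- u2 - e * u1) (u1 - e * u2) q - lform (- u2 - e * u1) (u1 - e * u2) p|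
     + `|lform (u2 - e * u1) (- u1 - e * u2) q - lform (u2 - e * u1) (- u1 - e * u2) p|
     - 2 * e * `|lform u1 u2 q - lform u1 u2 p|).
Proof.
move=> e0.
set x := lform u1 u2 q - lform u1 u2 p.
set y := lform (- u2) u1 q - lform (- u2) u1 p.
have -> : lform (- u2 - e * u1) (u1 - e * u2) q - lform (- u2 - e * u1) (u1 - e * u2) p = y - e * x.
  by rewrite /x /y /lform; ring.
have -> : lform (u2 - e * u1) (- u1 - e * u2) q - lform (u2 - e * u1) (- u1 - e * u2) p = - (y + e * x).
  by rewrite /x /y /lform; ring.
have -> : dist2 p q = Num.sqrt (x ^+ 2 + y ^+ 2).
  rewrite /dist2; congr Num.sqrt.
  have -> : (q.1 - p.1) ^+ 2 + (q.2 - p.2) ^+ 2 =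
    (u1 ^+ 2 + u2 ^+ 2) * ((q.1 - p.1) ^+ 2 + (q.2 - p.2) ^+ 2) by rewrite u11 mul1r.
  by rewrite /x /y /lform; ring.
rewrite normrN.
have hm : 2 * Num.max `|y| (e * `|x|) <= `|y - e * x| + `|y + e * x|.
  have h1 : 2 * `|y| <= `|y - e * x| + `|y + e * x|.
    rewrite -[2]gtr0_norm// -normrM.
    by rewrite (_ : 2 * y = (y - e * x) + (y + e * x)) ?ler_normD//; ring.
  have h2 : 2 * (e * `|x|) <= `|y - e * x| + `|y + e * x|.
    rewrite -[2]gtr0_norm// -[e in e * `|x|]gtr0_norm// -!normrM.
    rewrite (_ : 2 * (e * x) = (y + e * x) - (y - e * x)); last by ring.
    by rewrite [leRHS]addrC ler_normB.
  by rewrite maxEle; case: ifP.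
have x0 := normr_ge0 x; have y0 := normr_ge0 y.
have ex0 : 0 <= e * `|x| by rewrite mulr_ge0// ltW.
have ey0 : 0 <= e * `|y| by rewrite mulr_ge0// ltW.
have [flat|steep] := leP `|y| (2 * e * `|x|).
- apply: (@le_trans _ _ (`|x| + e * `|y|)).
    rewrite -[leRHS]ger0_norm ?addr_ge0// -sqrtr_sqr ler_wsqrtr//.
    rewrite -[x ^+ 2]real_normK ?num_real// -[y ^+ 2]real_normK ?num_real//.
    rewrite sqrrD -addrA lerD2l.
    have : `|y| * `|y| <= 2 * e * `|x| * `|y| by rewrite ler_wpM2r.
    rewrite (_ : `|x| * (e * `|y|) *+ 2 = 2 * e * `|x| * `|y|); last by ring.
    by rewrite expr2 => /le_trans; apply; rewrite lerDl sqr_ge0.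
  rewrite lerDl subr_ge0.
  apply: le_trans hm; rewrite -mulrA ler_pM2l// le_max lexx orbT//.
- apply: (@le_trans _ _ (`|x| + `|y|)).
    rewrite -[leRHS]ger0_norm ?addr_ge0// -sqrtr_sqr ler_wsqrtr//.
    rewrite -[x ^+ 2]real_normK ?num_real// -[y ^+ 2]real_normK ?num_real//.
    by rewrite sqrrD -addrA lerD2l lerDr mulrn_wge0// mulr_ge0.
  have : 2 * `|y| <= `|y - e * x| + `|y + e * x|.
    by apply: le_trans hm; rewrite ler_pM2l// le_max lexx.
  by move: steep; rewrite -mulrA; lra.
Qed.

(** Summing [dist2_le] over the edges turns absolute values into widths. The condition [e <= 1 / 2]
    keeps the coefficient [1 - 2 * e] nonnegative; the terminal values of the two tilted forms sum
    to -2e X_n and restore exactly what this coefficient removes from 2 X_n. *)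
Lemma hull_len_le e n w : 0 < e -> e <= 1 / 2 ->
  hull_len Z n w <= 2 * lform u1 u2 (walk Z n w)
   + 2 * ((maxsum (step_lform (- u1) (- u2)) (iota 0 n) w
           + maxsum (step_lform (- u1) (- u2)) (rev (iota 0 n)) w)
        + (maxsum (step_lform (- u2 - e * u1) (u1 - e * u2)) (iota 0 n) w
           + maxsum (step_lform (- u2 - e * u1) (u1 - e * u2)) (rev (iota 0 n)) w)
        + (maxsum (step_lform (u2 - e * u1) (- u1 - e * u2)) (iota 0 n) w
           + maxsum (step_lform (u2 - e * u1) (- u1 - e * u2)) (rev (iota 0 n)) w)
        + e * (maxsum (step_lform (- u2) u1) (iota 0 n) w
           + maxsum (step_lform u2 (- u1)) (iota 0 n) w)).
Proof.
move=> e0 e1.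
have s0 : pts n w != [::] by [].
pose W a b := \sum_(p <- undup (pts n w)) \sum_(q <- undup (pts n w) | hull_edge (pts n w) p q)
     `|lform a b q - lform a b p|.
have LW : hull_len Z n w <= W u1 u2 + e * W (- u2) u1 + (W (- u2 - e * u1) (u1 - e * u2)
      + W (u2 - e * u1) (- u1 - e * u2) - 2 * e * W u1 u2).
  rewrite /W !mulr_sumr -!big_split -sumrB -big_split/=.
  apply: ler_sum => p _.
  rewrite !mulr_sumr -!big_split -sumrB -big_split/=.
  by apply: ler_sum => q _; exact: dist2_le.
have x := lform u1 u2 (walk Z n w); have y := lform (- u2) u1 (walk Z n w).
have bnd a b k : (k <= n)%N ->
    - maxsum (step_lform (- a) (- b)) (iota 0 n) w <= lform a b (walk Z k w).
  by move=> kn; rewrite lerNl -lformN lform_walk_le.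
have bnd' a b k : (k <= n)%N ->
    lform a b (walk Z n w) - maxsum (step_lform a b) (rev (iota 0 n)) w <= lform a b (walk Z k w).
  move=> kn; have := lform_walk_leD (- a) (- b) w kn.
  by rewrite !lformN !opprK; lra.
have u0 : 0 < u1 ^+ 2 + u2 ^+ 2 by rewrite u11.
have v0 : 0 < (- u2) ^+ 2 + u1 ^+ 2 by rewrite sqrrN addrC.
have ee : 0 < 1 + e ^+ 2 by rewrite ltr_pwDl// sqr_ge0.
have p0 : 0 < (- u2 - e * u1) ^+ 2 + (u1 - e * u2) ^+ 2.
  have -> : (- u2 - e * u1) ^+ 2 + (u1 - e * u2) ^+ 2 =
    (u1 ^+ 2 + u2 ^+ 2) * (1 + e ^+ 2) by ring.
  by rewrite u11 mul1r.
have q0 : 0 < (u2 - e * u1) ^+ 2 + (- u1 - e * u2) ^+ 2.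
  have -> : (u2 - e * u1) ^+ 2 + (- u1 - e * u2) ^+ 2 =
    (u1 ^+ 2 + u2 ^+ 2) * (1 + e ^+ 2) by ring.
  by rewrite u11 mul1r.
(* Drift decides the reference points: along [u] the minimum is compared with the start and the
   maximum with the end, for the tilted forms the reverse, and in the driftless direction both with
   the start. *)
have Wx := sum_hull_edge_lform_le u0 s0 (pts_le (fun k kn =>
  introT andP (conj (bnd u1 u2 k kn) (lform_walk_leD u1 u2 w kn)))).
have Wy := sum_hull_edge_lform_le v0 s0 (pts_le (fun k kn =>
  introT andP (conj (bnd (- u2) u1 k kn) (lform_walk_le (- u2) u1 w kn)))).
have Wp := sum_hull_edge_lform_le p0 s0 (pts_le (fun k kn =>
  introT andP (conj (bnd' _ _ k kn) (lform_walk_le _ _ w kn)))).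
have Wq := sum_hull_edge_lform_le q0 s0 (pts_le (fun k kn =>
  introT andP (conj (bnd' _ _ k kn) (lform_walk_le _ _ w kn)))).
rewrite -/(W _ _) in Wx; rewrite -/(W _ _) in Wy; rewrite -/(W _ _) in Wp; rewrite -/(W _ _) in Wq.
rewrite !opprK in Wy.
have Ep : lform (- u2 - e * u1) (u1 - e * u2) (walk Z n w) =
  lform (- u2) u1 (walk Z n w) - e * lform u1 u2 (walk Z n w) by rewrite /lform; ring.
have Eq : lform (u2 - e * u1) (- u1 - e * u2) (walk Z n w) =
  - lform (- u2) u1 (walk Z n w) - e * lform u1 u2 (walk Z n w) by rewrite /lform; ring.
rewrite Ep in Wp; rewrite Eq in Wq.
apply: le_trans LW _.
have Wx' := ler_wpM2l (_ : 0 <= 1 - 2 * e) Wx.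
have Wy' := ler_wpM2l (ltW e0) Wy.
have h1 : 0 <= 1 - 2 * e by lra.
have {}Wx' := Wx' h1.
have h2 := mulr_ge0 (ltW e0) (addr_ge0 (maxsum_ge0 (step_lform (- u1) (- u2)) (iota 0 n) w)
   (maxsum_ge0 (step_lform (- u1) (- u2)) (rev (iota 0 n)) w)).
move: Wx' Wy' Wp Wq h2.
move: (W _ _) (W _ _) (W _ _) (W _ _) => Ax Ay Ap Aq.
move: (maxsum _ _ _) (maxsum _ _ _) (maxsum _ _ _) (maxsum _ _ _) (maxsum _ _ _) (maxsum _ _ _) (maxsum _ _ _) (maxsum _ _ _).
move=> M1 M2 M3 M4 M5 M6 M7 M8.
move: (lform _ _ _) (lform _ _ _) => X Y.
clear => *; lra.
Qed.

End HullBounds.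

(** * Second moments and change of normalization *)

Section PartialSumVariance.
Context {d : measure_display} {T : measurableType d} {R : realType}.
Variables (P : probability T R) (xi : nat -> T -> R).
Hypothesis iid : iid_seq P xi.
Hypotheses (sq0 : sq P (xi 0)) (mean0 : Ex P (xi 0) = 0).

Lemma psum_sq (t : R) k : sq P (fun w => \sum_(i < k) t * xi i w) /\
  Ex P (fun w => (\sum_(i < k) t * xi i w) ^+ 2) = k%:R * (t ^+ 2 * Ex P (fun w => xi 0 w ^+ 2)).
Proof.
elim: k => [|k [sk Ek]].
  under eq_fun do rewrite big_ord0.
  split; first exact: sq_cst.
  by under eq_fun do rewrite big_ord0 expr0n; rewrite Ex_cst mul0r.
have [sx Ex2] := iid_sq iid k sq0.
have [ix m0] := iid_Ex iid k (sq_itg sq0).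
have sx' := sqZ t sx.
have rec : (fun w => \sum_(i < k.+1) t * xi i w) =
    fun w => t * xi k w + \sum_(i < k) t * xi i w.
  by apply/funext => w; rewrite big_ord_recr /= addrC.
split; first by rewrite rec; exact: sqD.
have -> : (fun w => (\sum_(i < k.+1) t * xi i w) ^+ 2) =
    fun w => (t * xi k w + \sum_(i < k) t * xi i w) ^+ 2.
  by apply/funext => w; rewrite big_ord_recr /= addrC.
have ind : indep P (xi k) (fun w => \sum_(i < k) t * xi i w).
  apply: (@past_indep _ _ _ _ _ iid (iota 0 k)).
    by rewrite /= iota_uniq mem_iota ltnn.
  apply: measurable_sum => i; apply: measurable_funM => //.
  by apply: past_measurable; rewrite mem_iota /= add0n ltn_ord.
have mt : measurable_fun [set: R] (fun x : R => t * x) by exact: measurable_funM.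
have ind' := indep_comp mt (@measurable_id _ R setT) ind.
rewrite Ex_sqrD// Ek.
have -> : Ex P (fun w => t * xi k w * \sum_(i < k) t * xi i w) = 0.
  have := indep_ExM ind' (sq_itg sx') (sq_itg sk); rewrite /comp => ->.
  by rewrite ExZ// m0 mean0 mulr0 mul0r.
under eq_fun do rewrite exprMn.
rewrite ExZ; last by case: sx.
rewrite Ex2 mulr0 addr0 -[k.+1]add1n natrD; ring.
Qed.

Lemma psum_mean (t : R) k : Ex P (fun w => \sum_(i < k) t * xi i w) = 0.
Proof.
elim: k => [|k Ek]; first by under eq_fun do rewrite big_ord0; rewrite Ex_cst.
have [ix m0] := iid_Ex iid k (sq_itg sq0).
under eq_fun do rewrite big_ord_recr/=.
rewrite ExD; [|by apply: sq_itg; exact: (psum_sq t k).1|exact: itgZ].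
by rewrite Ek ExZ// m0 mean0 mulr0 addr0.
Qed.

End PartialSumVariance.

Section Normalization.
Context {d : measure_display} {T : measurableType d} {R : realType}.
Variable P : probability T R.

Lemma Ex_var_le (X : T -> R) : sq P X ->
  Ex P (fun w => (X w - Ex P X) ^+ 2) <= Ex P (fun w => X w ^+ 2).
Proof.
move=> sX; rewrite [leLHS](Ex_sqrD sX (sq_cst P (- Ex P X))) Ex_cst.
under [X in 2 * Ex _ X]eq_fun do rewrite mulrC.
rewrite ExZ; last exact: sq_itg.
by have := sqr_ge0 (Ex P X); lra.
Qed.

(** The inequality 2ab <= del a^2 + b^2 / del gives |1 - v| <= 3 del, so [v] is positive for
    [del <= 1 / 6]. The constant 20 is 2 for [Q - V] plus 2 times 3^2 for the rescaling of [Q]. *)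
Lemma sq_near1 (V Q : T -> R) (del : R) : sq P V -> sq P Q -> 0 < del -> del <= 1 / 6 ->
  Ex P (fun w => V w ^+ 2) = 1 -> Ex P (fun w => (Q w - V w) ^+ 2) <= del ^+ 2 ->
  let v := Ex P (fun w => Q w ^+ 2) in
  0 < v /\ Ex P (fun w => (Q w / Num.sqrt v - V w) ^+ 2) <= 20 * del ^+ 2.
Proof.
move=> sV sQ d0 d6 V1 hD v.
have sD := sqB sQ sV.
have iVD := sq_itgM sV sD.
have ED0 : 0 <= Ex P (fun w => (Q w - V w) ^+ 2) by apply: Ex_ge0 => w; exact: sqr_ge0.
set D2 := Ex P (fun w => (Q w - V w) ^+ 2) in hD ED0.
have vE : v = 1 + 2 * Ex P (fun w => V w * (Q w - V w)) + D2.
  have := Ex_sqrD sV sD; rewrite V1 -/D2 => <-.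
  by congr (Ex P _); apply/funext => w; congr (_ ^+ 2); ring.
have dn : del != 0 by rewrite gt_eqF.
have bound : 2 * `|Ex P (fun w => V w * (Q w - V w))| <= 2 * del.
  have i2 : itg P (fun w => del * V w ^+ 2 + del^-1 * (Q w - V w) ^+ 2).
    by apply: itgD; apply: itgZ; [exact: sV.2|exact: sD.2].
  have h : Ex P (fun w => 2 * `|V w * (Q w - V w)|) <=
      Ex P (fun w => del * V w ^+ 2 + del^-1 * (Q w - V w) ^+ 2).
    apply: Ex_le => //; first by apply: itgZ; exact: itg_norm.
    move=> w; rewrite normrM -[V w ^+ 2]real_normK ?num_real//.
    rewrite -[(Q w - V w) ^+ 2]real_normK ?num_real//.
    set a := `|V w|; set b := `|_|.
    rewrite -subr_ge0 (_ : _ - _ = del * (a - del^-1 * b) ^+ 2); last by field.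
    by rewrite mulr_ge0 ?sqr_ge0// ltW.
  rewrite ExZ in h; last exact: itg_norm.
  rewrite ExD in h; [|by apply: itgZ; exact: sV.2|by apply: itgZ; exact: sD.2].
  rewrite ExZ in h; last exact: sV.2.
  rewrite ExZ in h; last exact: sD.2.
  rewrite V1 mulr1 -/D2 in h.
  apply: (@le_trans _ _ (2 * Ex P (fun w => `|V w * (Q w - V w)|))).
    by rewrite ler_pM2l//; exact: Ex_norm.
  apply: le_trans h _.
  have : del^-1 * D2 <= del by rewrite mulrC ler_pdivrMr// -expr2.
  lra.
have v1 : `|1 - v| <= 3 * del.
  have hd2 : D2 <= del by apply: le_trans hD _; rewrite expr2 ler_piMl// ?(ltW d0)//; lra.
  move: bound; rewrite vE ler_norml => bound.
  have := ler_norm (Ex P (fun w => V w * (Q w - V w))).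
  have := ler_norm (- Ex P (fun w => V w * (Q w - V w))); rewrite normrN.
  by move=> h1 h2; apply/andP; split; lra.
have v0 : 0 < v.
  by move: v1; rewrite ler_norml => /andP[h1 h2]; lra.
split=> //; set r := Num.sqrt v.
have r0 : 0 < r by rewrite sqrtr_gt0.
have r2 : r ^+ 2 = v by rewrite sqr_sqrtr// ltW.
have c0 : `|1 - r| <= `|1 - v|.
  have -> : 1 - v = (1 - r) * (1 + r) by rewrite -r2; ring.
  by rewrite normrM ler_peMr// ger0_norm ?addr_ge0 ?(ltW r0)// lerDl ltW.
have iS : itg P (fun w => 2 * (Q w - V w) ^+ 2 + 2 * (r^-1 - 1) ^+ 2 * Q w ^+ 2).
  by apply: itgD; apply: itgZ; [exact: sD.2|exact: sQ.2].
have sQr : sq P (fun w => Q w / r) by under eq_fun do rewrite mulrC; exact: sqZ.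
apply: (@le_trans _ _ (Ex P (fun w => 2 * (Q w - V w) ^+ 2 + 2 * (r^-1 - 1) ^+ 2 * Q w ^+ 2))).
  apply: Ex_le => //; first exact: (sqB sQr sV).2.
  move=> w; rewrite -subr_ge0.
  rewrite (_ : _ - _ = ((Q w - V w) - (r^-1 - 1) * Q w) ^+ 2); last by ring.
  exact: sqr_ge0.
rewrite ExD; [|by apply: itgZ; exact: sD.2|by apply: itgZ; exact: sQ.2].
rewrite ExZ; last exact: sD.2.
rewrite ExZ; last exact: sQ.2.
rewrite -/v -/D2 -r2.
have -> : 2 * (r^-1 - 1) ^+ 2 * r ^+ 2 = 2 * (1 - r) ^+ 2 by field; rewrite gt_eqF.
have : (1 - r) ^+ 2 <= (3 * del) ^+ 2.
  rewrite -real_normK ?num_real// lerXn2r ?nnegrE ?mulr_ge0 ?(ltW d0)//.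
  exact: le_trans c0 v1.
rewrite exprMn; move: hD; lra.
Qed.

(** Allows the deterministic scale to be exchanged for the actual standard deviation without a
    separate study of the variance. *)
Lemma normalize_cvg (V Q : nat -> T -> R) :
  (forall n, sq P (V n)) -> (forall n, sq P (Q n)) ->
  (forall n, (0 < n)%N -> Ex P (fun w => V n w ^+ 2) = 1) ->
  Ex P (fun w => (Q n w - V n w) ^+ 2) @[n --> \oo] --> 0 ->
  Ex P (fun w => (Q n w / Num.sqrt (Ex P (fun w => Q n w ^+ 2)) - V n w) ^+ 2)
    @[n --> \oo] --> 0.
Proof.
move=> sV sQ V1 h0; apply/cvgrPdist_le => eps e0.
pose del := Num.min (1 / 6) (eps / 20).
have d0 : 0 < del by rewrite lt_min !divr_gt0.
have d6 : del <= 1 / 6 by rewrite ge_min lexx.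
have de : del <= eps / 20 by rewrite ge_min lexx orbT.
move/cvgrPdist_le : h0 => /(_ _ (exprn_gt0 2 d0)) near0.
near=> n.
have n0 : (0 < n)%N by near: n; exact: nbhs_infty_gt.
have hD : `|0 - Ex P (fun w => (Q n w - V n w) ^+ 2)| <= del ^+ 2 by near: n; exact: near0.
rewrite sub0r normrN ger0_norm in hD; last by apply: Ex_ge0 => w; exact: sqr_ge0.
have [_ h] := sq_near1 (sV n) (sQ n) d0 d6 (V1 n n0) hD.
rewrite sub0r normrN ger0_norm; last by apply: Ex_ge0 => w; exact: sqr_ge0.
apply: le_trans h _; rewrite expr2.
have : del * del <= del by rewrite ler_piMl ?(ltW d0)//; lra.
lra.
Unshelve. all: end_near. Qed.

End Normalization.

Section HullDefect.
Context {d : measure_display} {T : measurableType d} {R : realType}.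
Variables (P : probability T R) (Z : nat -> T -> R * R).
Hypothesis iid : iid_seq P Z.
Hypothesis itgZ2 : itg P (fun w => (Z 0 w).1 ^+ 2 + (Z 0 w).2 ^+ 2).

Lemma measurable_lform (a b : R) : measurable_fun [set: R * R] (lform a b).
Proof. by apply: measurable_funD; apply: measurable_funM. Qed.

Lemma step_iid a b : iid_seq P (step_lform Z a b).
Proof. exact: (iid_comp iid (measurable_lform a b)). Qed.

Lemma step_sq a b : sq P (step_lform Z a b 0).
Proof.
have m := iid_measurable (step_iid a b) 0; split=> //.
apply: (itg_le _ (itgZ (a ^+ 2 + b ^+ 2) itgZ2)) => [|w]; first exact: measurable_funX.
rewrite ger0_norm ?sqr_ge0// /step_lform /lform -subr_ge0.
rewrite (_ : _ - _ = (a * (Z 0 w).2 - b * (Z 0 w).1) ^+ 2); last by ring.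
exact: sqr_ge0.
Qed.

Lemma Ex_step a b : Ex P (step_lform Z a b 0) =
  a * Ex P (fun w => (Z 0 w).1) + b * Ex P (fun w => (Z 0 w).2).
Proof.
have i1 : itg P (fun w => (Z 0 w).1).
  have := sq_itg (step_sq 1 0); congr (itg _ _); apply/funext => w.
  by rewrite /step_lform /lform mul1r mul0r addr0.
have i2 : itg P (fun w => (Z 0 w).2).
  have := sq_itg (step_sq 0 1); congr (itg _ _); apply/funext => w.
  by rewrite /step_lform /lform mul1r mul0r add0r.
rewrite /step_lform /lform -ExZ// -ExZ// -ExD//; exact: itgZ.
Qed.

Variables (u1 u2 : R) (u11 : u1 ^+ 2 + u2 ^+ 2 = 1).
Hypothesis drift : 0 < Ex P (step_lform Z u1 u2 0).
Hypothesis ortho : Ex P (step_lform Z (- u2) u1 0) = 0.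

Definition hull_defect n w : R := hull_len Z n w - 2 * lform u1 u2 (walk Z n w).

Lemma measurable_walk_lform a b n : measurable_fun setT (fun w => lform a b (walk Z n w)).
Proof.
under eq_fun do rewrite lform_walk.
by apply: measurable_sum => i; exact: iid_measurable (step_iid a b) i.
Qed.

Lemma measurable_hull_len n : measurable_fun setT (hull_len Z n).
Proof.
apply: measurable_hull_perimeter => k.
- have := measurable_walk_lform 1 0 k; congr (measurable_fun _ _); apply/funext => w.
  by rewrite /lform mul1r mul0r addr0.
- have := measurable_walk_lform 0 1 k; congr (measurable_fun _ _); apply/funext => w.
  by rewrite /lform mul1r mul0r add0r.
Qed.

Lemma measurable_hull_defect n : measurable_fun setT (hull_defect n).
Proof.
apply: measurable_funB; first exact: measurable_hull_len.
by apply: measurable_funM => //; exact: measurable_walk_lform.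
Qed.

Let sqrD2 (x y : R) : (x + y) ^+ 2 <= 2 * (x ^+ 2 + y ^+ 2).
Proof.
rewrite -subr_ge0 (_ : _ - _ = (x - y) ^+ 2); last by ring.
exact: sqr_ge0.
Qed.

Let defect_arith (a1 a2 b1 b2 d1 d2 q th n C1 C2 C3 : R) :
  a1 <= th / 576 * n + C1 -> a2 <= th / 576 * n + C1 ->
  b1 <= th / 576 * n + C2 -> b2 <= th / 576 * n + C2 ->
  d1 <= th / 576 * n + C3 -> d2 <= th / 576 * n + C3 ->
  0 <= th * n -> q <= th / 192 * n -> 64 * (C1 + C2 + C3) <= n * (th / 3) ->
  32 * ((a1 + a2) + (b1 + b2) + (d1 + d2) + q) <= th * n.
Proof. by clear => *; lra. Qed.

(** Of the eight maxima in [hull_len_le], six have negative drift and contribute o(n); the two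
    driftless ones contribute O(n), but with the factor [e ^+ 2]. *)
Lemma hull_defect_sq (theta : R) : 0 < theta ->
  (forall n, sq P (hull_defect n)) /\
  \forall n \near \oo, Ex P (fun w => hull_defect n w ^+ 2) <= theta * n%:R.
Proof.
move=> th0.
pose m := Ex P (step_lform Z u1 u2 0); have dr : 0 < m := drift.
have E a b : Ex P (step_lform Z (- a) (- b) 0) = - Ex P (step_lform Z a b 0).
  by rewrite !Ex_step; ring.
have Ec e a b a' b' : Ex P (step_lform Z (a - e * a') (b - e * b') 0) =
   Ex P (step_lform Z a b 0) - e * Ex P (step_lform Z a' b' 0).
  by rewrite !Ex_step; ring.
pose v := Ex P (fun w => step_lform Z (- u2) u1 0 w ^+ 2).
have v0 : 0 <= v by apply: Ex_ge0 => w; exact: sqr_ge0.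
(* [1 / 2] is the constraint of [hull_len_le]; the other bound brings the two driftless maxima below
   [theta / 192 * n], with [v + 1] instead of [v] to avoid dividing by 0. *)
pose e := Num.min (1 / 2) (theta / (192 * (v + 1))).
have den : 0 < 192 * (v + 1) by apply: mulr_gt0; [rewrite ltr0n|lra].
have e0 : 0 < e by rewrite lt_min !divr_gt0.
have e12 : e <= 1 / 2 by rewrite ge_min lexx.
have eth : e * (192 * (v + 1)) <= theta by rewrite -ler_pdivlMr// ge_min lexx orbT.
have d1 : Ex P (step_lform Z (- u1) (- u2) 0) < 0 by rewrite E oppr_lt0.
(* The orthogonal form has mean 0, so tilting by [e] creates the drift [- e * m]. *)
have d2 : Ex P (step_lform Z (- u2 - e * u1) (u1 - e * u2) 0) < 0.
  by rewrite Ec ortho sub0r oppr_lt0 mulr_gt0.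
have ortho' : Ex P (step_lform Z u2 (- u1) 0) = 0.
  by rewrite -[u2]opprK E ortho oppr0.
have d3 : Ex P (step_lform Z (u2 - e * u1) (- u1 - e * u2) 0) < 0.
  by rewrite Ec ortho' sub0r oppr_lt0 mulr_gt0.
pose eta := theta / 576.
have eta0 : 0 < eta by apply: divr_gt0; [exact: th0|rewrite ltr0n].
have [C1 H1] := maxsum_drift (step_iid _ _) (step_sq _ _) d1 eta0.
have [C2 H2] := maxsum_drift (step_iid _ _) (step_sq _ _) d2 eta0.
have [C3 H3] := maxsum_drift (step_iid _ _) (step_sq _ _) d3 eta0.
have o1 : Ex P (step_lform Z (- u2) u1 0) <= 0 by rewrite ortho.
have o2 : Ex P (step_lform Z u2 (- u1) 0) <= 0 by rewrite ortho'.
have ev : Ex P (fun w => step_lform Z u2 (- u1) 0 w ^+ 2) = v.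
  congr (Ex P _); apply/funext => w.
  by rewrite -[u2 in LHS]opprK step_lformN sqrrN.
pose s1 n := iota 0 n; pose s2 n := rev (iota 0 n).
have us1 n : uniq (s1 n) by exact: iota_uniq.
have us2 n : uniq (s2 n) by rewrite rev_uniq iota_uniq.
pose A1 n := maxsum (step_lform Z (- u1) (- u2)) (s1 n).
pose A2 n := maxsum (step_lform Z (- u1) (- u2)) (s2 n).
pose B1 n := maxsum (step_lform Z (- u2 - e * u1) (u1 - e * u2)) (s1 n).
pose B2 n := maxsum (step_lform Z (- u2 - e * u1) (u1 - e * u2)) (s2 n).
pose D1 n := maxsum (step_lform Z (u2 - e * u1) (- u1 - e * u2)) (s1 n).
pose D2 n := maxsum (step_lform Z (u2 - e * u1) (- u1 - e * u2)) (s2 n).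
pose F1 n := maxsum (step_lform Z (- u2) u1) (s1 n).
pose F2 n := maxsum (step_lform Z u2 (- u1)) (s1 n).
have [sA1 eA1] : (forall n, sq P (A1 n)) /\ forall n, Ex P (fun w => A1 n w ^+ 2) <= eta * n%:R + C1.
  by split=> n; have [] := H1 _ (us1 n); rewrite ?size_iota.
have [sA2 eA2] : (forall n, sq P (A2 n)) /\ forall n, Ex P (fun w => A2 n w ^+ 2) <= eta * n%:R + C1.
  by split=> n; have [] := H1 _ (us2 n); rewrite ?size_rev ?size_iota.
have [sB1 eB1] : (forall n, sq P (B1 n)) /\ forall n, Ex P (fun w => B1 n w ^+ 2) <= eta * n%:R + C2.
  by split=> n; have [] := H2 _ (us1 n); rewrite ?size_iota.
have [sB2 eB2] : (forall n, sq P (B2 n)) /\ forall n, Ex P (fun w => B2 n w ^+ 2) <= eta * n%:R + C2.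
  by split=> n; have [] := H2 _ (us2 n); rewrite ?size_rev ?size_iota.
have [sD1 eD1] : (forall n, sq P (D1 n)) /\ forall n, Ex P (fun w => D1 n w ^+ 2) <= eta * n%:R + C3.
  by split=> n; have [] := H3 _ (us1 n); rewrite ?size_iota.
have [sD2 eD2] : (forall n, sq P (D2 n)) /\ forall n, Ex P (fun w => D2 n w ^+ 2) <= eta * n%:R + C3.
  by split=> n; have [] := H3 _ (us2 n); rewrite ?size_rev ?size_iota.
have [sF1 eF1] : (forall n, sq P (F1 n)) /\ forall n, Ex P (fun w => F1 n w ^+ 2) <= n%:R * v.
  by split=> n; have [] := maxsum_sq (step_iid _ _) (us1 n) (step_sq _ _) o1; rewrite ?size_iota.
have [sF2 eF2] : (forall n, sq P (F2 n)) /\ forall n, Ex P (fun w => F2 n w ^+ 2) <= n%:R * v.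
  by split=> n; have [] := maxsum_sq (step_iid _ _) (us1 n) (step_sq _ _) o2; rewrite ?size_iota ?ev.
(* 32 is 4 from the outer factor 2 squared, 4 from squaring a sum of four groups, and 2 from the two
   maxima in each group. Then six rates [theta / 576] amount to [theta / 3]. *)
pose G n w := 32 * ((A1 n w ^+ 2 + A2 n w ^+ 2) + (B1 n w ^+ 2 + B2 n w ^+ 2) +
   (D1 n w ^+ 2 + D2 n w ^+ 2) + e ^+ 2 * (F1 n w ^+ 2 + F2 n w ^+ 2)).
have iA n : itg P (fun w => A1 n w ^+ 2 + A2 n w ^+ 2) by apply: itgD; [case: (sA1 n)|case: (sA2 n)].
have iB n : itg P (fun w => B1 n w ^+ 2 + B2 n w ^+ 2) by apply: itgD; [case: (sB1 n)|case: (sB2 n)].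
have iD n : itg P (fun w => D1 n w ^+ 2 + D2 n w ^+ 2) by apply: itgD; [case: (sD1 n)|case: (sD2 n)].
have iF n : itg P (fun w => F1 n w ^+ 2 + F2 n w ^+ 2) by apply: itgD; [case: (sF1 n)|case: (sF2 n)].
have iAB n := itgD (iA n) (iB n).
have iABD n := itgD (iAB n) (iD n).
have iABDF n := itgD (iABD n) (itgZ (e ^+ 2) (iF n)).
have iG n : itg P (G n) by exact: (itgZ 32 (iABDF n)).
have RG n w : hull_defect n w ^+ 2 <= G n w.
  have r0 : 0 <= hull_defect n w by rewrite subr_ge0 hull_len_ge.
  have := hull_len_le Z u11 n w e0 e12.
  rewrite -/(s1 n) -/(s2 n) -/(A1 n w) -/(A2 n w) -/(B1 n w) -/(B2 n w).
  rewrite -/(D1 n w) -/(D2 n w) -/(F1 n w) -/(F2 n w) -lerBlDl -/(hull_defect n w) => h.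
  set x1 := A1 n w + A2 n w in h; set x2 := B1 n w + B2 n w in h.
  set x3 := D1 n w + D2 n w in h; set x4 := e * (F1 n w + F2 n w) in h.
  apply: (@le_trans _ _ ((2 * (x1 + x2 + x3 + x4)) ^+ 2)).
    by rewrite lerXn2r ?nnegrE// (le_trans r0).
  have k1 := sqrD2 (A1 n w) (A2 n w); have k2 := sqrD2 (B1 n w) (B2 n w).
  have k3 := sqrD2 (D1 n w) (D2 n w).
  have k4 : x4 ^+ 2 <= 2 * (e ^+ 2 * (F1 n w ^+ 2 + F2 n w ^+ 2)).
    by rewrite /x4 exprMn [leRHS]mulrCA ler_wpM2l ?sqr_ge0.
  rewrite -/x1 -/x2 -/x3 in k1 k2 k3.
  have k5 := sqrD2 x1 x2; have k6 := sqrD2 x3 x4.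
  have k7 := sqrD2 (x1 + x2) (x3 + x4).
  rewrite exprMn -[x1 + x2 + x3 + x4]addrA /G; lra.
have sR n : sq P (hull_defect n).
  split; first exact: measurable_hull_defect.
  apply: (itg_le _ (iG n)) => [|w]; last by rewrite ger0_norm ?sqr_ge0.
  by apply: measurable_funX; exact: measurable_hull_defect.
split=> //.
near=> n.
apply: le_trans (Ex_le (sR n).2 (iG n) (RG n)) _.
rewrite /G ExZ// ExD//; last exact: itgZ.
rewrite ExD// ExD// ExZ// ExD; [|exact: (sA1 n).2|exact: (sA2 n).2].
rewrite ExD; [|exact: (sB1 n).2|exact: (sB2 n).2].
rewrite ExD; [|exact: (sD1 n).2|exact: (sD2 n).2].
rewrite ExD; [|exact: (sF1 n).2|exact: (sF2 n).2].
have e2v : e ^+ 2 * (n%:R * v) <= theta / 192 * n%:R / 2.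
  have -> : e ^+ 2 * (n%:R * v) = n%:R * (e * (e * v)) by ring.
  rewrite (_ : theta / 192 * n%:R / 2 = n%:R * (1 / 2 * (theta / 192))); last by field.
  rewrite ler_wpM2l// ler_pM ?(ltW e0) ?mulr_ge0 ?(ltW e0)//.
  rewrite ler_pdivlMr// (le_trans _ eth)// -mulrA ler_wpM2l ?(ltW e0)//; lra.
have eF : e ^+ 2 * (Ex P (fun w => F1 n w ^+ 2) + Ex P (fun w => F2 n w ^+ 2)) <= theta / 192 * n%:R.
  apply: (@le_trans _ _ (e ^+ 2 * (n%:R * v + n%:R * v))).
    by rewrite ler_wpM2l ?sqr_ge0// lerD.
  by rewrite mulrDr; move: e2v; lra.
have nC : 64 * (C1 + C2 + C3) / (theta / 3) <= n%:R.
  by near: n; exact: nbhs_infty_ger.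
rewrite ler_pdivrMr ?divr_gt0// in nC.
exact: (defect_arith (eA1 n) (eA2 n) (eB1 n) (eB2 n) (eD1 n) (eD2 n)
  (mulr_ge0 (ltW th0) (ler0n R n)) eF nC).
Unshelve. all: end_near. Qed.

End HullDefect.

(** * Limit law of the perimeter *)

Unset Implicit Arguments.

Theorem theorem1p2 (d : measure_display) (T : measurableType d) (R : realType)
  (P : probability T R) (Z : nat -> T -> R * R) :
  iid_seq P Z ->
  (\int[P]_w (((Z 0 w).1 ^+ 2 + (Z 0 w).2 ^+ 2)%:E) < +oo)%E ->
  let mu1 := fine (\int[P]_w ((Z 0 w).1)%:E) in
  let mu2 := fine (\int[P]_w ((Z 0 w).2)%:E) in
  Num.sqrt (mu1 ^+ 2 + mu2 ^+ 2) != 0 ->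
  let sigma2 := 4 * fine (\int[P]_w
                  (((((Z 0 w).1 - mu1) * mu1 + ((Z 0 w).2 - mu2) * mu2) ^+ 2)%:E))
                / (mu1 ^+ 2 + mu2 ^+ 2) in
  0 < sigma2 ->
  let EL n := fine (\int[P]_w (hull_len Z n w)%:E) in
  let VarL n := fine (\int[P]_w (((hull_len Z n w - EL n) ^+ 2)%:E)) in
  forall x : R,
    (fun n => P [set w | (hull_len Z n w - EL n) / Num.sqrt (VarL n) <= x])
      @ \oo --> Phi x /\
    (fun n => P [set w | (hull_len Z n w - EL n) / Num.sqrt (sigma2 * n%:R) <= x])
      @ \oo --> Phi x.
Proof.
move=> iid finZ2 mu1 mu2 M0 sigma2 sigma0 EL VarL x.
have mZ0 : measurable_fun setT (Z 0%N) by case: iid.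
have mZ2 : measurable_fun setT (fun w => (Z 0%N w).1 ^+ 2 + (Z 0%N w).2 ^+ 2).
  apply: measurable_funD; apply: measurable_funX.
    exact: (measurableT_comp (@measurable_fst _ _ R R) mZ0).
  exact: (measurableT_comp (@measurable_snd _ _ R R) mZ0).
have itgZ2 : itg P (fun w => (Z 0%N w).1 ^+ 2 + (Z 0%N w).2 ^+ 2).
  apply/integrableP; split; first exact/measurable_EFinP.
  by under eq_integral do rewrite /= ger0_norm ?addr_ge0 ?sqr_ge0//.
pose M := Num.sqrt (mu1 ^+ 2 + mu2 ^+ 2).
have Mpos : 0 < M by rewrite lt_def M0 sqrtr_ge0.
have M2 : M ^+ 2 = mu1 ^+ 2 + mu2 ^+ 2 by rewrite sqr_sqrtr// addr_ge0 ?sqr_ge0.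
have Mn0 : M != 0 by rewrite gt_eqF.
pose u1 := mu1 / M; pose u2 := mu2 / M.
have u11 : u1 ^+ 2 + u2 ^+ 2 = 1.
  by rewrite /u1 /u2 !expr_div_n -mulrDl -M2 divff// expf_neq0.
have EZ1 : Ex P (fun w => (Z 0%N w).1) = mu1 by [].
have EZ2 : Ex P (fun w => (Z 0%N w).2) = mu2 by [].
have drift : Ex P (step_lform Z u1 u2 0) = M.
  rewrite (Ex_step iid itgZ2) EZ1 EZ2 /u1 /u2.
  rewrite (_ : _ + _ = (mu1 ^+ 2 + mu2 ^+ 2) / M); last by ring.
  by rewrite -M2 expr2 mulfK.
have drift0 : 0 < Ex P (step_lform Z u1 u2 0) by rewrite drift.
have ortho : Ex P (step_lform Z (- u2) u1 0) = 0.
  by rewrite (Ex_step iid itgZ2) EZ1 EZ2 /u1 /u2; ring.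
pose R_ := hull_defect Z u1 u2.
have sR n : sq P (R_ n).
  by have [] := hull_defect_sq iid itgZ2 u11 drift0 ortho ltr01.
have eR theta : 0 < theta -> \forall n \near \oo, Ex P (fun w => R_ n w ^+ 2) <= theta * n%:R.
  by move=> t0; have [] := hull_defect_sq iid itgZ2 u11 drift0 ortho t0.
pose s := Num.sqrt sigma2.
have s0 : 0 < s by rewrite sqrtr_gt0.
have s2 : s ^+ 2 = sigma2 by rewrite sqr_sqrtr// ltW.
have sn0 : s != 0 by rewrite gt_eqF.
(* [sigma2] is four times the variance of the projection on [u], the 4 reflecting L_n being close to
   2 X_n; hence this [f] standardizes the projected step. *)
pose f (z : R * R) := 2 / s * (lform u1 u2 z - M).
have mf : measurable_fun [set: R * R] f.
  by apply: measurable_funM => //; apply: measurable_funB => //; exact: measurable_lform.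
pose xi i := f \o Z i.
have iidx : iid_seq P xi by exact: iid_comp iid mf.
have sstep := step_sq iid itgZ2 u1 u2.
have sc : sq P (fun w => step_lform Z u1 u2 0 w - M) by exact: (sqB sstep (sq_cst P M)).
have sqx : sq P (xi 0%N) by exact: (sqZ (2 / s) sc).
have mean0 : Ex P (xi 0%N) = 0.
  rewrite (ExZ (2 / s) (sq_itg sc)) ExB ?Ex_cst ?drift ?subrr ?mulr0//; first exact: sq_itg.
  exact: itg_cst.
have var1 : Ex P (fun w => xi 0%N w ^+ 2) = 1.
  have -> : (fun w => xi 0%N w ^+ 2) = fun w => (4 / sigma2) * (step_lform Z u1 u2 0 w - M) ^+ 2.
    by apply/funext => w; rewrite /xi /f /= exprMn -s2 expr_div_n /step_lform; congr (_ / _ * _); ring.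
  rewrite ExZ; last by case: sc.
  have e : (fun w => (step_lform Z u1 u2 0 w - M) ^+ 2) =
     fun w => (M ^+ 2)^-1 * (((Z 0%N w).1 - mu1) * mu1 + ((Z 0%N w).2 - mu2) * mu2) ^+ 2.
    apply/funext => w; rewrite -exprVn -exprMn; congr (_ ^+ 2).
    have -> : ((Z 0%N w).1 - mu1) * mu1 + ((Z 0%N w).2 - mu2) * mu2 =
      (Z 0%N w).1 * mu1 + (Z 0%N w).2 * mu2 - M ^+ 2 by rewrite M2; ring.
    by rewrite /step_lform /lform /u1 /u2; field.
  have iq : itg P (fun w => (((Z 0%N w).1 - mu1) * mu1 + ((Z 0%N w).2 - mu2) * mu2) ^+ 2).
    rewrite (_ : (fun w => _) = fun w => M ^+ 2 * (step_lform Z u1 u2 0 w - M) ^+ 2).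
      by apply: itgZ; case: sc.
    apply/funext => w; have /= -> := congr1 (fun g => g w) e.
    by rewrite mulrA divff ?mul1r// expf_neq0.
  rewrite e ExZ// M2.
  have -> : sigma2 = 4 * Ex P (fun w => (((Z 0%N w).1 - mu1) * mu1 + ((Z 0%N w).2 - mu2) * mu2) ^+ 2)
     / (mu1 ^+ 2 + mu2 ^+ 2) by [].
  set q := Ex P _.
  have q0 : q != 0.
    apply: contraTneq sigma0 => q0.
    by rewrite (_ : sigma2 = 4 * q / (mu1 ^+ 2 + mu2 ^+ 2))// q0 mulr0 mul0r ltxx.
  by field; rewrite q0 -M2 expf_neq0.
pose t n : R := (Num.sqrt n%:R)^-1.
pose V n w := \sum_(i < n) t n * xi i w.
have sV n : sq P (V n) by have [] := psum_sq iidx sqx mean0 (t n) n.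
have VE n w : V n w = t n * (2 / s) * (lform u1 u2 (walk Z n w) - n%:R * M).
  rewrite /V -mulr_sumr /xi /f /= -mulr_sumr mulrA sumrB lform_walk.
  by rewrite sumr_const card_ord (mulr_natl M).
pose X n w := lform u1 u2 (walk Z n w) - n%:R * M.
have XE n w : X n w = s / 2 * \sum_(i < n) 1 * xi i w.
  rewrite -mulr_sumr mul1r /xi /f /= -mulr_sumr mulrA sumrB /X lform_walk.
  rewrite sumr_const card_ord (mulr_natl M).
  by rewrite (_ : s / 2 * (2 / s) = 1) ?mul1r//; field.
have sX n : sq P (X n).
  rewrite (_ : X n = fun w => s / 2 * \sum_(i < n) 1 * xi i w); last exact/funext.
  by apply: sqZ; have [] := psum_sq iidx sqx mean0 1 n.
have EX n : Ex P (X n) = 0.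
  rewrite (_ : X n = fun w => s / 2 * \sum_(i < n) 1 * xi i w); last exact/funext.
  rewrite ExZ; first by rewrite (psum_mean iidx sqx mean0) mulr0.
  by apply: sq_itg; have [] := psum_sq iidx sqx mean0 1 n.
have LE n : hull_len Z n = fun w => R_ n w + 2 * X n w + 2 * (n%:R * M).
  by apply/funext => w; rewrite /R_ /hull_defect /X; ring.
have sL n : sq P (hull_len Z n).
  by rewrite LE; apply: sqD; [apply: sqD => //; exact: sqZ|exact: sq_cst].
have ELE n : EL n = Ex P (R_ n) + 2 * (n%:R * M).
  have -> : EL n = Ex P (fun w => R_ n w + 2 * X n w + 2 * (n%:R * M)) by rewrite -LE.
  rewrite ExD; [|by apply: sq_itg; apply: sqD => //; exact: sqZ|exact: itg_cst].
  rewrite ExD; [|exact: sq_itg|by apply: sq_itg; exact: sqZ].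
  by rewrite Ex_cst ExZ ?EX ?mulr0 ?addr0//; exact: sq_itg.
pose Q n w := (hull_len Z n w - EL n) / Num.sqrt (sigma2 * n%:R).
have sqrtE n : (Num.sqrt (sigma2 * n%:R))^-1 = t n / s.
  by rewrite sqrtrM ?(ltW sigma0)// invfM mulrC.
have sQ n : sq P (Q n).
  have := sqZ (Num.sqrt (sigma2 * n%:R))^-1 (sqB (sL n) (sq_cst P (EL n))).
  by congr (sq _ _); apply/funext => w; rewrite mulrC.
(* [V n] is exactly the centred 2 X_n on the same scale, so only the centred defect remains. At
   [n = 0] both sides vanish, as the inverse of 0 is 0. *)
have DE n w : Q n w - V n w = t n / s * (R_ n w - Ex P (R_ n)).
  rewrite /Q sqrtE VE -/(X n w) ELE LE; ring.
have nt n : (0 < n)%N -> n%:R * t n ^+ 2 = 1.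
  by move=> n0; rewrite /t exprVn sqr_sqrtr// divff// pnatr_eq0 -lt0n.
have D0 : Ex P (fun w => (Q n w - V n w) ^+ 2) @[n --> \oo] --> 0.
  apply/cvgrPdist_le => eps e0.
  (* Centring only decreases the second moment of the defect, and [theta = eps * s ^+ 2] absorbs the
     division by [sigma2 * n]. *)
  have th0 : 0 < eps * s ^+ 2 by rewrite mulr_gt0// exprn_gt0.
  have near0 := eR _ th0.
  near=> n.
  have n0 : (0 < n)%N by near: n; exact: nbhs_infty_gt.
  have hR : Ex P (fun w => R_ n w ^+ 2) <= eps * s ^+ 2 * n%:R by near: n; exact: near0.
  rewrite sub0r normrN ger0_norm; last by apply: Ex_ge0 => w; exact: sqr_ge0.
  rewrite (_ : (fun w => _) = fun w => (t n / s) ^+ 2 * (R_ n w - Ex P (R_ n)) ^+ 2); last first.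
    by apply/funext => w; rewrite DE exprMn.
  rewrite ExZ; last by have [] := sqB (sR n) (sq_cst P (Ex P (R_ n))).
  apply: (@le_trans _ _ ((t n / s) ^+ 2 * (eps * s ^+ 2 * n%:R))).
    by rewrite ler_wpM2l ?sqr_ge0// (le_trans (Ex_var_le (sR n))).
  have -> : (t n / s) ^+ 2 * (eps * s ^+ 2 * n%:R) = eps * (n%:R * t n ^+ 2) by field.
  by rewrite nt// mulr1.
have V1 n : (0 < n)%N -> Ex P (fun w => V n w ^+ 2) = 1.
  by move=> n0; have [_ ->] := psum_sq iidx sqx mean0 (t n) n; rewrite var1 mulr1 nt.
have cV A g g1 g2 : c3 A g g1 g2 -> Ex P (fun w => g (V n w)) @[n --> \oo] --> gconv 1 g 0.
  exact: (clt_smooth iidx sqx mean0 var1).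
have mV n : measurable_fun setT (V n) by exact: (sV n).1.
have mQ n : measurable_fun setT (Q n) by exact: (sQ n).1.
have iQV n : itg P (fun w => (Q n w - V n w) ^+ 2) by exact: (sqB (sQ n) (sV n)).2.
split; last exact: (@cvg_cdf_Phi _ _ _ P Q V mQ mV cV iQV D0 x).
pose Q' n w := (hull_len Z n w - EL n) / Num.sqrt (VarL n).
have sQ' n : sq P (Q' n).
  have := sqZ (Num.sqrt (VarL n))^-1 (sqB (sL n) (sq_cst P (EL n))).
  by congr (sq _ _); apply/funext => w; rewrite mulrC.
(* [VarL n] is [sigma2 * n] times the second moment of [Q n], so normalizing by it is
   [normalize_cvg] applied to [Q]; [n = 0] is excluded because the scale vanishes there. *)
have QQ' n w : (0 < n)%N -> Q' n w = Q n w / Num.sqrt (Ex P (fun w => Q n w ^+ 2)).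
  move=> n0.
  have p0 : 0 < sigma2 * n%:R by rewrite mulr_gt0// ltr0n.
  have -> : Ex P (fun w => Q n w ^+ 2) = (sigma2 * n%:R)^-1 * VarL n.
    have -> : VarL n = Ex P (fun w => (hull_len Z n w - EL n) ^+ 2) by [].
    rewrite -ExZ; last first.
      by have [] := sqB (sL n) (sq_cst P (EL n)).
    congr (Ex P _); apply/funext => w'.
    by rewrite /Q expr_div_n sqr_sqrtr ?(ltW p0)// mulrC.
  rewrite sqrtrM ?invr_ge0 ?(ltW p0)// sqrtrV ?(ltW p0)// /Q /Q' invfM invrK.
  by rewrite mulrA divfK// gt_eqF// sqrtr_gt0.
have D0' := normalize_cvg sV sQ V1 D0.
have DQ' : Ex P (fun w => (Q' n w - V n w) ^+ 2) @[n --> \oo] --> 0.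
  apply: cvg_trans D0'; apply: near_eq_cvg; near=> n.
  have n0 : (0 < n)%N by near: n; exact: nbhs_infty_gt.
  by congr (Ex P _); apply/funext => w; rewrite -QQ'.
have mQ' n : measurable_fun setT (Q' n) by exact: (sQ' n).1.
have iQV' n : itg P (fun w => (Q' n w - V n w) ^+ 2).
  exact: (sqB (sQ' n) (sV n)).2.
exact: (@cvg_cdf_Phi _ _ _ P Q' V mQ' mV cV iQV' DQ' x).
Unshelve. all: end_near. Qed.
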